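(* Let $\Gamma$ be a countable group and $\Gamma\curvearrowright(B,\nu)$ an essentially free measure-class-preserving action on a standard probability space. Assume there is $\lambda\in(0,1)$ such that $R_\lambda(g,b)=\log_\lambda\left(\frac{d\nu\circ g}{d\nu}(b)\right)\in\mathbb{Z}$ for every $g\in\Gamma$ and a.e. $b\in B$. Let $\Gamma$ act on $B\times\mathbb{Z}$ by $g(b,n)=(gb,n+R_\lambda(g,b))$. Let $N\ge1$ be an integer, $I=\{0,\dots,N-1\}$, let $\mathcal{R}_I$ be the restriction to $B\times I$ of the orbit equivalence relation on $B\times\mathbb{Z}$, and let $\theta_{\lambda,I}(\{n\})=\frac{\lambda^{-n}}{1+\cdots+\lambda^{-N+1}}$ for $n\in I$. Let $\Gamma\curvearrowright(X,\mu)$ be a p.m.p. action, let $\Gamma$ act on $B\times X\times\mathbb{Z}$ by $g(b,x,n)=(gb,gx,n+R_\lambda(g,b))$, and let $\widetilde{\mathcal{R}}_I$ be the restriction of its orbit equivalence relation to $B\times X\times I$. Let $\mathcal{F}=\{\mathcal{F}_r\}_{r\in\mathbb{I}}$ be a Borel family of (nonempty) subset functions for $(B\times I,\nu\times\theta_{\lambda,I},\mathcal{R}_I)$ which is either regular or (asymptotically invariant, uniform and tempered). Let $\pi(b,x,t)=(b,t)$ and $\widetilde{\mathcal{F}}_r(b,x,t)=\pi^{-1}(\mathcal{F}_r(b,t))\cap[b,x,t]$, where $[b,x,t]$ is the $\widetilde{\mathcal{R}}_I$-class of $(b,x,t)$. Let $\psi\in L^1(B,\nu)$ be a probability density. For $f\in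 L^1(B\times X\times I,\nu\times\mu\times\theta_{\lambda,I})$ define $$\mathbb{M}[f|\widetilde{\mathcal{F}},\psi](x)=\sup_{r\in\mathbb{I}}\int_B\frac1N\sum_{t=0}^{N-1}\mathbb{A}[|f|\,|\widetilde{\mathcal{F}}_r](b,x,t)\,\psi(b)\,d\nu(b).$$ Then: (1) there are constants $C_p$ for $p>1$ such that for every $f\in L^p(B\times X\times I)$, if $\frac1p+\frac1q=1$, then $\|\mathbb{M}[f|\widetilde{\mathcal{F}},\psi]\|_p\le C_p\|\psi\|_q\|f\|_p$; (2) there is a constant $C_1>0$ such that if $f\in L\log L(B\times X\times I)$ and $\psi\in L^\infty(B)$, then $\|\mathbb{M}[f|\widetilde{\mathcal{F}},\psi]\|_1\le C_1\|\psi\|_\infty\|f\|_{L\log L}$. The constants $C_p$, $p\ge1$, do not depend on $f$ or on the action $\Gamma\curvearrowright(X,\mu)$, but they may depend on $p$ and $N$.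
   Context: $\mathbb{I}$ denotes either $\mathbb{N}$ or $\mathbb{R}_{>0}$; p.m.p. means probability-measure-preserving (on a standard probability space). Essentially free means a.e. stabilizer is trivial. A probability density on $(B,\nu)$ is $\psi\ge0$ with $\int\psi\,d\nu=1$. $\|\cdot\|_{L\log L}$ is the standard Orlicz (Luxemburg) norm of $L\log L$, e.g. for the Young function $s\log(1+s)$; $\|\psi\|_q=\infty$ is allowed (then the bound is vacuous). Subset functions. Write $(Y,m,\mathcal{R})=(B\times I,\nu\times\theta_{\lambda,I},\mathcal{R}_I)$; $m$ is $\mathcal{R}$-invariant and the classes $[y]$ are countable. Let $c$ be counting measure. $\mathrm{Inn}(\mathcal{R})$ is the group of Borel automorphisms of $Y$ with graph contained in $\mathcal{R}$. $\Psi\subset\mathrm{Inn}(\mathcal{R})$ generates $\mathcal{R}$ if for $(m\times c)$-a.e. $(y,y')\in\mathcal{R}$ there is $\phi$ in the group generated by $\Psi$ with $\phi(y)=y'$. A subset function $U$ assigns to each $y\in Y$ a subset $U(y)\subset[y]$; $U^{-1}(y)=\{z: y\in U(z)\}$; $U_1U_2(y)=\bigcup_{z\in U_2(y)}U_1(z)$. A Borel family of subset functions is a family $\mathcal{F}=\{\mathcal{F}_r\}_{r\in\mathbb{I}}$ of subset functions with $\{(y,z,r): z\in\mathcal{F}_r(y)\}$ Borel and $\bigcup_{s\le r}\mathcal{F}_s(y)$ finite for all $y,r$; ''nonempty'' means $|\mathcal{F}_r(y)|\ge1$ for a.e. $y$ and all $r$. $\mathcal{F}$ is: (i) asymptotically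 invariant if $|\mathcal{F}_r(y)|\ge1$ for a.e. $y$ and all $r$, and there is a countable generating set $\Psi\subset\mathrm{Inn}(\mathcal{R})$ such that for every $\phi\in\Psi$ and a.e. $y$, $\lim_{r\to\infty}|\mathcal{F}_r(y)\,\Delta\,\phi(\mathcal{F}_r(y))|/|\mathcal{F}_r(y)|=0$; (ii) uniform if there are constants $C_u,a_r,b_r>0$ with $b_r\le C_ua_r$, $a_r\le|\mathcal{F}_r(y)|\le b_r$ and $a_r\le|\mathcal{F}_r^{-1}(y)|\le b_r$ for all $r$ and a.e. $y$; (iii) regular if there is $C_{reg}>0$ with $\left|\bigcup_{s\le r}\mathcal{F}_s^{-1}\mathcal{F}_r(y)\right|\le C_{reg}|\mathcal{F}_r(y)|$ for a.e. $y$ and every $r$; (iv) tempered if $\mathbb{I}=\mathbb{N}$ and there is $C_t$ with $\left|\bigcup_{m\le n-1}\mathcal{F}_m^{-1}\mathcal{F}_n(y)\right|\le C_t|\mathcal{F}_n(y)|$ for a.e. $y$ and every $n$. Averages: $\mathbb{A}[f|\widetilde{\mathcal{F}}_r](z)=\frac{1}{|\widetilde{\mathcal{F}}_r(z)|}\sum_{z'\in\widetilde{\mathcal{F}}_r(z)}f(z')$. *)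

(* Defs.v *)
From HB Require Import structures.
From mathcomp Require Import all_boot all_order all_algebra.
From mathcomp Require Import all_classical all_reals all_analysis.

Set Implicit Arguments.
Unset Strict Implicit.
Unset Printing Implicit Defensive.

Import Order.TTheory GRing.Theory Num.Theory.
Import numFieldNormedType.Exports.

Local Open Scope classical_set_scope.
Local Open Scope ring_scope.

(* A standard Borel space: Borel isomorphic to a Polish space. *)
Definition standard_borel (R : realType) d (T : measurableType d) : Prop :=
  exists (S : completePseudoMetricType R) (e : T -> S),
    [/\ hausdorff_space S,
        exists2 D : set S, countable D & dense D,
        bijective e &
        forall A : set T, measurable A <->
          exists2 U : set S, <<s [set V : set S | open V] >> U & A = e @^-1` U].

Section finite_discrete.
Variable n : nat.

HB.instance Definition _ := isPointed.Build 'I_n.+1 ord0.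

HB.instance Definition _ := @isMeasurable.Build default_measure_display
  'I_n.+1 discrete_measurable discrete_measurable0
  discrete_measurableC discrete_measurableU.

End finite_discrete.

(* theta_{lambda,I} on I = {0, ..., N - 1} with N = n.+1.  The weights use the
   real power `^ because it is nonnegative for every base, so that theta is a
   probability without a side condition on lambda; for lambda > 0,
   lambda `^ (- k%:R) is lambda^(-k). *)
Section theta.
Local Open Scope ereal_scope.
Context {R : realType} (lambda : R) (n : nat).

Definition theta_weight (k : nat) : R :=
  (lambda `^ (- k%:R) / \sum_(j < n.+1) lambda `^ (- j%:R))%R.

Lemma theta_weight_ge0 k : (0 <= theta_weight k)%R.
Proof.
by rewrite divr_ge0 ?powR_ge0// sumr_ge0// => i _; exact: powR_ge0.
Qed.

Definition theta : set 'I_n.+1 -> \bar R :=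
  msum (fun k => mscale (NngNum (theta_weight_ge0 k)) \d_(inord k : 'I_n.+1))
    n.+1.

HB.instance Definition _ := Measure.on theta.

Let theta_setT : theta [set: 'I_n.+1] = 1.
Proof.
transitivity (\sum_(k < n.+1) (theta_weight k)%:E).
  by apply: eq_bigr => k _; rewrite /= /mscale/= diracT mule1.
rewrite sumEFin -mulr_suml divff// gt_eqF// big_ord_recl oppr0 powRr0.
by rewrite ltr_wpDr// sumr_ge0// => i _; exact: powR_ge0.
Qed.

HB.instance Definition _ :=
  Measure_isProbability.Build _ _ R theta theta_setT.

Lemma theta_set1 (t : 'I_n.+1) : theta [set t] = (theta_weight t)%:E.
Proof.
transitivity (\sum_(k < n.+1 | k == t) (theta_weight k)%:E); last first.
  by rewrite big_pred1_eq.
rewrite big_mkcond; apply: eq_bigr => k _.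
rewrite /= /mscale/= diracE inord_val; case: eqVneq => [->|kt].
  by rewrite mem_set// mule1.
by rewrite memNset ?mule0//= => tk; rewrite tk eqxx in kt.
Qed.

End theta.
Arguments theta {R} lambda n.

Section actions.
Context (Gamma : groupType).

Definition is_action T (act : Gamma -> T -> T) : Prop :=
  (forall x, act 1%g x = x) /\
  (forall g h x, act (g * h)%g x = act g (act h x)).

Definition orbit_rel T (act : Gamma -> T -> T) (x y : T) : Prop :=
  exists g, y = act g x.

Definition diag_action T1 T2 (a1 : Gamma -> T1 -> T1) (a2 : Gamma -> T2 -> T2)
  (g : Gamma) (x : T1 * T2) : T1 * T2 := (a1 g x.1, a2 g x.2).

Definition skew_action T (act : Gamma -> T -> T) (rho : Gamma -> T -> int)
  (g : Gamma) (x : T * int) : T * int := (act g x.1, x.2 + rho g x.1).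

Definition restricted_rel T N (act : Gamma -> T -> T) (rho : Gamma -> T -> int)
  (x y : T * 'I_N) : Prop :=
  orbit_rel (skew_action act rho) (x.1, (x.2 : nat)%:Z) (y.1, (y.2 : nat)%:Z).

Context {R : realType} d {T : measurableType d}.

Definition class_preserving (P : probability T R) (act : Gamma -> T -> T) :=
  forall g A, measurable A -> P (act g @^-1` A) = 0%E <-> P A = 0%E.

Definition measure_preserving (P : probability T R) (act : Gamma -> T -> T) :=
  forall g A, measurable A -> P (act g @^-1` A) = P A.

Definition essentially_free (P : probability T R) (act : Gamma -> T -> T) :=
  {ae P, forall x, forall g, act g x = x -> g = 1%g}.

(* log_lambda (d(P o g)/dP); since (P o g)(A) = P (g A), the measure P o g is
   the image of P under g^-1. *)
Definition log_RN (lambda : R) (P : probability T R)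
    (act : Gamma -> {mfun T >-> T}) (g : Gamma) (x : T) : R :=
  ln (fine (Radon_Nikodym
    (charge_of_finite_measure (distribution P (act (g^-1)%g))) P x)) /
  ln lambda.

(* Radon-Nikodym derivatives are only defined up to null sets, whereas the
   action on T x Z needs an everywhere defined cocycle: rho is a strict
   integer-valued Borel version of log_RN. *)
Record log_RN_cocycle (lambda : R) (P : probability T R)
    (act : Gamma -> {mfun T >-> T}) (rho : Gamma -> T -> int) : Prop := {
  rho_measurable : forall g k, measurable [set x | rho g x = k] ;
  rho_cocycle : forall g h x,
    rho (g * h)%g x = rho g (act h x) + rho h x ;
  rho_log_RN : forall g, {ae P, forall x, log_RN lambda P act g x = (rho g x)%:~R}
}.

End actions.

(* The index set, N or the positive reals, is a subset of R; families are
   functions on R whose values outside the index set are irrelevant. *)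
Section index_sets.
Context {R : realType}.
Definition nat_index : set R := range (fun n : nat => n%:R).
Definition pos_index : set R := [set r : R | 0 < r].
End index_sets.

Section subset_functions.
Context {T : Type}.
Definition sf_inv (U : T -> set T) (y : T) : set T := [set z | U z y].
Definition sf_comp (U1 U2 : T -> set T) (y : T) : set T :=
  \bigcup_(z in U2 y) U1 z.
End subset_functions.

Inductive generated_group (T : Type) (Psi : set (T -> T)) : (T -> T) -> Prop :=
| gen_id : generated_group Psi idfun
| gen_mul phi chi :
    Psi phi -> generated_group Psi chi -> generated_group Psi (phi \o chi)
| gen_inv phi phi' chi : Psi phi -> cancel phi phi' -> cancel phi' phi ->
    generated_group Psi chi -> generated_group Psi (phi' \o chi).

Section families.
Context {R : realType} d {Y : measurableType d}.
Variables (m : {measure set Y -> \bar R}) (rel : Y -> Y -> Prop).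
Variables (II : set R) (F : R -> Y -> set Y).
Local Open Scope ereal_scope.

Definition Inn : set (Y -> Y) :=
  [set phi | (forall y, rel y (phi y)) /\
    exists phi', [/\ cancel phi phi', cancel phi' phi,
      measurable_fun setT phi & measurable_fun setT phi']].

(* m x c on the relation, c being the counting measure *)
Definition rel_measure (E : set (Y * Y)) : \bar R :=
  \int[m]_y counting (xsection E y).

Definition generates (Psi : set (Y -> Y)) : Prop :=
  exists N : set (Y * Y),
    [/\ measurable N, N `<=` [set u | rel u.1 u.2], rel_measure N = 0 &
      forall y y', rel y y' -> ~ N (y, y') ->
        exists2 phi, generated_group Psi phi & phi y = y'].

Definition borel_family : Prop :=
  [/\ forall r y, II r -> F r y `<=` rel y,
      measurable [set u : Y * Y * measurableTypeR R |
        II u.2 /\ F u.2 u.1.1 u.1.2] &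
      forall r y, II r ->
        finite_set (\bigcup_(s in [set s | II s /\ (s <= r)%R]) F s y)].

Definition nonempty_family : Prop :=
  {ae m, forall y, forall r, II r -> F r y !=set0}.

Definition asymptotically_invariant : Prop :=
  nonempty_family /\
  exists Psi : set (Y -> Y),
    [/\ countable Psi, Psi `<=` Inn, generates Psi &
      forall phi, Psi phi -> {ae m, forall y,
        (fun r => fine (counting (F r y `+` phi @` F r y) : \bar R) /
                  fine (counting (F r y) : \bar R))%R
        @ within II (pinfty_nbhs R) --> (0 : R)%R}].

Definition uniform_family : Prop :=
  exists (Cu : R) (a b : R -> R), (0 < Cu)%R /\
    forall r, II r -> [/\ (0 < a r)%R, (0 < b r)%R, (b r <= Cu * a r)%R &
      {ae m, forall y,
        (a r)%:E <= counting (F r y) <= (b r)%:E /\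
        (a r)%:E <= counting (sf_inv (F r) y) <= (b r)%:E}].

Definition regular_family : Prop :=
  exists2 Creg : R, (0 < Creg)%R &
    {ae m, forall y, forall r, II r ->
      counting (\bigcup_(s in [set s | II s /\ (s <= r)%R])
                  sf_comp (sf_inv (F s)) (F r) y)
      <= Creg%:E * counting (F r y)}.

Definition tempered_family : Prop :=
  II = nat_index /\
  exists Ct : R, {ae m, forall y, forall n : nat,
    counting (\bigcup_(k < n) sf_comp (sf_inv (F k%:R)) (F n%:R) y)
    <= Ct%:E * counting (F n%:R y)}.

End families.

(* A[f | U](z); for z in the null set where U z may be infinite the value is 0. *)
Definition average (R : realType) (T : choiceType) (U : T -> set T) (f : T -> R)
    (z : T) : R :=
  (fine (counting (U z) : \bar R))^-1 * \sum_(z' \in U z) f z'.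

Definition lift_family (R : realType) (B X I : Type)
    (rel : B * X * I -> B * X * I -> Prop) (F : R -> B * I -> set (B * I))
    (r : R) (z : B * X * I) : set (B * X * I) :=
  (fun u => (u.1.1, u.2)) @^-1` F r (z.1.1, z.2) `&` rel z.

Section maximal.
Local Open Scope ereal_scope.
Context {R : realType} d1 {B : measurableType d1} d2 {X : measurableType d2}.
Context {N : nat}.

Definition maximal (nu : probability B R) (II : set R)
    (F : R -> B * X * 'I_N -> set (B * X * 'I_N)) (psi : B -> R)
    (f : B * X * 'I_N -> R) (x : X) : \bar R :=
  ereal_sup [set \int[nu]_b
    (N%:R^-1 * (\sum_(t < N) average (F r) (fun z => `|f z|) (b, x, t))
     * psi b)%:E | r in II].

End maximal.

Definition prob_density (R : realType) d (B : measurableType d)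
    (nu : probability B R) (psi : B -> R) : Prop :=
  [/\ measurable_fun setT psi, forall b, 0 <= psi b &
      (\int[nu]_b (psi b)%:E = 1)%E].

Section orlicz.
Local Open Scope ereal_scope.
Context {R : realType} d {T : measurableType d}.
Variable m : {measure set T -> \bar R}.

Definition luxemburg_norm (Phi : R -> R) (f : T -> R) : \bar R :=
  ereal_inf [set k%:E | k in
    [set k : R | (0 < k)%R /\ \int[m]_x (Phi (`|f x| / k)%R)%:E <= 1]].

Definition LlogL_norm : (T -> R) -> \bar R :=
  luxemburg_norm (fun s => s * ln (1 + s))%R.

Definition LlogL : set (T -> R) :=
  [set f | measurable_fun setT f /\ LlogL_norm f < +oo].

End orlicz.

(* Main.v *)
(* Up to a null set, the classes of [B x X x I] are parametrized by the group,
   so that the averages become sums over finite sets of group elements acting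
   partially on [B x X x I], and invariance of the measure becomes a mass
   transport principle.  A fractional version of the Vitali covering argument
   (each set covers its points by the proportion left uncovered by the
   previous ones, so that no disjoint subfamily has to be selected) gives a
   weak type (1,1) maximal inequality on [B x X x I], with a constant that
   depends only on [F].  When the index set is uncountable, the radius realizing
   a large average is chosen by a measurable selection.  The levels [a 2^k / 2]
   turn the weak type inequality into an integrable majorant of the [p]-th power
   of the averages, uniform in [r]; integrating it in [b] against [psi], with
   Hoelder's inequality, bounds the maximal function. *)

Require Import Defs.
From HB Require Import structures.
From mathcomp Require Import all_boot all_order all_algebra.
From mathcomp Require Import all_classical all_reals all_analysis.
From mathcomp Require Import measurable_realfun.
From mathcomp Require Import ring lra.

Set Implicit Arguments.
Unset Strict Implicit.
Unset Printing Implicit Defensive.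

Import Order.TTheory GRing.Theory Num.Theory.
Import numFieldNormedType.Exports.

Local Open Scope classical_set_scope.
Local Open Scope ring_scope.

(** * Measurable selection *)

(** The covering constant has two sources. A candidate that is already half covered must meet
    earlier good sets, and such meetings are limited by [C]; a candidate that stays good contributes
    its own size, and this is where [kappa^-1] enters. Every candidate therefore needs a schedule of
    steps that gives it a fixed total weight while larger radii are treated before it. The two kinds
    of families obstruct this differently. Temperedness compares a radius with strictly smaller ones
    only, so uniformity has to control the candidates of equal radius, all treated in one step.
    Regularity compares equal radii as well, but the radii may accumulate and the sets have no
    common size; a gap between radii and a bound on sizes are restored on sets that exhaust the
    domain, with a constant that does not see the exhaustion. All counting is done with group
    elements indexed by points of [B * I], hence the uniformity in [X]. The cases [p > 1] and L log
    L differ only in the sum over levels: a geometric sum dominated by its last term, or a number of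
    levels, which is logarithmic. *)

Section outer_hull.
Local Open Scope ereal_scope.
Context {R : realType} d {Z : measurableType d}.
Variable m : {measure set Z -> \bar R}.
Hypothesis m_fin : m setT < +oo.

(** Projections along [R] of measurable sets need not be measurable, so they are measured from
    outside. *)
Definition outer (A : set Z) : \bar R :=
  ereal_inf [set m M | M in [set M | measurable M /\ A `<=` M]].

Lemma outer_le A M : measurable M -> A `<=` M -> outer A <= m M.
Proof. by move=> mM AM; apply: ereal_inf_lbound; exists M. Qed.

Lemma outer_ge0 A : 0 <= outer A.
Proof. by apply: le_ereal_inf_tmp => _ [M _ <-]. Qed.

Lemma outer_fin A : outer A \is a fin_num.
Proof.
rewrite ge0_fin_numE ?outer_ge0//; apply: le_lt_trans m_fin.
exact: outer_le.
Qed.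

Lemma le_outer A A' : A `<=` A' -> outer A <= outer A'.
Proof.
move=> AA'; apply: le_ereal_inf_tmp => _ [M [mM A'M] <-].
by apply: outer_le => //; exact: subset_trans A'M.
Qed.

Lemma outer_hull A : exists M, [/\ measurable M, A `<=` M & m M = outer A].
Proof.
have /choice[M HM] (k : nat) : exists M,
    [/\ measurable M, A `<=` M & m M < outer A + k.+1%:R^-1%:E].
  have [_ [M [mM AM] <-] lt] := lb_ereal_inf_adherent
    (S := [set m M | M in [set M | measurable M /\ A `<=` M]])
    (e := k.+1%:R^-1) ltac:(by rewrite invr_gt0) (outer_fin A).
  by exists M.
have mI : measurable (\bigcap_k M k).
  by apply: bigcapT_measurable => k; have [] := HM k.
exists (\bigcap_k M k); split => //.
  by move=> z Az k _; have [_ + _] := HM k; exact.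
apply/eqP; rewrite eq_le; apply/andP; split; last first.
  by apply: outer_le => // z Az k _; have [_ + _] := HM k; exact.
apply/lee_addgt0Pr => e e0.
have [k ke] : exists k : nat, (k.+1%:R^-1 < e)%R.
  exists (Num.truncn e^-1); rewrite invf_plt ?posrE//.
  exact: truncnS_gt.
have [mMk _ /ltW lk] := HM k.
apply: le_trans (le_trans (le_measure _ _ _ _) (le_trans lk _)).
- exact: lexx.
- by rewrite inE.
- by rewrite inE.
- exact: bigcap_inf.
- by rewrite leeD2l// lee_fin ltW.
Qed.

(** Continuity from below survives without measurability: the intersection [B n] of the hulls of
    [A k] for [k >= n] increases with [n] and lies between [A n] and its hull. *)
Lemma outer_bigcup (A : (set Z)^nat) c : nondecreasing_seq A ->
  c < outer (\bigcup_n A n) -> exists n, c < outer (A n).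
Proof.
move=> ndA; apply: contraPP => /forallNP H; apply/negP; rewrite -leNgt.
have {}H n : outer (A n) <= c by rewrite leNgt; apply/negP/H.
have /choice[M HM] n := outer_hull (A n).
pose B n := \bigcap_(k in [set k | (n <= k)%N]) M k.
have mB n : measurable (B n).
  by apply: bigcap_measurable => [|k _]; [exists n => /= | have [] := HM k].
have ndB : nondecreasing_seq B.
  move=> i j ij; apply/subsetPset => z Bz k /= jk; apply: Bz => /=.
  exact: leq_trans jk.
have mU : measurable (\bigcup_n B n) by exact: bigcupT_measurable.
apply: (@le_trans _ _ (m (\bigcup_n B n))).
  apply: outer_le => // z [n _ Az]; exists n => // k /= nk.
  have [_ + _] := HM k; apply.
  by move: (ndA _ _ nk) => /subsetPset; exact.
have cv := @nondecreasing_cvg_mu _ _ _ m B mB mU ndB.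
rewrite -(cvg_lim _ cv)//; apply: lime_le.
  by apply/cvg_ex; eexists; exact: cv.
apply: nearW => n /=; apply: le_trans (H n).
have [mM _ <-] := HM n.
apply: le_measure; rewrite ?inE//.
by apply: bigcap_inf => /=.
Qed.

End outer_hull.

(** * Souslin sets in [Z * R] *)

Section souslin.
Context {R : realType} d {Z : measurableType d}.

(** The Souslin operation applied to measurable-by-closed rectangles. The rectangle of rank [k]
    depends on the first [k] entries of the branch only; the closed factors in [R] are what
    compactness will act on. *)
Definition souslin (E : set (Z * R)) : Prop :=
  exists (A : nat -> (nat -> nat) -> set Z) (K : nat -> (nat -> nat) -> set R),
  [/\ forall k s, measurable (A k s),
      forall k s, closed (K k s),
      forall k s s', (forall i, (i < k)%N -> s i = s' i) ->
        A k s = A k s' /\ K k s = K k s' &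
      E = [set u | exists s, forall k, A k s u.1 /\ K k s u.2]].

Lemma souslin_setX (A : set Z) (K : set R) :
  measurable A -> closed K -> souslin (A `*` K).
Proof.
move=> mA cK; exists (fun _ _ => A), (fun _ _ => K); split => //.
apply/seteqP; split => -[z r] /=; first by move=> [Az Kr]; exists id.
by move=> [s /(_ 0%N)].
Qed.

(** The first entry of a branch names a member of the union and the other entries form a branch for
    it; rank 0 carries [setT] to make room for the shift. *)
Lemma souslin_bigcup (E : (set (Z * R))^nat) :
  (forall i, souslin (E i)) -> souslin (\bigcup_i E i).
Proof.
move=> /choice[A /choice[K AK]].
exists (fun k s => if k is k'.+1 then A (s 0%N) k' (fun j => s j.+1) else setT),
  (fun k s => if k is k'.+1 then K (s 0%N) k' (fun j => s j.+1) else setT).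
split.
- by move=> [|k] s //; have [+ _ _ _] := AK (s 0%N); exact.
- by move=> [|k] s; [exact: closedT | have [_ + _ _] := AK (s 0%N); exact].
- move=> [|k] s s' ss' //; rewrite (ss' 0%N)//.
  have [_ _ + _] := AK (s' 0%N); apply => i ik.
  exact: ss'.
- apply/seteqP; split => -[z r] /=.
    move=> [i _]; have [_ _ _ ->] := AK i; move=> [s Hs] /=.
    exists (fun j => if j is j'.+1 then s j' else i) => -[|k]//=; exact: Hs.
  move=> [s Hs]; exists (s 0%N) => //; have [_ _ _ ->] := AK (s 0%N).
  by exists (fun j => s j.+1) => k; exact: (Hs k.+1).
Qed.

(** The bijection given by n + 1 = 2^i (2j + 1); the exponent of 2 recovers [i]. *)
Let code (i j : nat) : nat := (2 ^ i * j.*2.+1).-1.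
Let dec1 (n : nat) : nat := logn 2 n.+1.
Let dec2 (n : nat) : nat := (n.+1 %/ 2 ^ dec1 n)./2.

Let codeS i j : (code i j).+1 = (2 ^ i * j.*2.+1)%N.
Proof. by rewrite prednK// muln_gt0 expn_gt0. Qed.

Let dec1K i j : dec1 (code i j) = i.
Proof.
rewrite /dec1 codeS lognM ?expn_gt0// pfactorK//.
rewrite (@logn_coprime 2 j.*2.+1) ?addn0//.
by rewrite prime_coprime// dvdn2 /= odd_double.
Qed.

Let dec2K i j : dec2 (code i j) = j.
Proof.
by rewrite /dec2 dec1K codeS mulKn ?expn_gt0// /= uphalf_double.
Qed.

Let decK n : code (dec1 n) (dec2 n) = n.
Proof.
apply: succn_inj; rewrite codeS /dec2 /dec1.
have [r c e] := pfactor_coprime (isT : prime 2) (ltn0Sn n).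
have r2 : r = r./2.*2.+1.
  by move: c; rewrite coprime2n => ro; rewrite -{1}(odd_double_half r) ro.
have -> : (n.+1 %/ 2 ^ logn 2 n.+1 = r)%N by rewrite {1}e mulnK ?expn_gt0.
by rewrite -r2 mulnC -e.
Qed.

Let code_lt i j k : (j < k)%N -> (code i j < code i k)%N.
Proof.
move=> jk; rewrite -ltnS !codeS ltn_pmul2l ?expn_gt0//.
by rewrite ltnS ltn_double.
Qed.

(** Countably many branches are interleaved into one. Since [code i j] increases with [j], the first
    [n] entries of the merged branch contain the first [dec2 n] entries of branch number [dec1 n],
    which gives locality. *)
Lemma souslin_bigcap (E : (set (Z * R))^nat) :
  (forall i, souslin (E i)) -> souslin (\bigcap_i E i).
Proof.
move=> /choice[A /choice[K AK]].
exists (fun n s => A (dec1 n) (dec2 n) (fun j => s (code (dec1 n) j))),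
  (fun n s => K (dec1 n) (dec2 n) (fun j => s (code (dec1 n) j))).
split.
- by move=> n s; have [+ _ _ _] := AK (dec1 n); exact.
- by move=> n s; have [_ + _ _] := AK (dec1 n); exact.
- move=> n s s' ss'; have [_ _ + _] := AK (dec1 n); apply => j jn.
  by apply: ss'; rewrite -[ltnRHS]decK code_lt.
- apply/seteqP; split => -[z r] /=.
    move=> Ezr; have /choice[s Hs] (i : nat) :
        exists s, forall k, A i k s z /\ K i k s r.
      by have := Ezr i I; have [_ _ _ ->] := AK i.
    exists (fun n => s (dec1 n) (dec2 n)) => n.
    suff -> : (fun j => s (dec1 (code (dec1 n) j)) (dec2 (code (dec1 n) j)))
        = s (dec1 n) by exact: Hs.
    by apply/funext => j; rewrite dec1K dec2K.
  move=> [s Hs] i _; have [_ _ _ ->] := AK i.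
  exists (fun j => s (code i j)) => k.
  by have := Hs (code i k); rewrite dec1K dec2K.
Qed.

(** Souslin sets are not stable under complement in general, so the induction runs over the sets
    that are Souslin together with their complement; these form a sigma-algebra containing the
    rectangles. *)
Lemma souslin_measurable (W : set (Z * measurableTypeR R)) :
  measurable W -> souslin (W : set (Z * R)).
Proof.
pose D : set (set (Z * R)) := [set E | souslin E /\ souslin (~` E)].
have D0 : D set0.
  split.
    by rewrite -(@setX0 _ R set0); apply: souslin_setX => //; exact: closed0.
  by rewrite setC0 -setXTT; apply: souslin_setX => //; exact: closedT.
have DC E : D E -> D (~` E) by move=> [? ?]; split => //; rewrite setCK.
have DU (E : (set (Z * R))^nat) : (forall i, D (E i)) -> D (\bigcup_i E i).
  move=> DE; split; first by apply: souslin_bigcup => i; have [] := DE i.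
  by rewrite setC_bigcup; apply: souslin_bigcap => i; have [] := DE i.
have DI E E' : D E -> D E' -> D (E `&` E').
  move=> DE DE'; rewrite -[_ `&` _]setCK setCI; apply: (DC (_ `|` _)).
  rewrite -bigcup2E; apply: DU => -[|[|i]] //=; exact: DC.
have DZ A : measurable A -> D (A `*` setT).
  move=> mA; split; first by apply: souslin_setX => //; exact: closedT.
  rewrite (_ : ~` _ = ~` A `*` setT); last first.
    by apply/seteqP; split => -[z r] /=; tauto.
  by apply: souslin_setX; [exact: measurableC|exact: closedT].
have DR : @measurable _ (measurableTypeR R) `<=`
    [set B : set R | D (setT `*` B)].
  rewrite RGenOInfty.measurableE; apply: smallest_sub.
    split => /=.
    - by rewrite setX0.
    - move=> B DB; rewrite setTD (_ : _ `*` _ = ~` (setT `*` B)).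
        exact: DC.
      by apply/seteqP; split => -[z r] /=; tauto.
    - move=> F DF; rewrite (_ : _ `*` _ = \bigcup_i (setT `*` F i)).
        exact: DU.
      by apply/seteqP; split => -[z r] /= => [[_ [i _ ?]]|[i _ [_ ?]]];
        [exists i|split => //; exists i].
  move=> _ [x ->] /=; split; last first.
    rewrite (_ : ~` _ = setT `*` [set` `]-oo, x]]); last first.
      apply/seteqP; split => -[z r] /=; rewrite !in_itv/= ?andbT.
        by move=> h; split => //; rewrite leNgt; apply/negP => ?; exact: h.
      by move=> [_ rx] [_]; rewrite ltNge rx.
    by apply: souslin_setX => //; exact: interval_closed.
  rewrite (_ : _ `*` _ =
    \bigcup_(k : nat) (setT `*` [set` `[x + k.+1%:R^-1, +oo[])); last first.
    apply/seteqP; split => -[z r] /=; rewrite !in_itv/= ?andbT.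
      move=> [_ xr]; exists (Num.truncn (r - x)^-1) => //; split => //=.
      rewrite in_itv/= andbT addrC -lerBrDr ltW// invf_plt ?posrE// ?subr_gt0//.
      exact: truncnS_gt.
    move=> [k _ [_ /=]]; rewrite in_itv/= andbT => xr; split => //.
    by apply: lt_le_trans xr; rewrite ltrDl invr_gt0.
  by apply: souslin_bigcup => k; apply: souslin_setX => //;
    exact: interval_closed.
move=> mW; suff [] : D W by [].
move: W mW; rewrite measurable_prod_measurableType; apply: smallest_sub.
  by split => //= E; rewrite setTD; exact: DC.
move=> _ [A mA [B mB <-]].
rewrite (_ : A `*` B = (A `*` setT) `&` (setT `*` B)).
  by apply: DI; [exact: DZ|exact: DR].
by apply/seteqP; split => -[z r] /=; tauto.
Qed.

End souslin.

(** * Measurable choice of a radius *)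

Section selection.
Context {R : realType} d {Z : measurableType d}.
Implicit Types (A : nat -> (nat -> nat) -> set Z).
Implicit Types (K : nat -> (nat -> nat) -> set R).

Let local A K := forall k s s', (forall i, (i < k)%N -> s i = s' i) ->
  A k s = A k s' /\ K k s = K k s'.

(* Compactness of the box [prod_i {0..beta i}] times a segment turns
   approximate branches through z into a genuine one. *)
Let branch_limit A K (beta : nat -> nat) (a b : R) z :
  (forall k s, closed (K k s)) -> local A K ->
  (forall n : nat, exists s r, [/\ forall i, (s i <= beta i)%N,
    a <= r <= b + n.+1%:R^-1 &
    forall k, (k <= n)%N -> A k s z /\ K k s r]) ->
  exists s r, [/\ forall i, (s i <= beta i)%N, a <= r <= b &
    forall k, A k s z /\ K k s r].
Proof.
move=> cK locAK /choice[s /choice[r H]].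
pose box : set (prod_topology (fun _ : nat => nat)) :=
  [set f | forall i, [set j | (j <= beta i)%N] (f i)].
have cj i : compact ([set j | (j <= beta i)%N] : set nat).
  apply: finite_compact.
  by apply: (@sub_finite_set _ _ `I_(beta i).+1); [move=> j /=|exact: finite_II].
have cbox : compact box := tychonoff cj.
pose C := box `*` [set` `[a, b + 1]].
have cC : compact C by apply: compact_setX => //; exact: segment_compact.
pose u (n : nat) : prod_topology (fun _ : nat => nat) * R := (s n, r n).
have uC : (u @ \oo) C.
  exists 0%N => // n _; have [sb /andP[ar rb] _] := H n; split => //=.
  by rewrite in_itv/= ar (le_trans rb)// lerD2l invf_le1 ?ltr0n// ler1n.
have [[sg rr] [[/= sgb]]] := cC _ _ uC.
rewrite in_itv/= => /andP[arr _] clu.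
have near_branch k V : nbhs rr V -> exists n, [/\ (k <= n)%N,
    forall i, (i < k)%N -> s n i = sg i & V (r n)].
  move=> Vrr.
  have F : (u @ \oo) [set w | exists n, (k <= n)%N /\ w = u n].
    by exists k => // n /= kn; exists n.
  pose fN (i : 'I_k) : set (prod_topology (fun _ : nat => nat)) :=
    [set t | t i = sg i].
  have N : nbhs sg [set t | forall i, fN i t].
    apply: (@filter_forall _ _ fN (nbhs sg)) => i.
    exact: (@proj_continuous _ (fun _ : nat => nat) i sg [set sg i]
      (discrete_set1 _)).
  have [_ [[n [kn ->]] /= [ns nr]]] := clu _
    ([set t | forall i, fN i t] `*` V) F ltac:(by exists ([set t | forall i, fN i t], V)).
  exists n; split => // i ik; exact: (ns (Ordinal ik)).
exists sg, rr; split => //.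
(* The slack [n.+1%:R^-1] disappears in the limit; it is there for points that only approximate an
   infimum. *)
- rewrite arr/=; apply/ler_addgt0Pr => e e0.
  have e20 : 0 < (e : R) / 2 by rewrite divr_gt0.
  have [n [kn _ rn]] := near_branch (Num.truncn ((e : R) / 2)^-1)
    (ball rr ((e : R) / 2)) (nbhsx_ballx _ _ e20).
  have [_ /andP[_ rb] _] := H n.
  have : n.+1%:R^-1 < (e : R) / 2.
    rewrite invf_plt ?posrE//.
    by apply: lt_le_trans (truncnS_gt _) _; rewrite ler_nat ltnS.
  have aux (x y c i t : R) : x - y < t / 2 -> y <= c + i -> i < t / 2 -> x <= c + t.
    lra.
  move: rn; rewrite -ball_normE /= => /ltr_normlP[_ rn] ne.
  exact: aux rn rb ne.
- move=> k; split.
    have [n [kn ns _]] := near_branch k setT filterT.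
    have [_ _ /(_ k kn)[+ _]] := H n.
    by have [-> _] := locAK k _ _ ns.
  have <- : closure (K k sg) = K k sg by apply/esym/closure_id.
  move=> V Vrr; have [n [kn ns nV]] := near_branch k V Vrr.
  have [_ _ /(_ k kn)[_ +]] := H n.
  by have [_ ->] := locAK k _ _ ns => Kr; exists (r n).
Qed.

Variable m : {measure set Z -> \bar R}.
Hypothesis m_fin : (m setT < +oo)%E.

Let approx A K beta (a b : R) n : set Z :=
  [set z | exists s r, [/\ forall i, (s i <= beta i)%N, a <= r <= b &
    forall k, (k <= n)%N -> A k s z /\ K k s r]].

(** Up to rank [n] only the first [n] entries of a branch matter, so the union runs over the
    countable set of finite sequences, extended by 0; the condition [ok] on the real coordinate does
    not involve [z]. *)
Let measurable_approx A K beta a b n : (forall k s, measurable (A k s)) ->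
  local A K -> measurable (approx A K beta a b n).
Proof.
move=> mA locAK.
pose ok (s : seq nat) := exists r, [/\ forall i, (nth 0%N s i <= beta i)%N,
  a <= r <= b & forall k, (k <= n)%N -> K k (nth 0%N s) r].
pose P (s : seq nat) := [set z | ok s /\ forall k, (k <= n)%N -> A k (nth 0%N s) z].
have -> : approx A K beta a b n = \bigcup_s P s.
  apply/seteqP; split => z.
    move=> [s [r [sb rab H]]].
    have loc k : (k <= n)%N ->
        A k s = A k (nth 0%N (mkseq s n)) /\ K k s = K k (nth 0%N (mkseq s n)).
      by move=> kn; apply: locAK => i ik; rewrite nth_mkseq// (leq_trans ik).
    exists (mkseq s n) => //; split.
      exists r; split => //.
        move=> i; have [ni|ni] := leqP n i; last by rewrite nth_mkseq.
        by rewrite nth_default ?size_mkseq.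
      by move=> k kn; have [_ <-] := loc k kn; have [] := H k kn.
    by move=> k kn; have [<- _] := loc k kn; have [] := H k kn.
  move=> [s _ [[r [sb rab Kr]] Az]]; exists (nth 0%N s), r; split => // k kn.
  by split; [exact: Az|exact: Kr].
apply: countable_bigcupT_measurable => // s.
have [oks|noks] := pselect (ok s); last first.
  rewrite (_ : P s = set0)//; apply/seteqP; split => z //= -[] //.
rewrite (_ : P s = \bigcap_(k in [set k | (k <= n)%N]) A k (nth 0%N s)).
  by apply: bigcap_measurable => //; exists 0%N.
by apply/seteqP; split => z /= => [[_ H]|H]; [|split].
Qed.

(* A selection on the whole projection would need the von Neumann theorem;
   capacitability of projections only loses a set of small measure. *)
Lemma measurable_selection (W : set (Z * measurableTypeR R)) (c : \bar R) :
  measurable W -> (c < outer m [set z | exists r, W (z, r)])%E ->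
  exists (D : set Z) (r : Z -> measurableTypeR R), [/\ measurable D,
    measurable_fun D r, (c <= m D)%E & forall z, D z -> W (z, r z)].
Proof.
move=> mW cW.
have [A [K [mA cK locAK EW]]] := souslin_measurable mW.
pose E (M : R) (s : seq nat) : set Z := [set z | exists t r,
  [/\ forall i, (i < size s)%N -> (t i <= nth 0%N s i)%N, - M <= r <= M &
    forall k, A k t z /\ K k t r]].
(* Bounds are imposed one at a time, on [r] and then on each entry of the branch. As the bound grows
   the sets increase to the previous one, so [outer_bigcup] keeps the outer measure above [c]. *)
have [M cM] : exists M : nat, (c < outer m (E M%:R [::]))%E.
  apply: outer_bigcup => //.
    move=> i j ij; apply/subsetPset => z [t [r [? /andP[r1 r2] ?]]].
    exists t, r; split => //; rewrite (le_trans _ r1) ?lerN2 ?ler_nat//.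
    by rewrite (le_trans r2)// ler_nat.
  apply: lt_le_trans cW _; apply: le_outer => z [r].
  rewrite EW => -[t /= H]; exists (Num.truncn `|r|).+1 => //; exists t, r; split => //.
  by rewrite -ler_norml ltW// truncnS_gt.
have /choice[nxt Hnxt] (s : seq nat) : exists j, (c < outer m (E M%:R s))%E ->
    (c < outer m (E M%:R (rcons s j)))%E.
  have [cs|] := boolP (c < outer m (E M%:R s))%E; last by exists 0%N.
  suff [j Hj] : exists j, (c < outer m (E M%:R (rcons s j)))%E by exists j.
  apply: (outer_bigcup m_fin (A := fun j => E M%:R (rcons s j))).
    move=> i j ij; apply/subsetPset => z [t [r [H ? ?]]].
    exists t, r; split => // k; rewrite size_rcons => ks.
    apply: leq_trans (H k _) _; first by rewrite size_rcons.
    by rewrite !nth_rcons; case: ltnP => //; case: eqP.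
  apply: lt_le_trans cs _; apply: le_outer => z [t [r [H ? ?]]].
  exists (t (size s)) => //; exists t, r; split => // i.
  rewrite size_rcons ltnS leq_eqVlt => /predU1P[->|is_].
    by rewrite nth_rcons ltnn eqxx.
  by rewrite nth_rcons is_ H.
pose pre := fix pre n := if n is n'.+1 then rcons (pre n') (nxt (pre n')) else [::].
have size_pre n : size (pre n) = n by elim: n => //= n IH; rewrite size_rcons IH.
pose beta i := nxt (pre i).
have nth_pre n i : (i < n)%N -> nth 0%N (pre n) i = beta i.
  elim: n => // n IH; rewrite ltnS leq_eqVlt /= nth_rcons size_pre.
  by move=> /predU1P[->|ni]; rewrite ?ltnn ?eqxx// ni IH.
have c_pre n : (c < outer m (E M%:R (pre n)))%E by elim: n => //= n /Hnxt.
pose S b z := [set r | exists t, [/\ forall i, (t i <= beta i)%N,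
  - M%:R <= r <= b & forall k, A k t z /\ K k t r]].
(* Once branches are confined to a compact box, finite approximations detect them, and the
   projection becomes a countable intersection of measurable sets. *)
have SE b : [set z | exists r, S b z r] =
    \bigcap_n approx A K beta (- M%:R) b n.
  apply/seteqP; split => z.
    by move=> [r [t [? ? H]]] n _; exists t, r; split.
  move=> H.
  have [n|t [r [? ? ?]]] := @branch_limit A K beta (- M%:R) b z cK locAK.
    have [t [r [? /andP[r1 r2] ?]]] := H n I; exists t, r; split => //.
    by rewrite r1 (le_trans r2)// lerDl.
  by exists r, t.
have mS b : measurable [set z | exists r, S b z r].
  by rewrite SE; apply: bigcapT_measurable => n; exact: measurable_approx.
(* The least admissible value is attained, by [branch_limit] with its slack; hence [r z < y] means
   that some admissible value is at most [y - k.+1%:R^-1] for some [k], a measurable condition. *)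
pose r z := inf (S M%:R z).
have Sr b z x : S b z x -> S b z (r z) /\ S M%:R z (r z) \/ M%:R < b.
  have [bM Sx|] := leP b M%:R; last by right.
  left; have SM : S M%:R z x.
    move: Sx => [t [? /andP[x1 x2] ?]]; exists t; split => //.
    by rewrite x1 (le_trans x2).
  have hi : has_inf (S M%:R z).
    by split; [exists x|exists (- M%:R) => y [t [_ /andP[]]]].
  have rx : r z <= x by apply: ge_inf => //; case: hi.
  have [n|t [y [tb /andP[y1 y2] yH]]] :=
      @branch_limit A K beta (- M%:R) (r z) z cK locAK.
    have n0 : (0 : R) < n.+1%:R^-1 by rewrite invr_gt0.
    have [y [t [? /andP[y1 y2] ?]] yr] := inf_adherent n0 hi.
    by exists t, y; split => //; rewrite y1 ltW.
  have xb : x <= b by move: Sx => [? [_ /andP[]]].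
  suff -> : r z = y by split; exists t; split => //; rewrite y1/= (le_trans y2)//
    (le_trans rx)// (le_trans xb).
  apply/eqP; rewrite eq_le y2 andbT; apply: ge_inf; first by case: hi.
  by exists t; split => //; rewrite y1/= (le_trans y2)// (le_trans rx)// (le_trans xb).
exists [set z | exists x, S M%:R z x], r; split => //.
- apply: (measurability _ (RGenInftyO.measurableE R)) => _ [_ [y ->] <-].
  rewrite (_ : _ `&` _ = \bigcup_(k : nat)
    [set z | exists x, S (Num.min M%:R (y - k.+1%:R^-1)) z x]).
    exact: bigcupT_measurable.
  apply/seteqP; split => z /=; rewrite ?in_itv/=.
    move=> [[x Sx] ry].
    exists (Num.truncn (y - r z)^-1) => //=.
    have [[_ [t [? /andP[r1 r2] ?]]]|] := Sr _ _ _ Sx; last by rewrite ltxx.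
    exists (r z), t; split => //; rewrite r1 le_min r2/=.
    rewrite lerBrDl -lerBrDr ltW// invf_plt ?posrE// ?subr_gt0//.
    exact: truncnS_gt.
  move=> [k _ [x Sx]]; have [[[t [? /andP[r1]]]]|] := Sr _ _ _ Sx; last first.
    by rewrite lt_min ltxx.
  rewrite le_min => /andP[rM ry] ? ?; split; first by exists (r z).
  by apply: le_lt_trans ry _; rewrite ltrBlDr ltrDl invr_gt0.
- rewrite SE; have mI := measurable_approx beta (- M%:R) M%:R _ mA locAK.
  have cv := @nonincreasing_cvg_mu _ _ _ m (approx A K beta (- M%:R) M%:R)
    (le_lt_trans (le_measure m (mem_set (mI 0%N)) (mem_set measurableT) (@subsetT _ _)) m_fin) mI
    (bigcapT_measurable mI).
  have {}cv := cv ltac:(by move=> i j ij; apply/subsetPset => z [t [x [? ? H]]];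
     exists t, x; split => // k ki; apply: H; exact: leq_trans ki ij).
  rewrite -(cvg_lim _ cv)//; apply: lime_ge.
    by apply/cvg_ex; eexists; exact: cv.
  apply: nearW => n /=; apply: le_trans (ltW (c_pre n)) _.
  (* Here [t] is bounded by [beta] below rank [n] only. Truncating it by [minn] puts it in the box
     and, by locality, changes nothing up to rank [n]. *)
  apply: outer_le => // z [t [x [H ? tx]]].
  exists (fun i => minn (t i) (beta i)), x; split => //.
    by move=> i; exact: geq_minr.
  move=> k kn.
  suff tb : forall i, (i < k)%N -> t i = minn (t i) (beta i).
    by have [<- <-] := locAK k t (fun i => minn (t i) (beta i)) tb.
  move=> i ik; apply/esym/minn_idPl.
  have iN : (i < n)%N by exact: leq_trans kn.
  by rewrite -(nth_pre n)// H// size_pre.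
- move=> z [x Sx]; have [[_ [t [_ _ H]]]|] := Sr _ _ _ Sx; last by rewrite ltxx.
  by rewrite EW; exists t.
Qed.

End selection.

(** * Mass transport and fractional covering *)

(** Cardinality as an [esum]: measurability in parameters and exchange with integrals then come from
    the rules for sums of functions. *)
Definition ecard {R : realType} {T : choiceType} (A : set T) : \bar R :=
  \esum_(i in A) 1%E.

(* Unlike in [ge0_le_integral], measurability is not assumed: the maximal
   function need not be measurable. *)
Lemma le_integral_nneg {R : realType} d {T : measurableType d}
    (m : {measure set T -> \bar R}) (D : set T) (f g : T -> \bar R) :
  (forall x, D x -> 0 <= f x)%E -> (forall x, D x -> f x <= g x)%E ->
  (\int[m]_(x in D) f x <= \int[m]_(x in D) g x)%E.
Proof.
move=> f0 fg.
have g0 x : D x -> (0 <= g x)%E by move=> Dx; exact: le_trans (f0 _ Dx) (fg _ Dx).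
rewrite !ge0_integralE//; apply: le_ereal_sup => _ [h hf <-]; exists h => // x.
apply: le_trans (hf x) _; rewrite !patchE; case: ifPn => // /set_mem; exact: fg.
Qed.

Lemma measurable_patchT {R : realType} d {T : measurableType d} (D : set T)
    (f : T -> \bar R) :
  measurable D -> measurable_fun setT f -> measurable_fun setT (f \_ D).
Proof.
by move=> mD mf; apply: (measurable_restrictT f mD).1; exact: measurable_funTS.
Qed.

Section esum_complements.
Local Open Scope ereal_scope.
Context {R : realType}.

Lemma esum_sub {T : choiceType} (A B : set T) (a : T -> \bar R) :
  (forall i, 0 <= a i) -> A `<=` B ->
  \esum_(i in A) a i <= \esum_(i in B) a i.
Proof.
move=> a0 AB; rewrite esum_mkcond [leRHS]esum_mkcond.
apply: le_esum => i _; case: ifPn => [/set_mem /AB /mem_set -> //|_].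
by case: ifP.
Qed.

Lemma le_ecard {T T' : choiceType} (A : set T) (B : set T') (e : T -> T') :
  set_inj A e -> (forall i, A i -> B (e i)) ->
  ecard A <= ecard B :> \bar R.
Proof.
move=> inj AB; rewrite /ecard -(@esum_image _ _ _ A e (fun=> 1))//.
by apply: esum_sub => // _ [i Ai <-]; exact: AB.
Qed.

Lemma ecard_ge0 {T : choiceType} (A : set T) : 0 <= ecard A :> \bar R.
Proof. exact: esum_ge0. Qed.

Lemma ecard_ge1 {T : choiceType} (A : set T) i : A i -> 1 <= ecard A :> \bar R.
Proof.
move=> Ai; rewrite -(@esum_set1 R _ i (fun=> 1))//.
by apply: esum_sub => // _ ->.
Qed.

(** One enumeration by options, with empty slots contributing 0, turns all sums over a countable
    type into series, so that the convergence theorems for series apply. *)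
Lemma esum_series {T : choiceType} : countable [set: T] ->
  exists e : nat -> option T, forall a : T -> \bar R, (forall t, 0 <= a t) ->
    \esum_(t in [set: T]) a t = \sum_(n <oo) oapp a 0 (e n).
Proof.
move=> /countable_injP[iota inj].
have /choice[e He] (n : nat) : exists o : option T,
    if o is Some t then iota t = n else forall t, iota t <> n.
  by have [[t <-]|/forallNP H] := pselect (exists t, iota t = n);
    [exists (Some t)|exists None].
exists e => a a0.
have tJ : trivIset setT (fun n => [set t | iota t = n]).
  by apply/trivIsetP => i j _ _ /eqP ij; apply/seteqP; split => // t [/= -> /ij].
rewrite nneseries_esumT; last by move=> n; case: (e n) => /=.
rewrite (_ : setT = \bigcup_(n in setT) [set t | iota t = n]); last first.
  by apply/seteqP; split => // t _; exists (iota t).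
rewrite esum_bigcupT//; apply: eq_esum => n _.
case: (e n) (He n) => [t <-|H] /=.
  rewrite (_ : [set _ | _] = [set t]) ?esum_set1//.
  by apply/seteqP; split => [s /= /inj|s ->//]; apply; rewrite inE.
by rewrite (_ : [set _ | _] = set0) ?esum_set0//; apply/seteqP; split => s // /H.
Qed.

Lemma esumZl {T : choiceType} : countable [set: T] ->
  forall (A : set T) (a : T -> \bar R) (k : R), (forall t, 0 <= a t) ->
  (0 <= k)%R -> \esum_(t in A) (k%:E * a t) = k%:E * \esum_(t in A) a t.
Proof.
move=> cT A a k a0 k0; have [e He] := esum_series cT.
rewrite esum_mkcond [in RHS]esum_mkcond !He; last 2 first.
- by move=> t; case: ifP.
- by move=> t; case: ifP => // _; rewrite mule_ge0.
rewrite -nneseriesZl; last by move=> n _; case: (e n) => //= t; case: ifP.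
by apply: eq_eseriesr => n _; case: (e n) => /= [t|]; [case: ifP|]; rewrite ?mule0.
Qed.

Lemma esum_cst {T : choiceType} : countable [set: T] ->
  forall (A : set T) (k : R), (0 <= k)%R ->
  \esum_(t in A) k%:E = k%:E * ecard A.
Proof.
by move=> cT A k k0; rewrite /ecard -esumZl//; apply: eq_esum => t _; rewrite mule1.
Qed.

Context d {Z : measurableType d} (m : {measure set Z -> \bar R}).
Context {T : choiceType} (countT : countable [set: T]).

Let mem_section (P : Z -> set T) t z : (t \in P z) = (z \in [set z | P z t]).
Proof. by apply/idP/idP => /set_mem ?; exact/mem_set. Qed.

Lemma measurable_indic_fun (P : set Z) (a : Z -> \bar R) : measurable P ->
  measurable_fun setT a ->
  measurable_fun setT (fun z => if z \in P then a z else 0).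
Proof.
move=> mP ma; have /(measurable_restrictT a mP).1 : measurable_fun P a.
  exact: measurable_funTS.
by apply: eq_measurable_fun => z _; rewrite patchE.
Qed.

Lemma measurable_esum (P : Z -> set T) (a : T -> Z -> \bar R) :
  (forall t, measurable [set z | P z t]) ->
  (forall t, measurable_fun setT (a t)) -> (forall t z, 0 <= a t z) ->
  measurable_fun setT (fun z => \esum_(t in P z) a t z).
Proof.
move=> mP ma a0; have [e He] := esum_series countT.
rewrite (_ : (fun _ => _) = fun z => \sum_(n <oo)
    oapp (fun t => if z \in [set z | P z t] then a t z else 0) 0 (e n)).
  apply: ge0_emeasurable_sum.
    by move=> n z _ _; case: (e n) => //= t; case: ifP.
  by move=> n _; case: (e n) => //= t; apply: measurable_indic_fun.
apply/funext => z; rewrite esum_mkcond -He; last by move=> t; case: ifP.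
by apply: eq_esum => t _; rewrite mem_section.
Qed.

Lemma integral_esum (P : Z -> set T) (a : T -> Z -> \bar R) :
  (forall t, measurable [set z | P z t]) ->
  (forall t, measurable_fun setT (a t)) -> (forall t z, 0 <= a t z) ->
  \int[m]_z (\esum_(t in P z) a t z) =
  \esum_(t in [set: T]) \int[m]_(z in [set z | P z t]) a t z.
Proof.
move=> mP ma a0; have [e He] := esum_series countT.
transitivity (\int[m]_z (\sum_(n <oo)
    oapp (fun t => if z \in [set z | P z t] then a t z else 0) 0 (e n))).
  apply: eq_integral => z _; rewrite esum_mkcond -He; last by move=> t; case: ifP.
  by apply: eq_esum => t _; rewrite mem_section.
rewrite integral_nneseries//; last 2 first.
- by move=> n; case: (e n) => //= t; apply: measurable_indic_fun.
- by move=> n z _; case: (e n) => //= t; case: ifP.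
rewrite He; last by move=> t; exact: integral_ge0.
apply: eq_eseriesr => n _; case: (e n) => [t|] /=; last by rewrite integral0.
by rewrite [RHS]integral_mkcond; apply: eq_integral => z _; rewrite patchE.
Qed.

End esum_complements.

(** A group element acts only where it does not leave the space; [tau g] is total, but its values
    off [dom g] carry no meaning. [pact_inv] is the invariance of [m] in integral form. *)
Record partial_action {R : realType} d {Z : measurableType d}
    (m : {measure set Z -> \bar R}) (Gamma : groupType)
    (dom : Gamma -> set Z) (tau : Gamma -> Z -> Z) : Prop := {
  pact_dom : forall g, measurable (dom g) ;
  pact_meas : forall g, measurable_fun setT (tau g) ;
  pact1 : forall z, dom 1%g z /\ tau 1%g z = z ;
  pactM : forall g h z, dom h z -> dom g (tau h z) ->
    dom (g * h)%g z /\ tau (g * h)%g z = tau g (tau h z) ;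
  pactV : forall g z, dom g z -> dom g^-1%g (tau g z) ;
  pact_inv : forall g (f : Z -> \bar R), measurable_fun setT f ->
    (forall z, 0 <= f z)%E ->
    (\int[m]_(z in dom g) f (tau g z) = \int[m]_(z in dom g^-1%g) f z)%E }.

Section mass_transport.
Local Open Scope ereal_scope.
Context {R : realType} d {Z : measurableType d} (m : {measure set Z -> \bar R}).
Context {Gamma : groupType} (countG : countable [set: Gamma]).
Context {dom : Gamma -> set Z} {tau : Gamma -> Z -> Z}.
Hypothesis act : partial_action m dom tau.

Lemma pactK g z : dom g z -> tau g^-1%g (tau g z) = z.
Proof.
move=> gz; have [_] := pactM act gz (pactV act gz).
by rewrite mulVg; have [_ ->] := pact1 act z.
Qed.

(** Let [z] send the mass [a g z] to [tau g z]. The left side integrates the mass sent, the right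
    side the mass received at [z] from [tau h z] along [h^-1]; for each single group element the
    equality is [pact_inv]. *)
Lemma mass_transport (P : Z -> set Gamma) (a : Gamma -> Z -> \bar R) :
  (forall g, measurable [set z | P z g]) -> (forall z g, P z g -> dom g z) ->
  (forall g, measurable_fun setT (a g)) -> (forall g z, 0 <= a g z) ->
  \int[m]_z (\esum_(g in P z) a g z) =
  \int[m]_z (\esum_(h in [set h | dom h z /\ P (tau h z) h^-1%g])
    a h^-1%g (tau h z)).
Proof.
move=> mP Pdom ma a0.
have mP' h : measurable [set z | dom h z /\ P (tau h z) h^-1%g].
  apply: measurableI; first exact: pact_dom act _.
  by rewrite -[X in measurable X]setTI; exact: (pact_meas act h measurableT (mP _)).
rewrite !integral_esum//; last first.
  by move=> g; exact: measurableT_comp (ma _) (pact_meas act _).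
rewrite (@reindex_esum _ _ _ setT setT (fun g : Gamma => g^-1%g)); last first.
  split => //.
  - by move=> ? ? _ _ /invg_inj.
  - by move=> g _; exists g^-1%g; rewrite ?invgK.
apply: eq_esum => h _.
pose b z := if z \in [set z | P z h^-1%g] then a h^-1%g z else 0.
have mb : measurable_fun setT b by exact: measurable_indic_fun.
have b0 z : 0 <= b z by rewrite /b; case: ifP.
transitivity (\int[m]_(z in dom h^-1%g) b z).
  rewrite [RHS]integral_mkcond integral_mkcond; apply: eq_integral => z _.
  rewrite !patchE /b; case: ifPn => [/set_mem/Pdom/mem_set -> //|_].
  by case: ifP.
rewrite -(pact_inv act)// [LHS]integral_mkcond [RHS]integral_mkcond.
apply: eq_integral => z _; rewrite !patchE /b.
have [zd|zd] := boolP (z \in dom h).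
  move/set_mem: zd => zd; congr (if _ then _ else _).
  apply/idP/idP => /set_mem Ph; apply/mem_set => //.
  by case: Ph.
case: ifPn => // /set_mem[zd' _].
by case/negP: zd; exact/mem_set.
Qed.

End mass_transport.

(** * The fractional covering argument *)

Section covering.
Local Open Scope ereal_scope.
Context {R : realType} d {Z : measurableType d} (m : {measure set Z -> \bar R}).
Context {Gamma : groupType} (countG : countable [set: Gamma]).
Context {dom : Gamma -> set Z} {tau : Gamma -> Z -> Z}.
Hypothesis act : partial_action m dom tau.
Variables (S : Z -> set Gamma) (f : Z -> R) (G : nat -> set Z) (M : nat -> R).
Hypothesis mS : forall g, measurable [set z | S z g].
Hypothesis S_dom : forall z g, S z g -> dom g z.
Hypothesis mf : measurable_fun setT f.
Hypothesis f0 : forall z, (0 <= f z)%R.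
Hypothesis mG : forall i, measurable (G i).
Hypothesis M0 : forall i, (0 < M i)%R.

(** The points [tau h v] of [D] whose sets contain [v], since [h^-1] leads from [tau h v] back to
    [v]. *)
Definition hits (D : set Z) (v : Z) : set Gamma :=
  [set h | dom h v /\ D (tau h v) /\ S (tau h v) h^-1%g].

(* [u v] is the fraction of [v] covered so far; a candidate is good when at
   least half of the [f]-mass of its set is still uncovered. *)
Definition good (D : set Z) (u : Z -> R) : set Z :=
  [set z | D z /\ \esum_(g in S z) (f (tau g z))%:E <=
    2%:E * \esum_(g in S z) (f (tau g z) * (1 - u (tau g z)))%:E].

(** A step fills the uncovered part of [v] in the proportion of hits to their bound [M i]. The
    proportion is at most 1, so [cover] never exceeds 1, however much the sets of one step
    overlap. *)
Fixpoint cover (i : nat) : Z -> R :=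
  if i is i'.+1 then fun v => (cover i' v + (1 - cover i' v) *
      (fine (ecard (hits (good (G i') (cover i')) v) : \bar R) / M i'))%R
  else cst 0%R.

Let goods i := good (G i) (cover i).

(** The points [tau k z] of [D] whose sets intersect that of [z]: the common point is [tau g z],
    reached from [tau k z] by [g * k^-1]. *)
Definition meets (D : set Z) (z : Z) : set Gamma :=
  [set k | [/\ dom k z, D (tau k z) &
    exists g, S z g /\ S (tau k z) (g * k^-1)%g]].

Hypothesis few_hits : forall i v, ecard (hits (G i) v) <= (M i)%:E.

Let goods_sub i : goods i `<=` G i. Proof. by move=> z []. Qed.

Let few_good_hits i v : ecard (hits (goods i) v) <= (M i)%:E.
Proof.
apply: le_trans (few_hits i v); apply: esum_sub => // h [? [? ?]].
by split => //; split => //; exact: goods_sub.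
Qed.

Let fin_good_hits i v : (ecard (hits (goods i) v) : \bar R) \is a fin_num.
Proof.
by rewrite ge0_fin_numE ?ecard_ge0// (le_lt_trans (few_good_hits i v))// ltry.
Qed.

Let hits_ratio i v : (0 <= fine (ecard (hits (goods i) v) : \bar R) / M i <= 1)%R.
Proof.
rewrite divr_ge0 ?fine_ge0 ?ecard_ge0 ?(ltW (M0 i))//=.
by rewrite ler_pdivrMr// mul1r -lee_fin fineK.
Qed.

Let cover01 i v : (0 <= cover i v <= 1)%R.
Proof.
elim: i => [|i /andP[u0 u1]] /=; first by rewrite lexx ler01.
have /andP[h0 h1] := hits_ratio i v; apply/andP; split.
  by rewrite addr_ge0// mulr_ge0// subr_ge0.
rewrite -lerBrDl -[leRHS]mulr1 ler_wpM2l// subr_ge0//.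
Qed.

Let measurable_comp_set D g : measurable D -> measurable [set z | D (tau g z)].
Proof.
by move=> mD; rewrite -[X in measurable X]setTI; exact: (pact_meas act g measurableT mD).
Qed.

Let measurable_S_comp h g : measurable [set z | S (tau h z) g].
Proof. exact: (@measurable_comp_set [set z | S z g]). Qed.

Let measurable_hits D : measurable D ->
  measurable_fun setT (fun v => ecard (hits D v) : \bar R).
Proof.
move=> mD; apply: measurable_esum => // h.
apply: measurableI; first exact: pact_dom act _.
by apply: measurableI; [exact: measurable_comp_set|exact: measurable_S_comp].
Qed.

Let measurable_good D (u : Z -> R) : measurable D -> measurable_fun setT u ->
  (forall z, u z <= 1)%R -> measurable (good D u).
Proof.
move=> mD mu u1; apply: measurableI => //.
have mftau g : measurable_fun setT (fun z => f (tau g z)).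
  exact: measurableT_comp mf (pact_meas act g).
have mutau g : measurable_fun setT (fun z => u (tau g z)).
  exact: measurableT_comp mu (pact_meas act g).
rewrite -[X in measurable X]setTI; apply: measurable_lee => //.
  apply: measurable_esum => // g; first exact/measurable_EFinP.
  by move=> z; rewrite lee_fin.
apply: emeasurable_funM => //; apply: measurable_esum => // g.
  apply/measurable_EFinP/measurable_funM => //.
  exact: measurable_funB.
by move=> z; rewrite lee_fin mulr_ge0// subr_ge0.
Qed.

Let measurable_cover i : measurable_fun setT (cover i).
Proof.
elim: i => [|i IH] //=.
apply: measurable_funD => //; apply: measurable_funM.
  exact: measurable_funB.
apply: measurable_funM => //.
apply: (measurableT_comp (fine_measurable measurableT)).
by apply: measurable_hits; apply: measurable_good => // z; have /andP[] := cover01 i z.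
Qed.

Let measurable_goods i : measurable (goods i).
Proof. by apply: measurable_good => // z; have /andP[] := cover01 i z. Qed.

Let measurable_card_S : measurable_fun setT (fun z => ecard (S z) : \bar R).
Proof. exact: measurable_esum. Qed.

Variable eps : R.
Hypothesis eps0 : (0 < eps)%R.
Hypothesis heavy : forall i z, G i z ->
  eps%:E * ecard (S z) <= \esum_(g in S z) (f (tau g z))%:E.

Let gain_ge0 i z : (0 <= f z * (cover i.+1 z - cover i z))%R.
Proof.
rewrite mulr_ge0//= addrAC subrr add0r mulr_ge0//.
  by rewrite subr_ge0; have /andP[] := cover01 i z.
by have /andP[] := hits_ratio i z.
Qed.

(** A good set is heavy and at least half of its mass is uncovered, whence [eps / 2]. Mass transport
    turns the total of these uncovered masses into the integral of the uncovered mass at a point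
    times its number of hits, that is, [M i] times the increment of [cover]. *)
Let mass_goods i :
  (eps / 2)%:E * ((M i)^-1%:E * \int[m]_(z in goods i) ecard (S z)) <=
  \int[m]_z (f z * (cover i.+1 z - cover i z))%:E.
Proof.
pose r z := (f z * (1 - cover i z))%R.
have r0 z : (0 <= r z)%R.
  by rewrite mulr_ge0// subr_ge0; have /andP[] := cover01 i z.
have mr : measurable_fun setT r by apply: measurable_funM => //; exact: measurable_funB.
pose P z := [set g | goods i z /\ S z g].
have mP g : measurable [set z | P z g].
  exact: (measurableI _ _ (measurable_goods i) (mS g)).
have le1 : eps%:E * \int[m]_(z in goods i) ecard (S z) <=
    2%:E * \int[m]_z (\esum_(g in P z) (r (tau g z))%:E).
  rewrite -ge0_integralZl//; last 3 first.
  - exact: measurable_funTS.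
  - by move=> z _; exact: ecard_ge0.
  - by rewrite lee_fin ltW.
  rewrite -ge0_integralZl//; last 2 first.
  - apply: measurable_esum => // g.
      apply/measurable_EFinP; exact: measurableT_comp mr (pact_meas act g).
    by move=> z; rewrite lee_fin.
  - by move=> z _; apply: esum_ge0 => g _; rewrite lee_fin.
  rewrite integral_mkcond; apply: le_integral_nneg => z _; rewrite patchE.
    by case: ifP => // _; rewrite mule_ge0 ?ecard_ge0// lee_fin ltW.
  case: ifPn => [/set_mem gz|_]; last first.
    by rewrite mule_ge0// esum_ge0// => g _; rewrite lee_fin.
  rewrite (_ : P z = S z); last by apply/seteqP; split => g //= [].
  by apply: le_trans (heavy (goods_sub gz)) _; case: gz.
have eq2 : \int[m]_z (\esum_(g in P z) (r (tau g z))%:E) =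
    (M i)%:E * \int[m]_z (f z * (cover i.+1 z - cover i z))%:E.
  rewrite (mass_transport countG act mP (a := fun g z => (r (tau g z))%:E)); last 3 first.
  - by move=> z g [_ /S_dom].
  - move=> g; apply/measurable_EFinP; exact: measurableT_comp mr (pact_meas act g).
  - by move=> g z; rewrite lee_fin.
  rewrite -ge0_integralZl//; last 3 first.
  - apply/measurable_EFinP/measurable_funM => //.
    by apply: measurable_funB; exact: measurable_cover.
  - by move=> z _; rewrite lee_fin gain_ge0.
  - by rewrite lee_fin ltW.
  apply: eq_integral => z _.
  transitivity (\esum_(h in hits (goods i) z) (r z)%:E).
    rewrite (_ : [set h | _] = hits (goods i) z)//.
    by apply: eq_esum => h [zd _]; rewrite (pactK act).
  rewrite esum_cst// -(fineK (fin_good_hits i z)) -!EFinM; congr EFin.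
  rewrite /= /r -/(goods i) [(cover i z + _)%R]addrC addrK.
  set c := fine _; have Mi : M i != 0%R by rewrite gt_eqF.
  by field.
have Mi : M i != 0%R by rewrite gt_eqF.
have -> : (eps / 2)%:E * ((M i)^-1%:E * \int[m]_(z in goods i) ecard (S z)) =
    (2 * M i)^-1%:E * (eps%:E * \int[m]_(z in goods i) ecard (S z)).
  by rewrite !muleA -!EFinM; congr (_%:E * _); field.
apply: le_trans (lee_wpmul2l _ le1) _; first by rewrite lee_fin invr_ge0 mulr_ge0// ltW.
rewrite eq2 !muleA -!EFinM (_ : (_ * 2 * M i)%R = 1%R) ?mul1e//.
by field.
Qed.

(** The gains of the successive steps telescope, and [cover] stays at most 1. *)
Let mass_total T :
  (eps / 2)%:E * (\sum_(i < T) (M i)^-1%:E * \int[m]_(z in goods i) ecard (S z)) <=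
  \int[m]_z (f z)%:E.
Proof.
rewrite ge0_sume_distrr; last first.
  move=> i _; apply: mule_ge0; first by rewrite lee_fin invr_ge0 ltW.
  by apply: integral_ge0 => z _; exact: ecard_ge0.
apply: le_trans (lee_sum _ (fun (i : 'I_T) _ => mass_goods i)) _.
rewrite -(ge0_integral_sum m measurableT
  (f := fun (i : 'I_T) z => (f z * (cover i.+1 z - cover i z))%:E)); last 2 first.
- move=> i; apply/measurable_EFinP/measurable_funM => //.
  by apply: measurable_funB; exact: measurable_cover.
- by move=> i z _; rewrite lee_fin gain_ge0.
apply: le_integral_nneg => z _.
  by apply: sume_ge0 => i _; rewrite lee_fin gain_ge0.
rewrite sumEFin lee_fin -mulr_sumr.
rewrite -(big_mkord xpredT (fun i => cover i.+1 z - cover i z)%R) telescope_sumr//.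
have /andP[_ c1] := cover01 T z.
by rewrite subr0 -[leRHS]mulr1 ler_wpM2l.
Qed.

Let half_covered i z : G i z -> ~ goods i z ->
  exists2 g, S z g & (1 / 2 < cover i (tau g z))%R.
Proof.
move=> Gz ng; apply: contrapT => /forall2NP H; apply: ng; split => //.
rewrite -esumZl//; last first.
  move=> g; rewrite lee_fin mulr_ge0// subr_ge0.
  by have /andP[] := cover01 i (tau g z).
apply: le_esum => g Sg; rewrite -EFinM lee_fin mulrCA ler_peMr//.
have [//|/negP] := H g; rewrite -leNgt; lra.
Qed.

Let cover_le i v :
  (cover i v)%:E <= \sum_(j < i) (M j)^-1%:E * ecard (hits (goods j) v).
Proof.
elim: i => [|i IH]; first by rewrite big_ord0.
rewrite big_ord_recr/= EFinD leeD//.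
rewrite -(fineK (fin_good_hits i v)) -EFinM lee_fin mulrC [leRHS]mulrC.
rewrite ler_piMr//; first by have /andP[] := hits_ratio i v.
by rewrite gerBl; have /andP[] := cover01 i v.
Qed.

(** A candidate that is not good has a point [tau g z] covered by more than one half, and every
    earlier good set hitting that point meets the set of [z]. *)
Let bad_meets i z : G i z -> ~ goods i z ->
  1 <= 2%:E * \sum_(j < i) (M j)^-1%:E * ecard (meets (goods j) z).
Proof.
move=> Gz ng; have [g Sg cg] := half_covered Gz ng.
rewrite -[leLHS](_ : 2%:E * (1 / 2)%:E = 1); last by rewrite -EFinM; congr EFin; field.
apply: lee_wpmul2l => //; apply: le_trans (le_trans (cover_le i (tau g z)) _).
  by rewrite lee_fin ltW.
apply: lee_sum => j _; apply: lee_wpmul2l; first by rewrite lee_fin invr_ge0 ltW.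
have gz := S_dom Sg.
apply: (le_ecard (e := fun h => (h * g)%g)); first by move=> ? ? _ _ /mulIg.
move=> h [hd [Dh Sh]]; have [hgd hgE] := pactM act gz hd.
split; rewrite ?hgE//; exists g; split => //.
by rewrite invgM mulgA mulgV mul1g.
Qed.

Variables (E : set Z) (T : nat) (Rel : nat -> set Z) (C kappa : R).
Hypothesis mE : measurable E.
Hypothesis mRel : forall j, measurable (Rel j).
Hypothesis C0 : (0 <= C)%R.
Hypothesis kappa0 : (0 < kappa)%R.
Hypothesis few_meets : forall j w, G j w ->
  ecard [set k | [/\ dom k w, E (tau k w), Rel j (tau k w) &
    exists g, S (tau k w) g /\ S w (g * k)%g]] <= C%:E * ecard (S w).
Hypothesis schedule : forall z, E z -> exists i0 i1, [/\ (i0 <= i1 <= T)%N,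
  forall j, (i0 <= j < i1)%N -> G j z,
  forall j, (j.+1 < i1)%N -> Rel j z &
  kappa%:E <= \sum_(i0 <= j < i1) (M j)^-1%:E * ecard (S z)].

Let measurable_meets D : measurable D ->
  forall k, measurable [set z | meets D z k].
Proof.
move=> mD k; rewrite (_ : [set z | _] = dom k `&` [set z | D (tau k z)] `&`
    \bigcup_g ([set z | S z g] `&` [set z | S (tau k z) (g * k^-1)%g])).
  apply: measurableI; first apply: measurableI; first exact: pact_dom act _.
    exact: measurable_comp_set.
  by apply: countable_bigcupT_measurable => // g; exact: measurableI.
apply/seteqP; split => z /=.
  by move=> [? ? [g [? ?]]]; split => //; exists g.
by move=> [[? ?] [g _ [? ?]]]; split => //; exists g.
Qed.

(** Each [z] sends unit mass to the good points it meets; by [few_meets], a good point [w] receives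
    at most [C] times the size of its own set. *)
Let int_meets j :
  \int[m]_(z in E `&` Rel j) ecard (meets (goods j) z) <=
  C%:E * \int[m]_(z in goods j) ecard (S z).
Proof.
pose P z := [set k | (E `&` Rel j) z /\ meets (goods j) z k].
have mER : measurable (E `&` Rel j) by exact: measurableI.
have mP k : measurable [set z | P z k].
  by apply: measurableI => //; exact: measurable_meets.
rewrite integral_mkcond.
rewrite [leLHS](_ : _ = \int[m]_z (\esum_(k in P z) 1)); last first.
  apply: eq_integral => z _; rewrite patchE; case: ifPn => [/set_mem ERz|/negP nER].
    by congr esum; apply/seteqP; split => k //= [].
  rewrite (_ : P z = set0) ?esum_set0//.
  by apply/seteqP; split => k // [/mem_set].
rewrite (mass_transport countG act mP (a := fun _ _ => 1))//; last first.
  by move=> z k [_ []].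
rewrite -ge0_integralZl ?lee_fin//; last 2 first.
- exact: measurable_funTS.
- by move=> z _; exact: ecard_ge0.
rewrite [leRHS]integral_mkcond; apply: le_integral_nneg => w _.
  exact: esum_ge0.
rewrite patchE; case: ifPn => [/set_mem gw|/negP ngw].
  apply: le_trans (few_meets (goods_sub gw)); apply: esum_sub => // h.
  move=> [hd [[Eh Rh] [_ _ [g [Sg Sg']]]]]; split => //; exists g; split => //.
  by move: Sg'; rewrite (pactK act)// invgK.
rewrite (_ : [set h | _] = set0) ?esum_set0//.
apply/seteqP; split => h //= [hd [_ [_ + _]]]; rewrite (pactK act)// => /mem_set.
exact: ngw.
Qed.

(** Either [z] is good during its whole window of steps, and its weights sum to at least [kappa], or
    it is bad at some step of the window and [bad_meets] applies to the steps before. *)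
Let E_le z : E z -> 1 <= 2%:E *
    (\sum_(j < T) (M j)^-1%:E * (fun z => ecard (meets (goods j) z)) \_ (Rel j) z) +
  kappa^-1%:E * (\sum_(j < T) (M j)^-1%:E * (fun z => ecard (S z)) \_ (goods j) z).
Proof.
move=> Ez; have [i0 [i1 [/andP[i01 i1T] GI RelI kI]]] := schedule Ez.
have M1 j : 0 <= (M j)^-1%:E by rewrite lee_fin invr_ge0 ltW.
have ge1 j : 0 <= (M j)^-1%:E *
    (fun z => ecard (meets (goods j) z)) \_ (Rel j) z.
  by rewrite mule_ge0// patchE; case: ifP => // _; exact: ecard_ge0.
have ge2 j : 0 <= (M j)^-1%:E * (fun z => ecard (S z)) \_ (goods j) z.
  by rewrite mule_ge0// patchE; case: ifP => // _; exact: ecard_ge0.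
have [allg|] := pselect (forall j, (i0 <= j < i1)%N -> goods j z); last first.
  move=> /existsNP[i /not_implyP[iI ng]]; have Gi := GI i iI.
  have /andP[i0i ii1] := iI.
  apply: le_trans (bad_meets Gi ng) _.
  rewrite -[leLHS]adde0; apply: leeD; last first.
    by apply: mule_ge0; [rewrite lee_fin invr_ge0 ltW|exact: sume_ge0].
  apply: lee_wpmul2l => //.
  have iT : (i <= T)%N by rewrite (leq_trans _ i1T)// ltnW.
  rewrite -(big_mkord xpredT (fun j => (M j)^-1%:E * ecard (meets (goods j) z))).
  rewrite -(big_mkord xpredT (fun j => (M j)^-1%:E *
    (fun z => ecard (meets (goods j) z)) \_ (Rel j) z)).
  rewrite (@big_cat_nat _ _ _ i 0 T)//= -[leLHS]adde0; apply: leeD; last exact: sume_ge0.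
  rewrite big_nat [leRHS]big_nat; apply: lee_sum => j /andP[_ ji].
  (* Here [j < i < i1], so [j.+1 < i1]: membership in [Rel j] is needed only before the last step of
     the window. *)
  by rewrite patchE mem_set//; apply: RelI; exact: leq_ltn_trans ii1.
rewrite -[leLHS]add0e; apply: leeD; first by rewrite mule_ge0//; exact: sume_ge0.
have -> : 1 = kappa^-1%:E * kappa%:E :> \bar R.
  by rewrite -EFinM mulVf// gt_eqF.
apply: lee_wpmul2l; first by rewrite lee_fin invr_ge0 ltW.
apply: le_trans kI _.
rewrite -(big_mkord xpredT (fun j => (M j)^-1%:E *
  (fun z => ecard (S z)) \_ (goods j) z)).
rewrite (@big_cat_nat _ _ _ i1 0 T)//= (@big_cat_nat _ _ _ i0 0 i1)//=.
rewrite -[leLHS]add0e -[leLHS]adde0; apply: leeD; last exact: sume_ge0.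
apply: leeD; first exact: sume_ge0.
rewrite big_nat [leRHS]big_nat; apply: lee_sum => j jI.
by rewrite patchE mem_set//; exact: allg.
Qed.

(** Integrating [E_le] over [E] bounds [m E] by multiples of the weighted size of the good sets:
    [2 * C] from the meetings and [kappa^-1] from the points that stay good. [mass_total] bounds
    that size by the integral of [f]. *)
Theorem fractional_covering :
  (eps / 2)%:E * m E <= (2 * C + kappa^-1)%:E * \int[m]_z (f z)%:E.
Proof.
have M1 j : 0 <= (M j)^-1%:E by rewrite lee_fin invr_ge0 ltW.
pose a j z := (M j)^-1%:E * (fun z => ecard (meets (goods j) z)) \_ (Rel j) z.
pose b j z := (M j)^-1%:E * (fun z => ecard (S z)) \_ (goods j) z.
have a0 j z : 0 <= a j z.
  by rewrite /a mule_ge0// patchE; case: ifP => // _; exact: ecard_ge0.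
have b0 j z : 0 <= b j z.
  by rewrite /b mule_ge0// patchE; case: ifP => // _; exact: ecard_ge0.
have mmeets j : measurable_fun setT (fun z => ecard (meets (goods j) z) : \bar R).
  by apply: measurable_esum => // k; exact: measurable_meets.
have ma j : measurable_fun setT (a j).
  apply: emeasurable_funM => //; apply: measurable_patchT => //.
have mb j : measurable_fun setT (b j).
  apply: emeasurable_funM => //; apply: measurable_patchT => //.
have msa : measurable_fun setT (fun z => \sum_(j < T) a j z) by exact: emeasurable_sum.
have msb : measurable_fun setT (fun z => \sum_(j < T) b j z) by exact: emeasurable_sum.
have k0 : 0 <= kappa^-1%:E by rewrite lee_fin invr_ge0 ltW.
have mEE : measurable_fun E (fun z => \sum_(j < T) a j z) by exact: measurable_funTS.
have mEb : measurable_fun E (fun z => \sum_(j < T) b j z) by exact: measurable_funTS.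
have le1 : m E <= 2%:E * \sum_(j < T) \int[m]_(z in E) a j z +
    kappa^-1%:E * \sum_(j < T) \int[m]_(z in E) b j z.
  rewrite -[leLHS]mul1e -(integral_cst _ mE).
  rewrite -!(ge0_integral_sum m mE); last 4 first.
  - by move=> j; exact: measurable_funTS.
  - by [].
  - by move=> j; exact: measurable_funTS.
  - by [].
  rewrite -!ge0_integralZl//; try by move=> z _; exact: sume_ge0.
  rewrite -ge0_integralD//.
  - by apply: le_integral_nneg => // z Ez; exact: E_le.
  - by move=> z _; rewrite mule_ge0//; exact: sume_ge0.
  - exact: emeasurable_funM.
  - by move=> z _; rewrite mule_ge0//; exact: sume_ge0.
  - exact: emeasurable_funM.
pose I j := (M j)^-1%:E * \int[m]_(z in goods j) ecard (S z).
have I0 j : 0 <= I j.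
  by rewrite mule_ge0//; apply: integral_ge0 => z _; exact: ecard_ge0.
have lea j : \int[m]_(z in E) a j z <= C%:E * I j.
  rewrite ge0_integralZl//; last 2 first.
  - apply: measurable_funTS; exact: measurable_patchT.
  - by move=> z _; rewrite patchE; case: ifP => // _; exact: ecard_ge0.
  rewrite -integral_mkcondr /I [leRHS]muleCA; exact: lee_wpmul2l.
have leb j : \int[m]_(z in E) b j z <= I j.
  rewrite ge0_integralZl//; last 2 first.
  - apply: measurable_funTS; exact: measurable_patchT.
  - by move=> z _; rewrite patchE; case: ifP => // _; exact: ecard_ge0.
  apply: lee_wpmul2l => //; rewrite -integral_mkcondr.
  apply: ge0_subset_integral => //; first exact: measurableI.
  - exact: measurable_funTS.
  - by move=> z _; exact: ecard_ge0.
have e20 : (0 <= eps / 2)%R by rewrite divr_ge0// ltW.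
apply: (@le_trans _ _ ((eps / 2)%:E * ((2 * C + kappa^-1)%:E * \sum_(j < T) I j))).
  apply: lee_wpmul2l => //; apply: le_trans le1 _.
  have -> : (2 * C + kappa^-1)%:E * (\sum_(j < T) I j) =
      (2 * C)%:E * (\sum_(j < T) I j) + kappa^-1%:E * (\sum_(j < T) I j).
    by rewrite EFinD ge0_muleDl// lee_fin mulr_ge0.
  apply: leeD; last by apply: lee_wpmul2l => //; exact: lee_sum.
  rewrite EFinM -muleA; apply: lee_wpmul2l => //.
  by rewrite ge0_sume_distrr//; apply: lee_sum => j _; exact: lea.
rewrite muleCA; apply: lee_wpmul2l; last exact: mass_total.
by rewrite lee_fin addr_ge0 ?mulr_ge0// invr_ge0 ltW.
Qed.

End covering.

(** * Weak type inequalities for partial actions *)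

Section ecard_counting.
Local Open Scope ereal_scope.
Context {R : realType} {T : choiceType}.

Lemma ecard_counting (A : set T) : ecard A = counting A :> \bar R.
Proof.
rewrite /counting; case: asboolP => [finA|infA].
  rewrite /ecard esum_fset// fsbig_finite//= sumEFin.
  by rewrite big_const_seq count_predT iter_addr addr0.
apply/eqyP => r r0.
have [B BA rB] := infinite_set_fset (Num.truncn r).+1 infA.
move: BA; set A' := (X in X `<=` _) => BA.
have fA' : finite_set A' by exact: finite_fset.
have EB : fset_set A' = B by exact: set_fsetK.
suff h : (r : R)%:E <= (ecard A' : \bar R).
  by apply: (le_trans h); exact: esum_sub.
rewrite /ecard esum_fset// fsbig_finite//= EB.
rewrite sumEFin big_const_seq count_predT iter_addr addr0 lee_fin.
by rewrite (le_trans (ltW (truncnS_gt r)))// ler_nat.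
Qed.

Lemma ecard_finite (A : set T) : (ecard A < +oo :> \bar R) -> finite_set A.
Proof.
by rewrite ecard_counting /counting; case: asboolP => // _; rewrite ltxx.
Qed.

Lemma finite_bound (A : set T) (F : T -> nat) : finite_set A ->
  exists N, forall t, A t -> (F t <= N)%N.
Proof.
move=> finA; exists (\max_(t <- finmap.enum_fset (fset_set A)) F t) => t At.
by apply: leq_bigmax_seq => //; rewrite in_fset_set// mem_set.
Qed.

End ecard_counting.

Section measurable_comparisons.
Context {R : realType} d {Z : measurableType d} (f g : Z -> R).
Hypotheses (mf : measurable_fun setT f) (mg : measurable_fun setT g).

Lemma measurable_set_lt : measurable [set z | f z < g z].
Proof.
rewrite -[X in measurable X]setTI.
have := @measurable_lte _ Z R setT measurableT (EFin \o f) (EFin \o g).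
by apply; exact/measurable_EFinP.
Qed.

Lemma measurable_set_le : measurable [set z | f z <= g z].
Proof.
rewrite -[X in measurable X]setTI.
have := @measurable_lee _ Z R setT measurableT (EFin \o f) (EFin \o g).
by apply; exact/measurable_EFinP.
Qed.

End measurable_comparisons.

Lemma measurable_set_eq {R : realType} d {Z : measurableType d} (f g : Z -> R) :
  measurable_fun setT f -> measurable_fun setT g ->
  measurable [set z | f z = g z].
Proof.
move=> mf mg; rewrite (_ : [set z | _] = [set z | f z <= g z] `&` [set z | g z <= f z]).
  by apply: measurableI; exact: measurable_set_le.
apply/seteqP; split => z /=; first by move=> ->.
by move=> [? ?]; apply/eqP; rewrite eq_le; apply/andP.
Qed.

Section weak_type.
Local Open Scope ereal_scope.
Context {R : realType} d {Z : measurableType d} (m : {measure set Z -> \bar R}).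
Hypothesis m_fin : m setT < +oo.
Context {Gamma : groupType} (countG : countable [set: Gamma]).
Context {dom : Gamma -> set Z} {tau : Gamma -> Z -> Z}.
Hypothesis act : partial_action m dom tau.
Variables (II : set R) (Z0 : set Z) (S : R -> Z -> set Gamma).
Hypothesis mZ0 : measurable Z0.
Hypothesis II0 : forall r, II r -> (0 <= r)%R.
Hypothesis mS : forall g,
  measurable [set u : Z * measurableTypeR R | II u.2 /\ S u.2 u.1 g].
Hypothesis S_dom : forall r z g, II r -> S r z g -> dom g z.
Hypothesis S_fin : forall r z, Z0 z -> II r -> ecard (S r z) < +oo :> \bar R.
Hypothesis S_nonempty : forall r z, Z0 z -> II r -> S r z !=set0.

(** The group-element form of the union of the sets F_s^-1 F_r (z) over [s] in [P]: the set of
    radius [s] at [tau k z] and the set of radius [r] at [z] share the point [tau (g * k) z]. *)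
Definition conflicts (P : set R) (r : R) (z : Z) : set Gamma :=
  [set k | dom k z /\ exists2 s, II s /\ P s &
    exists g, S s (tau k z) g /\ S r z (g * k)%g].

Definition abstract_regular (C : R) := (0 < C)%R /\
  forall z r, Z0 z -> II r ->
    ecard (conflicts [set s | (s <= r)%R] r z) <= C%:E * ecard (S r z).

Definition abstract_tempered (C Cu : R) (a b : nat -> R) :=
  [/\ II = nat_index, (0 <= C)%R /\ (0 < Cu)%R,
    forall n, [/\ 0 < a n, 0 < b n & b n <= Cu * a n]%R,
    forall n z, Z0 z -> (a n)%:E <= ecard (S n%:R z) /\
      ecard (conflicts [set s | (s < n%:R)%R] n%:R z) <= C%:E * ecard (S n%:R z) &
    forall n v, ecard [set h | dom h v /\ (Z0 (tau h v) /\
      S n%:R (tau h v) h^-1%g)] <= (b n)%:E].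

Section selected.
Variables (f : Z -> R) (eps : R) (D : set Z) (r : Z -> measurableTypeR R).
Hypothesis mf : measurable_fun setT f.
Hypothesis f0 : forall z, (0 <= f z)%R.
Hypothesis eps0 : (0 < eps)%R.
Hypothesis mD : measurable D.
Hypothesis mr : measurable_fun D r.
Hypothesis DZ0 : D `<=` Z0.
Hypothesis IIr : forall z, D z -> II (r z).
Hypothesis heavyr : forall z, D z ->
  eps%:E * ecard (S (r z) z) <= \esum_(g in S (r z) z) (f (tau g z))%:E.

Let Sr z : set Gamma := [set g | D z /\ S (r z) z g].

Let SrE z : D z -> Sr z = S (r z) z.
Proof. by move=> Dz; apply/seteqP; split => g // []. Qed.

Let Sr_dom z g : Sr z g -> dom g z.
Proof. by move=> [Dz Sz]; exact: S_dom (IIr Dz) Sz. Qed.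

Let rr : Z -> R := fun z => if z \in D then r z else 0%R.

Let rrE z : D z -> rr z = r z. Proof. by move=> Dz; rewrite /rr mem_set. Qed.

Let mrr : measurable_fun setT rr.
Proof.
have := (measurable_restrictT (r : Z -> R) mD).1 mr.
by apply: eq_measurable_fun => z _; rewrite patchE.
Qed.

Let rr_ge0 z : D z -> (0 <= rr z)%R.
Proof. by move=> Dz; rewrite rrE//; exact/II0/IIr. Qed.

Let mSr g : measurable [set z | Sr z g].
Proof.
have mp : measurable_fun setT (fun z => (z, rr z) : Z * measurableTypeR R).
  exact: measurable_fun_pair.
rewrite (_ : [set z | _] = D `&` (setT `&` (fun z => (z, rr z)) @^-1`
    [set u : Z * measurableTypeR R | II u.2 /\ S u.2 u.1 g])).
  by apply: measurableI => //; exact: mp.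
apply/seteqP; split => z /=.
  by move=> [Dz Sz]; split => //; split => //; rewrite rrE//; split => //; exact: IIr.
by move=> [Dz [_ [_]]]; rewrite rrE.
Qed.

Let measurable_comp_set (A : set Z) g : measurable A -> measurable [set z | A (tau g z)].
Proof.
by move=> mA; rewrite -[X in measurable X]setTI; exact: (pact_meas act g measurableT mA).
Qed.

Let exhaust (E : (set Z)^nat) (c : \bar R) : (forall k, measurable (E k)) ->
  nondecreasing_seq E -> D `<=` \bigcup_k E k -> (forall k, m (E k) <= c) -> m D <= c.
Proof.
move=> mE ndE DE Ec.
have mU : measurable (\bigcup_k E k) by exact: bigcupT_measurable.
apply: (@le_trans _ _ (m (\bigcup_k E k))); first by apply: le_measure; rewrite ?inE.
have cv := @nondecreasing_cvg_mu _ _ _ m E mE mU ndE.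
rewrite -(cvg_lim _ cv)//; apply: lime_le.
  by apply/cvg_ex; eexists; exact: cv.
exact: nearW.
Qed.

Let scale_le (c : R) (x y : \bar R) :
  (eps / 2)%:E * x <= c%:E * y -> x <= (2 * c / eps)%:E * y.
Proof.
move=> h; have e0 : eps != 0%R by rewrite gt_eqF.
have -> : x = (2 / eps)%:E * ((eps / 2)%:E * x).
  by rewrite muleA -EFinM (_ : (_ * _)%R = 1%R) ?mul1e//; field.
have -> : (2 * c / eps)%:E * y = (2 / eps)%:E * (c%:E * y).
  by rewrite muleA -EFinM; congr (_%:E * _); field.
by apply: lee_wpmul2l => //; rewrite lee_fin divr_ge0// ltW.
Qed.

(** Among radii at most [k], step [i] treats the radius [k - i], so large radii go first. A point of
    radius [n] is a candidate in a single step, with weight at least [a n / b n >= Cu^-1]; the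
    smaller radii still to come are controlled by temperedness. The bound does not depend on [k]. *)
Lemma tempered_selected (C Cu : R) (a b : nat -> R) :
  abstract_tempered C Cu a b ->
  m D <= (2 * (2 * C + Cu) / eps)%:E * \int[m]_z (f z)%:E.
Proof.
move=> [IIn [C0 Cu0] ab lower upper].
have rn z : D z -> exists n : nat, r z = n%:R.
  by move=> Dz; move: (IIr Dz); rewrite IIn => -[n _ <-]; exists n.
pose E k := D `&` [set z | (rr z <= k%:R)%R].
have mEk k : measurable (E k).
  apply: measurableI => //; exact: measurable_set_le.
apply: (@exhaust E) => //.
- move=> i j ij; apply/subsetPset => z [Dz /= zi]; split => //=.
  by rewrite (le_trans zi)// ler_nat.
- move=> z Dz; have [n rzn] := rn z Dz; exists n => //; split => //=.
  by rewrite rrE// rzn.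
move=> k; apply: scale_le.
pose G i := D `&` [set z | rr z = (k - i)%:R].
pose Rel j := D `&` [set z | (rr z < (k - j)%:R)%R].
rewrite -[X in (_ + X)%R]invrK.
apply: (@fractional_covering R _ Z m Gamma countG dom tau act Sr f G
  (fun i => b (k - i)%N) _ _ _ _ _ _ _ eps _ _ (E k) k.+1 Rel C Cu^-1) => //.
- move=> i; apply: measurableI => //; exact: measurable_set_eq.
- by move=> i; have [] := ab (k - i)%N.
- move=> i v; apply: le_trans (upper (k - i)%N v); apply: esum_sub => // h.
  move=> [hd [[Dh rh] [_ Sh]]]; split => //; split; first exact: DZ0.
  by rewrite -rh rrE.
- by move=> i z [Dz _]; rewrite SrE//; exact: heavyr.
- move=> j; apply: measurableI => //; exact: measurable_set_lt.
- by rewrite invr_gt0.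
- move=> j w [Dw /= rw]; rewrite [X in _ <= _ * ecard X]SrE//; rewrite rrE// in rw.
  have [_ le2] := lower (k - j)%N w (DZ0 Dw).
  rewrite rw; apply: le_trans le2; apply: esum_sub => // h.
  move=> [hd _ [Dh rh] [g [[_ Sg] [_ Sg']]]]; split => //.
  move: rh => /=; rewrite rrE// => rh.
  by exists (r (tau h w)); [split => //; exact: IIr|exists g; rewrite -rw].
- move=> z [Dz /=]; rewrite rrE// => rk; have [n rzn] := rn z Dz.
  have nk : (n <= k)%N by move: rk; rewrite rzn ler_nat.
  exists (k - n)%N, (k - n).+1; split.
  + by rewrite leqnSn ltnS leq_subr.
  + move=> j; rewrite ltnS -eqn_leq => /eqP <-; split => //=.
    by rewrite rrE// rzn subKn.
  + move=> j; rewrite ltnS => jn; split => //=.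
    by rewrite rrE// rzn ltr_nat; rewrite ltn_subRL addnC -ltn_subRL.
  + rewrite big_nat1 subKn// SrE// rzn.
    have [a0 b0 ba] := ab n; have [le1 _] := lower n z (DZ0 Dz).
    apply: (@le_trans _ _ ((b n)^-1%:E * (a n)%:E)).
      by rewrite -EFinM lee_fin ler_pdivlMl// ler_pdivrMr// mulrC.
    by apply: lee_wpmul2l => //; rewrite lee_fin invr_ge0 ltW.
Qed.

(** Radii are ordered through the integer part [lev] of [k.+1] times the radius. On [E k] this is
    harmless: there, a set of smaller radius intersecting the given one has a radius smaller by at
    least [k.+1%:R^-1]. The bound does not depend on [k], and the sets [E k] exhaust [D]. *)
Lemma regular_selected (C : R) : abstract_regular C ->
  m D <= (2 * (2 * C + 1) / eps)%:E * \int[m]_z (f z)%:E.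
Proof.
move=> [C0 reg].
pose clash z h := [/\ dom h z, D (tau h z), (rr (tau h z) < rr z)%R &
  exists g, Sr (tau h z) g /\ Sr z (g * h)%g].
pose gap (k : nat) := [set z | forall h, clash z h ->
  (k.+1%:R^-1 <= rr z - rr (tau h z))%R].
pose E k := D `&` [set z | (ecard (Sr z) <= (k%:R : R)%:E)%E] `&`
  [set z | (rr z <= k%:R)%R] `&` gap k.
have mclash h : measurable [set z | clash z h].
  rewrite (_ : [set z | _] = dom h `&` [set z | D (tau h z)] `&`
    [set z | (rr (tau h z) < rr z)%R] `&`
    \bigcup_g ([set z | Sr (tau h z) g] `&` [set z | Sr z (g * h)%g])).
    apply: measurableI; last first.
      apply: countable_bigcupT_measurable => // g; apply: measurableI => //.
      exact: (@measurable_comp_set [set z | Sr z g]).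
    apply: measurableI; last first.
      apply: measurable_set_lt => //.
      exact: measurableT_comp mrr (pact_meas act h).
    by apply: measurableI; [exact: pact_dom act _|exact: measurable_comp_set].
  apply/seteqP; split => z /=.
    by move=> [? ? ? [g [? ?]]]; split => //; exists g.
  by move=> [[[? ?] ?] [g _ [? ?]]]; split => //; exists g.
have mgap k : measurable (gap k).
  rewrite (_ : gap k = ~` \bigcup_h ([set z | clash z h] `&`
      [set z | (rr z - rr (tau h z) < k.+1%:R^-1)%R])).
    apply: measurableC; apply: countable_bigcupT_measurable => // h.
    apply: measurableI => //; apply: measurable_set_lt => //; apply: measurable_funB => //.
    exact: measurableT_comp mrr (pact_meas act h).
  apply/seteqP; split => z /=.
    by move=> H [h _ [/H + /=]]; rewrite leNgt => /negP.
  by move=> H h clh; rewrite leNgt; apply/negP => lt; apply: H; exists h.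
have mEk k : measurable (E k).
  apply: measurableI => //; apply: measurableI; last first.
    by exact: measurable_set_le.
  apply: measurableI => //; rewrite -[X in measurable X]setTI.
  by apply: measurable_lee => //; exact: measurable_esum.
apply: (@exhaust E) => //.
- move=> i j ij; apply/subsetPset => z [[[Dz /= zi] ri] gi].
  split; first split; first split => //=.
  + by rewrite (le_trans zi)// lee_fin ler_nat.
  + by rewrite /= (le_trans ri)// ler_nat.
  + move=> h clh; apply: le_trans (gi h clh).
    by rewrite lef_pV2 ?posrE// ler_nat ltnS.
- move=> z Dz.
  have fS : ecard (Sr z) < +oo :> \bar R by rewrite SrE//; exact: S_fin (DZ0 Dz) (IIr Dz).
  (* Regularity leaves finitely many clashes at [z], so their gaps have a positive lower bound and
     [z] belongs to some [E k]. *)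
  have fclash : finite_set (clash z).
    apply: (@ecard_finite R).
    apply: (@le_lt_trans _ _ (ecard (conflicts [set s | (s <= r z)%R] (r z) z))).
      apply: esum_sub => // h [hd Dh]; rewrite !rrE// => rh [g [[_ Sg] [_ Sg']]].
      by split => //; exists (r (tau h z)); [split; [exact: IIr|exact: ltW]|exists g].
    apply: le_lt_trans (reg _ _ (DZ0 Dz) (IIr Dz)) _.
    by rewrite lte_mul_pinfty ?lee_fin ?ltW// -SrE.
  have [N1 HN1] := finite_bound (fun h => Num.truncn (rr z - rr (tau h z))^-1) fclash.
  pose N2 := Num.truncn (fine (ecard (Sr z) : \bar R)).
  pose N3 := Num.truncn (rr z).
  exists (maxn N1 (maxn N2.+1 N3.+1)) => //; split; first split; first split => //=.
  + rewrite -(@fineK _ (ecard (Sr z))) ?ge0_fin_numE ?ecard_ge0// lee_fin.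
    apply: le_trans (ltW (truncnS_gt _)) _; rewrite ler_nat -/N2.
    by rewrite !leq_max leqnn orbT.
  + apply: le_trans (ltW (truncnS_gt _)) _; rewrite ler_nat -/N3.
    by rewrite !leq_max leqnn !orbT.
  + move=> h clh; have [_ _ lt _] := clh.
    have d0 : (0 < rr z - rr (tau h z))%R by rewrite subr_gt0.
    rewrite invf_ple ?posrE//; apply: le_trans (ltW (truncnS_gt _)) _.
    by rewrite ler_nat ltnS leq_max HN1.
move=> k; apply: scale_le.
pose lev z := Num.truncn (k.+1%:R * rr z)%R.
pose L := (k.+1 * k).+1.
pose Mn := (Num.truncn (C * k%:R)%R).+1.
have CM : (C * k%:R <= Mn%:R)%R by exact/ltW/truncnS_gt.
have k10 : (0 < k.+1%:R :> R)%R by [].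
have lev_le z : E k z -> (lev z < L)%N.
  move=> [[[Dz _] /= rk] _]; rewrite truncn_lt_nat ?mulr_ge0 ?rr_ge0//.
  apply: (@le_lt_trans _ _ ((k.+1 * k)%:R : R)%R); last by rewrite ltr_nat.
  by rewrite natrM ler_pM2l.
(* If the radius at [tau h w] were the larger one, [gap] at [tau h w] would make it larger by
   [k.+1%:R^-1] and push its level above that of [w]. *)
have ordered w h : dom h w -> D w -> E k (tau h w) -> (lev (tau h w) <= lev w)%N ->
    (exists g, Sr (tau h w) g /\ Sr w (g * h)%g) -> (r (tau h w) <= r w)%R.
  move=> hd Dw [[[Dh _] _] gh] le [g [Sg Sg']]; rewrite leNgt; apply/negP => lt.
  have clh : clash (tau h w) h^-1%g.
    rewrite /clash (pactK act)// !rrE//; split => //; first exact: pactV act _ _ hd.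
    by exists (g * h)%g; split => //; rewrite -mulgA mulgV mulg1.
  have := gh _ clh; rewrite (pactK act)// leNgt => /negP; apply.
  rewrite -(ltr_pM2l k10) mulfV ?gt_eqF// mulrBr ltrBlDr.
  have /andP[l1 _] := truncn_itv (mulr_ge0 (ltW k10) (rr_ge0 Dw)).
  apply: lt_le_trans (truncnS_gt _) _.
  rewrite -/(lev (tau h w)) -natr1 addrC lerD2l.
  by apply: le_trans l1; rewrite ler_nat.
have confl w : E k w ->
    ecard (conflicts [set s | (s <= r w)%R] (r w) w) <= Mn%:R%:E :> \bar R.
  move=> [[[Dw Sk] _] _]; apply: le_trans (reg _ _ (DZ0 Dw) (IIr Dw)) _.
  rewrite -SrE//; apply: (@le_trans _ _ (C%:E * k%:R%:E)); last by rewrite -EFinM lee_fin.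
  by apply: lee_wpmul2l; [rewrite lee_fin ltW|exact: Sk].
(* Every level, from [L.-1] downwards, occupies [Mn] consecutive steps. A single step may give as
   little weight as 1 / [Mn]; repeated [Mn] times it gives at least 1, whence [kappa = 1]. *)
pose G i := E k `&` [set z | lev z = (L.-1 - i %/ Mn)%N].
pose Rel j := E k `&` [set z | (lev z <= L.-1 - j %/ Mn)%N].
have mlev : measurable_fun setT (fun z => (k.+1%:R * rr z)%R) by exact: measurable_funM.
have mlev_le q : measurable [set z | (lev z <= q)%N].
  rewrite (_ : [set z | _] = [set z | (k.+1%:R * rr z < q.+1%:R)%R]).
    by exact: measurable_set_lt.
  by apply/seteqP; split => z /=; rewrite truncn_le_nat.
have mlev_eq q : measurable [set z | lev z = q].
  case: q => [|q].
    rewrite (_ : [set z | _] = [set z | (lev z <= 0)%N]) //.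
    by apply/seteqP; split => z /=; rewrite leqn0 => /eqP.
  rewrite (_ : [set z | _] = [set z | (lev z <= q.+1)%N] `\` [set z | (lev z <= q)%N]).
    exact: measurableD.
  apply/seteqP; split => z /=; first by move=> ->; split => //; rewrite ltnn.
  by move=> [? /negP]; rewrite -ltnNge => ?; apply/eqP; rewrite eqn_leq; apply/andP.
rewrite -[X in (_ + X)%R]invr1.
apply: (@fractional_covering R _ Z m Gamma countG dom tau act Sr f G
  (fun=> Mn%:R) _ _ _ _ _ _ _ eps _ _ (E k) (L * Mn)%N Rel C 1) => //.
- by move=> i; exact: measurableI.
(* Candidates of one level whose sets contain [v] all conflict with any fixed one of them,
   [tau h0 v]; equal levels order the radii by [ordered], so [confl] at [tau h0 v] counts them. *)
- move=> i v; set Hs := hits _ _ _.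
  have [->|/set0P[h0 [hd0 [[Eh0 lh0] Sh0]]]] := eqVneq Hs set0.
    by rewrite /ecard esum_set0 lee_fin.
  have [[[Dh0 _] _] _] := Eh0.
  apply: le_trans (confl _ Eh0).
  apply: (le_ecard (e := fun h => (h * h0^-1)%g)); first by move=> ? ? _ _ /mulIg.
  move=> h [hd [[Eh lh] Sh]].
  have [d1 e1] := pactM act (pactV act hd0) ltac:(by rewrite (pactK act hd0); exact: hd).
  rewrite (pactK act hd0) in e1.
  have [[[Dh _] _] _] := Eh.
  have S2 : exists g, Sr (tau (h * h0^-1)%g (tau h0 v)) g /\
      Sr (tau h0 v) (g * (h * h0^-1))%g.
    by exists h^-1%g; rewrite e1 mulgA mulVg mul1g.
  split => //; exists (r (tau h v)).
    split; first exact: IIr.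
    rewrite /= -e1; apply: ordered => //; rewrite e1//.
    by rewrite lh lh0.
  by move: S2; rewrite e1 => -[g [[_ ?] [_ ?]]]; exists g.
- by move=> i z [[[[Dz _] _] _] _]; rewrite SrE//; exact: heavyr.
- by move=> j; exact: measurableI.
- exact: ltW.
- move=> j w [Ew lw]; have [[[Dw _] _] _] := Ew.
  rewrite [X in _ <= _ * ecard X]SrE//.
  apply: le_trans (reg _ _ (DZ0 Dw) (IIr Dw)); apply: esum_sub => // h.
  move=> [hd _ [Eh lh] Sg]; split => //.
  have [[[Dh _] _] _] := Eh.
  exists (r (tau h w)); last by move: Sg => [g [[_ ?] [_ ?]]]; exists g.
  by split; [exact: IIr|apply: ordered => //; rewrite lw].
- move=> z Ez; have [[[Dz _] _] _] := Ez; have lz := lev_le z Ez.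
  have lz' : (lev z <= L.-1)%N by rewrite -ltnS.
  have Mn0 : (0 < Mn)%N by [].
  have divj j : ((L.-1 - lev z) * Mn <= j < (L.-1 - lev z) * Mn + Mn)%N ->
      (j %/ Mn = L.-1 - lev z)%N.
    by move=> /andP[j1 j2]; apply/eqP; rewrite eqn_leq leq_divRL// j1 andbT
      -ltnS ltn_divLR// mulSn addnC.
  exists ((L.-1 - lev z) * Mn)%N, ((L.-1 - lev z) * Mn + Mn)%N; split.
  + rewrite leq_addr/= addnC -mulSn leq_mul2r; apply/orP; right.
    by rewrite -(@prednK L)// ltnS leq_subr.
  + by move=> j jI; split => //=; rewrite divj// subKn.
  + move=> j jI; split => //=; rewrite -[leqLHS](subKn lz') leq_sub2l//.
    by rewrite -ltnS ltn_divLR// mulSn addnC (ltn_trans _ jI).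
  + rewrite -ge0_sume_distrl ?sumEFin//.
    rewrite sumr_const_nat addKn -(mulr_natr (Mn%:R^-1)%R) mulVf ?mul1e ?pnatr_eq0//.
    have [g Sg] := S_nonempty (DZ0 Dz) (IIr Dz).
    by apply: (@ecard_ge1 _ _ _ g); rewrite SrE.
Qed.

End selected.

(** The exceptional set is a measurable hull of the set of large averages. Were the hull too large,
    a radius could be selected measurably on a set whose measure still exceeds the bound, against
    the inequality for selected radii. *)
Lemma weak_type_of_selected (c0 : R) : (0 <= c0)%R ->
  (forall (f : Z -> R) (eps : R) (D : set Z) (r : Z -> measurableTypeR R),
    measurable_fun setT f -> (forall z, 0 <= f z)%R -> (0 < eps)%R ->
    measurable D -> measurable_fun D r -> D `<=` Z0 ->
    (forall z, D z -> II (r z)) ->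
    (forall z, D z -> eps%:E * ecard (S (r z) z) <=
      \esum_(g in S (r z) z) (f (tau g z))%:E) ->
    m D <= (c0 / eps)%:E * \int[m]_z (f z)%:E) ->
  forall (f : Z -> R) (eps : R), measurable_fun setT f ->
    (forall z, 0 <= f z)%R -> (0 < eps)%R ->
  exists D : set Z, [/\ measurable D,
    forall z r, Z0 z -> II r -> eps%:E * ecard (S r z) <
      \esum_(g in S r z) (f (tau g z))%:E -> D z &
    m D <= (c0 / eps)%:E * \int[m]_z (f z)%:E].
Proof.
move=> c00 H f eps mf f0 eps0.
pose W : set (Z * measurableTypeR R) := [set u | Z0 u.1 /\
  (eps%:E * (\esum_(g in [set g | II u.2 /\ S u.2 u.1 g]) 1) <
  \esum_(g in [set g | II u.2 /\ S u.2 u.1 g]) (f (tau g u.1))%:E)%E].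
have mW : measurable W.
  apply: measurableI.
    by rewrite -[X in measurable X]setTI; exact: measurable_fst.
  rewrite -[X in measurable X]setTI; apply: measurable_lte => //.
    by apply: emeasurable_funM => //; apply: measurable_esum => //.
  apply: measurable_esum => // g; last by move=> u; rewrite lee_fin.
  apply/measurable_EFinP; apply: (measurableT_comp mf).
  exact: (measurableT_comp (pact_meas act g) measurable_fst).
have WII z r : W (z, r) -> II r.
  move=> [_ /=]; apply: contraPP => nII.
  by rewrite (_ : [set g | _] = set0) ?esum_set0 ?mule0 ?ltxx//;
    apply/seteqP; split => g // [].
have WE z r : II r -> [set g | II r /\ S r z g] = S r z.
  by move=> IIr; apply/seteqP; split => g // [].
have [D [mD WD mDE]] := outer_hull m_fin [set z | exists r, W (z, r)].
exists D; split => //.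
  by move=> z r Zz IIr lt; apply: WD; exists r; split => //=; rewrite WE.
rewrite mDE leNgt; apply/negP => lt.
have I0 : 0 <= (c0 / eps)%:E * \int[m]_z (f z)%:E.
  by rewrite mule_ge0 ?lee_fin ?divr_ge0 ?(ltW eps0)// integral_ge0// => z _; rewrite lee_fin.
set c := _ * _ in lt I0.
have [c' cc' c'o] : exists2 c', c < c' & c' < outer m [set z | exists r, W (z, r)].
  have cf : c \is a fin_num by rewrite ge0_fin_numE// (lt_trans lt)// ltey_eq outer_fin.
  exists ((fine c + fine (outer m [set z | exists r, W (z, r)])) / 2)%:E.
    rewrite -{1}(fineK cf) lte_fin midf_lt//.
    by rewrite -lte_fin !fineK// outer_fin.
  rewrite -[ltRHS](fineK (outer_fin m_fin _)) lte_fin midf_lt//.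
  by rewrite -lte_fin !fineK// outer_fin.
have [D' [r [mD' mr c'D WD']]] := measurable_selection m_fin mW c'o.
have := lt_le_trans cc' c'D; rewrite ltNge => /negP; apply.
apply: (H f eps D' r) => //.
- by move=> z Dz; have [] := WD' z Dz.
- by move=> z Dz; exact: WII (WD' z Dz).
- by move=> z Dz; have [_ /ltW] := WD' z Dz; rewrite /= WE//; exact: WII (WD' z Dz).
Qed.

Lemma weak_type_regular (C : R) : abstract_regular C ->
  forall (f : Z -> R) (eps : R), measurable_fun setT f ->
    (forall z, 0 <= f z)%R -> (0 < eps)%R ->
  exists D : set Z, [/\ measurable D,
    forall z r, Z0 z -> II r -> eps%:E * ecard (S r z) <
      \esum_(g in S r z) (f (tau g z))%:E -> D z &
    m D <= (2 * (2 * C + 1) / eps)%:E * \int[m]_z (f z)%:E].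
Proof.
move=> reg; have [C0 _] := reg; apply: weak_type_of_selected.
  by rewrite ltW// mulr_gt0// addr_gt0// mulr_gt0.
by move=> f eps D r mf f0 e0 mD mr DZ IIr hv; exact: (@regular_selected f eps D r).
Qed.

Lemma weak_type_tempered (C Cu : R) (a b : nat -> R) :
  abstract_tempered C Cu a b ->
  forall (f : Z -> R) (eps : R), measurable_fun setT f ->
    (forall z, 0 <= f z)%R -> (0 < eps)%R ->
  exists D : set Z, [/\ measurable D,
    forall z r, Z0 z -> II r -> eps%:E * ecard (S r z) <
      \esum_(g in S r z) (f (tau g z))%:E -> D z &
    m D <= (2 * (2 * C + Cu) / eps)%:E * \int[m]_z (f z)%:E].
Proof.
move=> temp; have [_ [C0 Cu0] _ _ _] := temp; apply: weak_type_of_selected.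
  by rewrite mulr_ge0// addr_ge0 ?mulr_ge0// ltW.
move=> f eps D r mf f0 e0 mD mr DZ IIr hv.
exact: (@tempered_selected f eps D r _ _ _ _ _ _ _ _ C Cu a b).
Qed.

End weak_type.

(** * The partial action on a skew product *)

Section log_RN_change.
Local Open Scope ereal_scope.
Context {R : realType} {Gamma : groupType} d {B : measurableType d}.
Variables (nu : probability B R) (act : Gamma -> {mfun B >-> B}).
Hypothesis act_action : is_action act.
Hypothesis act_mcp : class_preserving nu act.
Variables (lambda : R) (lambda01 : (0 < lambda < 1)%R).
Variables (rho : Gamma -> B -> int) (rho_R : log_RN_cocycle lambda nu act rho).

Lemma cocycle1 b : rho 1%g b = 0%R.
Proof.
have := rho_cocycle rho_R 1%g 1%g b; rewrite mulg1.
have [-> _] := act_action; move=> /eqP.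
by rewrite -{1}[rho 1%g b]addr0 (inj_eq (addrI _)) => /eqP <-.
Qed.

Lemma cocycleV g b : rho g^-1%g (act g b) = (- rho g b)%R.
Proof.
apply/eqP; rewrite -addr_eq0; apply/eqP.
by rewrite -(rho_cocycle rho_R) mulVg cocycle1.
Qed.

(** The density [h] of the image of [nu] under [g^-1] equals the power [rho g b] of [lambda] almost
    everywhere, hence is constant where [rho g b = j]. *)
Lemma log_RN_change g (j : int) (phi : B -> \bar R) :
  measurable_fun setT phi -> (forall b, 0 <= phi b) ->
  \int[nu]_(b in [set b | rho g b = j]) phi (act g b) =
  (lambda `^ (- j%:~R))%:E * \int[nu]_(b in [set b | rho g^-1%g b = (- j)%R]) phi b.
Proof.
move=> mphi phi0; have /andP[l0 l1] := lambda01.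
have [act1 actM] := act_action.
have actK b : act g^-1%g (act g b) = b by rewrite -actM mulVg act1.
have actVK b : act g (act g^-1%g b) = b by rewrite -actM mulgV act1.
pose dist := distribution nu (act g^-1%g).
have distdom : dist `<< nu.
  apply/null_content_dominatesP => A mA A0; rewrite /dist /distribution /pushforward.
  by apply/act_mcp.
pose h := Radon_Nikodym_SigmaFinite.f dist nu.
have h0 b : 0 <= h b by exact: Radon_Nikodym_SigmaFinite.f_ge0.
have hfin b : h b \is a fin_num by exact: Radon_Nikodym_SigmaFinite.f_fin_num.
have mh : measurable_fun setT h.
  by apply: (measurable_int nu); exact: Radon_Nikodym_SigmaFinite.f_integrable.
have mE := rho_measurable rho_R g j.
(* [ln] takes the value 0 at 0, so [log_RN] does not exclude zeros of the density; preservation of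
   the measure class does. *)
have hpos : {ae nu, forall b, 0 < h b}.
  have mN : measurable (h @^-1` [set 0]) by rewrite -[X in measurable X]setTI; exact: mh.
  exists (h @^-1` [set 0]); split => //; last first.
    by move=> b /= /negP; rewrite lt_neqAle h0 andbT negbK eq_sym => /eqP.
  apply/(act_mcp g^-1%g) => //.
  have -> : nu (act g^-1%g @^-1` (h @^-1` [set 0])) = dist (h @^-1` [set 0]) by [].
  have -> : dist (h @^-1` [set 0]) = \int[nu]_(b in h @^-1` [set 0]) h b.
    exact: (Radon_Nikodym_SigmaFinite.f_integral distdom mN).
  by rewrite integral0_eq// => b /=.
have hE : {ae nu, forall b, h b = (lambda `^ (rho g b)%:~R)%:E}.
  have RNe := @ae_eq_Radon_Nikodym_SigmaFinite _ _ _ dist nu distdom setT measurableT.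
  have logE := rho_log_RN rho_R g.
  near=> b.
  have hb0 : 0 < h b by near: b.
  have eqh : h b = Radon_Nikodym (charge_of_finite_measure dist) nu b.
    by near: b; apply: filterS RNe => b; exact.
  have : log_RN lambda nu act g b = (rho g b)%:~R by near: b.
  rewrite /log_RN -/dist -eqh => /(congr1 (fun x => x * ln lambda)%R).
  rewrite mulfVK; last by rewrite lt_eqF// ln_lt0// l0.
  move=> e; rewrite -(fineK (hfin b)) /powR gt_eqF// -e lnK// posrE fine_gt0// hb0/=.
  by rewrite ltey_eq hfin.
have mphig : measurable_fun setT (fun b => phi (act g b)) by exact: measurableT_comp.
have key : \int[nu]_(b in [set b | rho g b = j]) (phi (act g b) * h b) =
    \int[nu]_(b in [set b | rho g^-1%g b = (- j)%R]) phi b.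
  rewrite (Radon_Nikodym_SigmaFinite.change_of_variables distdom)//; last first.
    exact: measurable_funTS.
  rewrite (@ge0_integral_pushforward _ _ _ _ _ (act g^-1%g))//; last exact: measurable_funTS.
  rewrite (_ : act g^-1%g @^-1` [set b | rho g b = j] =
      [set b | rho g^-1%g b = (- j)%R]).
    by apply: eq_integral => b _ /=; rewrite actVK.
  apply/seteqP; split => b /=.
    by move=> <-; rewrite -cocycleV actVK.
  by move=> e; have := cocycleV g^-1%g b; rewrite invgK e opprK.
rewrite -key.
transitivity ((lambda `^ (- j%:~R))%:E * \int[nu]_(b in [set b | rho g b = j])
    ((lambda `^ j%:~R)%:E * phi (act g b))); last first.
  congr (_ * _); apply: ae_eq_integral => //.
  - by apply: emeasurable_funM => //; exact: measurable_funTS.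
  - by apply: measurable_funTS; exact: emeasurable_funM.
  - by apply: filterS hE => b -> /= <-; rewrite muleC.
rewrite ge0_integralZl ?lee_fin ?powR_ge0//; last exact: measurable_funTS.
rewrite muleA -EFinM -powRD; last by rewrite (gt_eqF l0) implybT.
by rewrite addNr powRr0 mul1e.
Unshelve. all: by end_near.
Qed.

End log_RN_change.

Section prod_ord.
Local Open Scope ereal_scope.
Context {R : realType} d {T : measurableType d} {n : nat}.

Lemma measurable_fun_ord d' {U : measurableType d'} (F : T * 'I_n.+1 -> U) :
  (forall t, measurable_fun setT (fun x => F (x, t))) -> measurable_fun setT F.
Proof.
move=> mF _ Y mY; rewrite setTI.
rewrite (_ : F @^-1` Y = \bigcup_t (((fun x => F (x, t)) @^-1` Y) `*` [set t])).
  apply: countable_bigcupT_measurable; first exact: finite_set_countable.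
  move=> t; apply: measurableX => //.
  by rewrite -[X in measurable X]setTI; exact: mF.
apply/seteqP; split => -[x t] /=; first by move=> ?; exists t.
by move=> [s _ [? /= ->]].
Qed.

Lemma integral_theta (lambda : R) (h : 'I_n.+1 -> \bar R) : (forall t, 0 <= h t) ->
  \int[theta lambda n]_t h t = \sum_(t < n.+1) (theta_weight lambda n t)%:E * h t.
Proof.
move=> h0.
transitivity (\int[msum (fun k => mscale (NngNum (theta_weight_ge0 lambda n k))
    (\d_(inord k : 'I_n.+1))) n.+1]_t h t).
  exact: eq_measure_integral.
rewrite ge0_integral_measure_sum//; apply: eq_bigr => t _.
rewrite ge0_integral_mscale//= integral_dirac// diracT mul1e.
by rewrite inord_val.
Qed.

Lemma integral_prod_theta (P : probability T R) (lambda : R)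
    (F : T * 'I_n.+1 -> \bar R) :
  measurable_fun setT F -> (forall z, 0 <= F z) ->
  \int[P \x theta lambda n]_z F z =
  \sum_(t < n.+1) (theta_weight lambda n t)%:E * \int[P]_x F (x, t).
Proof.
move=> mF F0; rewrite fubini_tonelli1//.
have mFt t : measurable_fun setT (fun x => F (x, t)) by exact: measurableT_comp.
transitivity (\int[P]_x \sum_(t < n.+1) (theta_weight lambda n t)%:E * F (x, t)).
  by apply: eq_integral => x _; rewrite /fubini_F integral_theta.
rewrite ge0_integral_sum//.
- apply: eq_bigr => t _; rewrite ge0_integralZl//.
  by rewrite lee_fin theta_weight_ge0.
- by move=> t; exact: emeasurable_funM.
- by move=> t x _; rewrite mule_ge0// lee_fin theta_weight_ge0.
Qed.

End prod_ord.

Section skew_partial_action.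
Local Open Scope ereal_scope.
Context {R : realType} {Gamma : groupType} d {T : measurableType d}.
Variables (P : probability T R).
Variables (act : Gamma -> T -> T) (rho : Gamma -> T -> int) (lambda : R) (n : nat).

(** The points kept inside the window [I] by [g]; off this set, [inord] and [absz] give [stau] an
    arbitrary second coordinate. *)
Definition sdom (g : Gamma) : set (T * 'I_n.+1) :=
  [set z : T * 'I_n.+1 | exists t : 'I_n.+1, ((z.2 : nat)%:Z + rho g z.1 = (t : nat)%:Z)%R].

Definition stau (g : Gamma) (z : T * 'I_n.+1) : T * 'I_n.+1 :=
  (act g z.1, inord (absz ((z.2 : nat)%:Z + rho g z.1)%R)).

Lemma stau2 g z : sdom g z ->
  (((stau g z).2 : nat)%:Z = (z.2 : nat)%:Z + rho g z.1)%R.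
Proof. by move=> [t /= ->]; rewrite absz_nat inordK. Qed.

Lemma stau_eq g (z : T * 'I_n.+1) (t : 'I_n.+1) : ((z.2 : nat)%:Z + rho g z.1 = (t : nat)%:Z)%R ->
  stau g z = (act g z.1, t).
Proof. by move=> e; rewrite /stau e absz_nat inord_val. Qed.

Lemma restricted_relP x y :
  restricted_rel act rho x y <-> exists2 g, sdom g x & y = stau g x.
Proof.
split.
  move=> [g [e1 e2]]; exists g; first by exists y.2.
  rewrite (stau_eq (t := y.2))//; first by rewrite -e1; case: y {e1 e2}.
move=> [g gx ->]; exists g; rewrite /skew_action/=; congr pair.
exact: stau2.
Qed.

Hypothesis act_action : is_action act.
Hypothesis mact : forall g, measurable_fun setT (act g).
Hypothesis mrho : forall g k, measurable [set x | rho g x = k].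
Hypothesis rhoM : forall g h x, (rho (g * h)%g x = rho g (act h x) + rho h x)%R.

Lemma sdom1 z : sdom 1%g z /\ stau 1%g z = z.
Proof.
have [act1 _] := act_action.
have r1 : rho 1%g z.1 = 0%R.
  have := rhoM 1%g 1%g z.1; rewrite mulg1 act1 => /eqP.
  by rewrite -{1}[rho 1%g _]addr0 (inj_eq (addrI _)) => /eqP <-.
have e : ((z.2 : nat)%:Z + rho 1%g z.1 = (z.2 : nat)%:Z)%R by rewrite r1 addr0.
by split; [exists z.2|rewrite (stau_eq e) act1; case: z {e r1}].
Qed.

Lemma sdomM g h z : sdom h z -> sdom g (stau h z) ->
  sdom (g * h)%g z /\ stau (g * h)%g z = stau g (stau h z).
Proof.
have [_ actM] := act_action.
move=> hz [t tE]; have e2 := stau2 hz.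
have e : ((z.2 : nat)%:Z + rho (g * h)%g z.1 = (t : nat)%:Z)%R.
  by rewrite -tE e2 rhoM /= addrA addrAC.
by split; [exists t|rewrite (stau_eq e) (stau_eq tE) actM].
Qed.

Lemma sdomV g z : sdom g z -> sdom g^-1%g (stau g z).
Proof.
move=> gz; have e2 := stau2 gz; exists z.2; rewrite e2/=.
have [act1 _] := act_action.
have [_ r1] := sdom1 z.
have := rhoM g^-1%g g z.1; rewrite mulVg => e.
have r10 : rho 1%g z.1 = 0%R.
  have := rhoM 1%g 1%g z.1; rewrite mulg1 act1 => /eqP.
  by rewrite -{1}[rho 1%g _]addr0 (inj_eq (addrI _)) => /eqP <-.
by rewrite -addrA [(rho g _ + _)%R]addrC -e r10 addr0.
Qed.

Let mrhoP g (Q : 'I_n.+1 -> int -> Prop) :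
  measurable [set z : T * 'I_n.+1 | Q z.2 (rho g z.1)].
Proof.
rewrite (_ : [set z | _] = \bigcup_(u : 'I_n.+1 * int)
    ([set x | rho g x = u.2 /\ Q u.1 u.2] `*` [set u.1])).
  apply: countable_bigcupT_measurable => // u; apply: measurableX => //.
  have [q|nq] := pselect (Q u.1 u.2).
    rewrite (_ : [set x | _] = [set x | rho g x = u.2])//.
    by apply/seteqP; split => x //= [].
  by rewrite (_ : [set x | _] = set0)//; apply/seteqP; split => x //= [].
apply/seteqP; split => -[x t] /=; first by move=> q; exists (t, rho g x).
by move=> [[s k] _ [[/= <- q] ->]].
Qed.

Lemma measurable_sdom g : measurable (sdom g).
Proof. exact: (mrhoP g (fun t k => exists s : 'I_n.+1, (t : nat)%:Z + k = (s : nat)%:Z)%R). Qed.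

Lemma measurable_stau g : measurable_fun setT (stau g).
Proof.
apply: measurable_fun_pair; first by exact: measurableT_comp.
move=> _ Y _; rewrite setTI.
exact: (mrhoP g (fun t k => Y (inord (absz ((t : nat)%:Z + k)%R)))).
Qed.

(** The domain is cut according to the starting level [t] and the arrival level [s]; on each piece
    [rho g] is the constant s - t. *)
Let integral_sdom g (K : 'I_n.+1 -> 'I_n.+1 -> T -> \bar R) :
  (forall t s, measurable_fun setT (K t s)) -> (forall t s x, 0 <= K t s x) ->
  \int[P \x theta lambda n]_(z in sdom g) K z.2 (stau g z).2 z.1 =
  \sum_(t < n.+1) \sum_(s < n.+1) (theta_weight lambda n t)%:E *
    \int[P]_(x in [set x | (rho g x = (s : nat)%:Z - (t : nat)%:Z)%R]) K t s x.
Proof.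
move=> mK K0.
have E x t : ((fun z => K z.2 (stau g z).2 z.1) \_ (sdom g)) (x, t) =
    \sum_(s < n.+1) ((K t s) \_ [set x | (rho g x = (s : nat)%:Z - (t : nat)%:Z)%R]) x.
  rewrite patchE; case: ifPn => [/set_mem[s /= es]|/negP nd].
    rewrite (bigD1 s)//= big1 ?adde0; last first.
      move=> s' ss'; rewrite patchE ifF//; apply/negP => /set_mem /= e.
      move: es; rewrite e addrC subrK => -[] /ord_inj e'.
      by rewrite e' eqxx in ss'.
    rewrite patchE mem_set/=; last by rewrite -es addrAC subrr add0r.
    by rewrite /= es absz_nat inord_val.
  rewrite big1// => s _; rewrite patchE ifF//; apply/negP => /set_mem /= e.
  by apply/nd/mem_set; exists s => /=; rewrite e addrC subrK.
rewrite integral_mkcond integral_prod_theta; last 2 first.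
- apply: measurable_fun_ord => t.
  rewrite (_ : (fun x => _) = fun x => \sum_(s < n.+1)
    ((K t s) \_ [set x | (rho g x = (s : nat)%:Z - (t : nat)%:Z)%R]) x).
    by apply: emeasurable_sum => s; apply: measurable_patchT.
  by apply/funext => x; exact: E.
- by move=> z; rewrite patchE; case: ifP.
apply: eq_bigr => t _.
transitivity ((theta_weight lambda n t)%:E * \sum_(s < n.+1)
    \int[P]_(x in [set x | (rho g x = (s : nat)%:Z - (t : nat)%:Z)%R]) K t s x).
  congr (_ * _); under eq_integral => x _ do rewrite E.
  rewrite ge0_integral_sum//.
  - by apply: eq_bigr => s _; rewrite [RHS]integral_mkcond.
  - by move=> s; exact: measurable_patchT.
  - by move=> s x _; rewrite patchE; case: ifP.
by rewrite ge0_sume_distrr// => s _; exact: integral_ge0.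
Qed.

Hypothesis lambda0 : (0 < lambda)%R.
Hypothesis quasi : forall g (j : int) (phi : T -> \bar R),
  measurable_fun setT phi -> (forall x, 0 <= phi x) ->
  \int[P]_(x in [set x | rho g x = j]) phi (act g x) =
  (lambda `^ (- j%:~R))%:E * \int[P]_(x in [set x | rho g^-1%g x = (- j)%R]) phi x.

(** The weights of [theta] compensate the density: moving from level t to level s costs lambda^(-(s
    - t)), and lambda^(-t) lambda^(-(s - t)) = lambda^(-s). *)
Lemma skew_partial_action : partial_action (P \x theta lambda n) sdom stau.
Proof.
split.
- exact: measurable_sdom.
- exact: measurable_stau.
- exact: sdom1.
- exact: sdomM.
- exact: sdomV.
move=> g f mf f0.
have mft t : measurable_fun setT (fun x => f (x, t)) by exact: measurableT_comp.
transitivity (\int[P \x theta lambda n]_(z in sdom g)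
    (fun t s x => f (act g x, s)) z.2 (stau g z).2 z.1) => //.
rewrite (@integral_sdom g (fun t s x => f (act g x, s)))//; last first.
  by move=> t s; exact: measurableT_comp (mft s) (mact g).
transitivity (\int[P \x theta lambda n]_(z in sdom g^-1%g)
    (fun t s x => f (x, t)) z.2 (stau g^-1%g z).2 z.1); last first.
  by apply: eq_integral => -[].
rewrite (@integral_sdom g^-1%g (fun t s x => f (x, t)))//.
rewrite exchange_big/=; apply: eq_bigr => s _; apply: eq_bigr => t _.
rewrite (quasi _ _ (mft s))// opprB muleA -EFinM; congr (_%:E * _).
rewrite /theta_weight mulrAC; congr (_ / _)%R.
rewrite -powRD; last by rewrite (gt_eqF lambda0) implybT.
by congr (powR _ _); rewrite intrB -!pmulrn opprB addrA addNr add0r.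
Qed.

End skew_partial_action.

Section quasi_invariance_prod.
Local Open Scope ereal_scope.
Context {R : realType} {Gamma : groupType}.
Context dB {B : measurableType dB} dX {X : measurableType dX}.
Variables (nu : probability B R) (mu : probability X R).
Variables (actB : Gamma -> {mfun B >-> B}) (actX : Gamma -> {mfun X >-> X}).
Variables (rho : Gamma -> B -> int) (lambda : R).
Hypothesis mrho : forall g k, measurable [set b | rho g b = k].
Hypothesis actX_mp : measure_preserving mu actX.
Hypothesis quasi : forall g (j : int) (phi : B -> \bar R),
  measurable_fun setT phi -> (forall x, 0 <= phi x) ->
  \int[nu]_(x in [set x | rho g x = j]) phi (actB g x) =
  (lambda `^ (- j%:~R))%:E * \int[nu]_(x in [set x | rho g^-1%g x = (- j)%R]) phi x.

Lemma measurable_diag_action g : measurable_fun setT (diag_action actB actX g).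
Proof.
by apply: measurable_fun_pair; apply: measurableT_comp.
Qed.

Let integral_actX g (h : X -> \bar R) : measurable_fun setT h ->
  (forall x, 0 <= h x) -> \int[mu]_x h (actX g x) = \int[mu]_x h x.
Proof.
move=> mh h0.
rewrite -[LHS](@ge0_integral_pushforward _ _ _ _ _ (actX g) _ mu setT h)//.
by apply: eq_measure_integral => A mA _; exact: actX_mp.
Qed.

Let fubini_cond (D : set B) (psi : B * X -> \bar R) : measurable D ->
  measurable_fun setT psi -> (forall z, 0 <= psi z) ->
  \int[nu \x mu]_(z in [set z | D z.1]) psi z = \int[nu]_(b in D) \int[mu]_x psi (b, x).
Proof.
move=> mD mpsi psi0.
have mD' : measurable [set z : B * X | D z.1].
  by rewrite -[X in measurable X]setTI; exact: measurable_fst.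
rewrite integral_mkcond fubini_tonelli1//; last 2 first.
- exact: measurable_patchT.
- by move=> z; rewrite patchE; case: ifP.
rewrite [RHS]integral_mkcond; apply: eq_integral => b _.
rewrite /fubini_F patchE; case: ifPn => [/set_mem Db|/negP nDb].
  by apply: eq_integral => x _; rewrite patchE mem_set.
rewrite integral0_eq// => x _; rewrite patchE ifF//; apply/negP => /set_mem Db.
exact/nDb/mem_set.
Qed.

Lemma quasi_prod g (j : int) (phi : B * X -> \bar R) :
  measurable_fun setT phi -> (forall x, 0 <= phi x) ->
  \int[nu \x mu]_(x in [set x | rho g x.1 = j]) phi (diag_action actB actX g x) =
  (lambda `^ (- j%:~R))%:E *
    \int[nu \x mu]_(x in [set x | rho g^-1%g x.1 = (- j)%R]) phi x.
Proof.
move=> mphi phi0.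
rewrite (@fubini_cond [set b | rho g b = j] (phi \o diag_action actB actX g))//; last 2 first.
- exact: measurableT_comp (measurable_diag_action g).
- by move=> z; exact: phi0.
rewrite (@fubini_cond [set b | rho g^-1%g b = (- j)%R] phi)//.
have q := @quasi g j (fun b => \int[mu]_x phi (b, x)).
rewrite -q//; last 2 first.
- exact: (@measurable_fun_fubini_tonelli_F _ _ _ _ _ mu phi mphi phi0).
- by move=> b; exact: integral_ge0.
apply: eq_integral => b _.
rewrite -(@integral_actX g (fun x => phi (actB g b, x)))//.
exact: measurableT_comp.
Qed.

End quasi_invariance_prod.

Section invariant_sets.
Local Open Scope ereal_scope.
Context {R : realType} d {Z : measurableType d} (m : {measure set Z -> \bar R}).
Context {Gamma : groupType} (countG : countable [set: Gamma]).
Context {dom : Gamma -> set Z} {tau : Gamma -> Z -> Z}.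
Hypothesis act : partial_action m dom tau.

(** All points with some image in the null set [N] are discarded. For each [g] they form a null set
    by [pact_inv], and the group is countable. *)
Lemma invariant_conull (P : Z -> Prop) : {ae m, forall z, P z} ->
  exists Z0 : set Z, [/\ measurable Z0, m (~` Z0) = 0,
    forall z, Z0 z -> P z &
    forall z g, Z0 z -> dom g z -> Z0 (tau g z)].
Proof.
move=> [N [mN N0 PN]].
pose U g := dom g `&` [set z | N (tau g z)].
have mU g : measurable (U g).
  apply: measurableI; first exact: pact_dom act _.
  by rewrite -[X in measurable X]setTI; exact: (pact_meas act g measurableT mN).
have U0 g : \int[m]_(z in U g) 1 = 0.
  transitivity (\int[m]_(z in dom g) (if tau g z \in N then 1 else 0)).
    rewrite integral_mkcond [RHS]integral_mkcond; apply: eq_integral => z _.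
    rewrite !patchE; have [/set_mem zd|/negP nzd] := boolP (z \in dom g).
      case: ifPn => [/set_mem[_ Nz]|/negP nU]; first by rewrite mem_set.
      by rewrite ifF//; apply/negP => /set_mem Nz; apply: nU; exact/mem_set.
    by rewrite ifF//; apply/negP => /set_mem[zd _]; exact/nzd/mem_set.
  rewrite (pact_inv act g (f := fun z => if z \in N then 1 else 0)); last 2 first.
  - exact: (measurable_indic_fun mN (measurable_cst _)).
  - by move=> z; case: ifP.
  apply/eqP; rewrite eq_le integral_ge0 ?andbT; last by move=> z _; case: ifP.
  apply: (@le_trans _ _ (\int[m]_z (if z \in N then 1 else 0))).
    rewrite integral_mkcond; apply: le_integral_nneg => z _; rewrite patchE.
      by case: ifP => // _; case: ifP.
    by case: ifP => //; case: ifP.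
  rewrite [leLHS](_ : _ = \int[m]_(z in N) cst 1 z); first by rewrite integral_cst// N0 mule0.
  by rewrite [RHS]integral_mkcond; apply: eq_integral => z _; rewrite patchE.
have mUU : measurable (\bigcup_g U g) by exact: countable_bigcupT_measurable.
exists (~` \bigcup_g U g); split.
- exact: measurableC.
- rewrite setCK; apply/eqP; rewrite eq_le measure_ge0 andbT.
  rewrite -[leLHS]mul1e -(integral_cst _ mUU).
  apply: (@le_trans _ _ (\int[m]_z ecard [set g | U g z])).
    rewrite integral_mkcond; apply: le_integral_nneg => z _; rewrite patchE.
      by case: ifP.
    case: ifPn => [/set_mem[g _ Ug]|_]; last exact: ecard_ge0.
    exact: (@ecard_ge1 _ _ _ g).
  rewrite (@integral_esum R d Z m Gamma countG (fun z => [set g | U g z])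
    (fun _ _ => 1))// esum1// => g _.
  exact: U0.
- move=> z nU; apply: contrapT => nP; apply: nU; exists 1%g => //.
  by have [? e] := pact1 act z; split => //=; rewrite e; exact: PN.
- move=> z g nU gz [h _ [hd /= Nh]]; apply: nU.
  by have [hgd hgE] := pactM act gz hd; exists (h * g)%g => //; split => //=; rewrite hgE.
Qed.

End invariant_sets.

Lemma ae_fst {R : realType} d1 {T1 : measurableType d1} d2 {T2 : measurableType d2}
    (P1 : {sigma_finite_measure set T1 -> \bar R})
    (P2 : {sigma_finite_measure set T2 -> \bar R}) (Q : T1 -> Prop) :
  {ae P1, forall x, Q x} -> {ae (P1 \x P2)%E, forall z, Q z.1}.
Proof.
move=> [N [mN N0 QN]]; exists (N `*` setT); split.
- exact: measurableX.
- have := @product_measure1E _ _ _ _ R P1 P2 N setT mN measurableT.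
  by move=> ->; rewrite [X in (X * _)%E](_ : _ = 0%E) ?mul0e.
- by move=> z nQ; split => //; apply: QN.
Qed.

(** * Weak type inequality for the lifted family *)

Section family_weak_type.
Local Open Scope ereal_scope.
Context {R : realType} {Gamma : groupType} (countG : countable [set: Gamma]).
Context dB {B : measurableType dB}.
Variables (nu : probability B R) (actB : Gamma -> {mfun B >-> B}).
Hypothesis actB_action : is_action actB.
Hypothesis actB_mcp : class_preserving nu actB.
Hypothesis actB_free : essentially_free nu actB.
Variables (lambda : R) (lambda01 : (0 < lambda < 1)%R).
Variables (rho : Gamma -> B -> int) (rho_R : log_RN_cocycle lambda nu actB rho).
Variables (n : nat) (II : set R) (II_index : II = nat_index \/ II = pos_index).
Variable F : R -> B * 'I_n.+1 -> set (B * 'I_n.+1).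

Local Notation Y := (B * 'I_n.+1)%type.
Local Notation mY := (nu \x theta lambda n).
Local Notation tauY := (fun g (y : Y) => stau actB rho g y).
Local Notation domY := (fun g => @sdom Gamma _ B rho n g).

Hypothesis F_borel : borel_family (@restricted_rel Gamma B n.+1 actB rho) II F.

Let lambda0 : (0 < lambda)%R. Proof. by case/andP: lambda01. Qed.

Let II0 r : II r -> (0 <= r)%R.
Proof. by case: II_index => -> => [[k _ <-]|/ltW]. Qed.

Let mrho := rho_measurable rho_R.
Let rhoM := rho_cocycle rho_R.

Let actY : partial_action mY domY tauY.
Proof.
apply: skew_partial_action => //.
by move=> g j phi mphi phi0; exact: (log_RN_change actB_action actB_mcp lambda01 rho_R).
Qed.

(* For a point with trivial stabilizer, [family_index r y] describes the
   finite set [F r y] by group elements. *)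
Definition family_index (r : R) (y : Y) : set Gamma :=
  [set g | domY g y /\ F r y (tauY g y)].

Definition free_pt (y : Y) := forall g, actB g y.1 = y.1 -> g = 1%g.

Let tauY_inj y (A : set Gamma) : free_pt y -> set_inj A (fun g => tauY g y).
Proof.
move=> fy g h _ _ [e _]; have [act1 actM] := actB_action.
have /fy e2 : actB (h^-1 * g)%g y.1 = y.1 by rewrite actM e -actM mulVg act1.
by rewrite -[g]mul1g -(mulgV h) -mulgA e2 mulg1.
Qed.

Let F_image r y : II r -> F r y = [set tauY g y | g in family_index r y].
Proof.
move=> IIr; have [Frel _ _] := F_borel; apply/seteqP; split => w.
  move=> Fw; have /restricted_relP[g gy we] := Frel r y IIr w Fw.
  by exists g => //; split => //; rewrite -we.
by move=> [g [_ ?] <-].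
Qed.

Let F_finite r y : II r -> finite_set (F r y).
Proof.
move=> IIr; have [_ _ /(_ r y IIr)] := F_borel; apply: sub_finite_set.
by move=> w Fw; exists r => //=; split.
Qed.

Lemma ecard_family_index r y : free_pt y -> II r ->
  ecard (family_index r y) = counting (F r y) :> \bar R.
Proof.
move=> fy IIr; rewrite -ecard_counting (F_image _ IIr) /ecard esum_image//.
exact: tauY_inj.
Qed.

Lemma finite_family_index r y : free_pt y -> II r -> finite_set (family_index r y).
Proof.
move=> fy IIr; apply: (@ecard_finite R); rewrite ecard_family_index//.
by rewrite /counting asboolT ?ltry//; exact: F_finite.
Qed.

Let ecard_conflicts P r y : free_pt y ->
  ecard (@conflicts R _ Y Gamma domY tauY II family_index P r y) <=
  counting (\bigcup_(s in [set s | II s /\ P s]) sf_comp (sf_inv (F s)) (F r) y) :> \bar R.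
Proof.
move=> fy; rewrite -ecard_counting.
apply: (le_ecard (e := fun k => tauY k y)); first exact: tauY_inj.
move=> k [ky [s sP [g [[gky Fs] [gy Fr]]]]]; exists s => //.
have [_ e] := pactM actY ky gky.
by exists (tauY (g * k)%g y) => //; rewrite /sf_inv /= e.
Qed.

Let ecard_hits (Y0 : set Y) r v : free_pt v ->
  ecard [set h | domY h v /\ (Y0 (tauY h v) /\ family_index r (tauY h v) h^-1%g)] <=
  counting (sf_inv (F r) v) :> \bar R.
Proof.
move=> fv; rewrite -ecard_counting.
apply: (le_ecard (e := fun k => tauY k v)); first exact: tauY_inj.
by move=> h [hv [_ [_]]]; rewrite (pactK actY).
Qed.

Let free_ae : {ae mY, forall y, free_pt y}.
Proof. exact: (ae_fst _ actB_free). Qed.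

(** [c0] is fixed before [X]: the index sets are read off the projection to [B * I], so one constant
    serves all actions on [X]. *)
Definition has_weak_type (Y0 : set Y) (c0 : R) : Prop :=
  forall dX (X : measurableType dX) (mu : probability X R)
    (actX : Gamma -> {mfun X >-> X}), is_action actX -> measure_preserving mu actX ->
  forall (f : B * X * 'I_n.+1 -> R) (eps : R), measurable_fun setT f ->
    (forall z, 0 <= f z)%R -> (0 < eps)%R ->
  exists D : set (B * X * 'I_n.+1), [/\ measurable D,
    forall z r, Y0 (z.1.1, z.2) -> II r ->
      eps%:E * ecard (family_index r (z.1.1, z.2)) <
      \esum_(g in family_index r (z.1.1, z.2))
        (f (stau (diag_action actB actX) (fun g bx => rho g bx.1) g z))%:E -> D z &
    (nu \x mu \x theta lambda n) D <= (c0 / eps)%:E *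
      \int[nu \x mu \x theta lambda n]_z (f z)%:E].

Section lifted.
Context dX {X : measurableType dX} (mu : probability X R).
Variable actX : Gamma -> {mfun X >-> X}.
Hypothesis actX_action : is_action actX.
Hypothesis actX_mp : measure_preserving mu actX.

Local Notation Z := (B * X * 'I_n.+1)%type.
Local Notation proj := (fun z : Z => (z.1.1, z.2) : Y).
Local Notation rhoZ := (fun g (bx : B * X) => rho g bx.1).
Local Notation domZ := (fun g => @sdom Gamma _ (B * X)%type rhoZ n g).
Local Notation tauZ := (fun g (z : Z) => stau (diag_action actB actX) rhoZ g z).

Lemma partial_actionZ : partial_action (nu \x mu \x theta lambda n) domZ tauZ.
Proof.
have [actB1 actBM] := actB_action; have [actX1 actXM] := actX_action.
have H := @skew_partial_action R Gamma _ (B * X)%type (nu \x mu)%E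
  (diag_action actB actX) rhoZ lambda n.
apply: H.
- split; first by move=> [b x]; rewrite /diag_action/= actB1 actX1.
  by move=> g h [b x]; rewrite /diag_action/= actBM actXM.
- exact: measurable_diag_action.
- move=> g k; rewrite -[X in measurable X]setTI.
  by apply: (measurable_fst _ _ (mrho g k)).
- by move=> g h x; rewrite rhoM.
- exact: lambda0.
- move=> g j phi mphi phi0; apply: quasi_prod => //.
  by move=> g' j' psi mpsi psi0; exact: (log_RN_change actB_action actB_mcp lambda01 rho_R).
Qed.

Lemma measurable_proj : measurable_fun setT proj.
Proof.
apply: measurable_fun_pair; last exact: measurable_snd.
exact: (measurableT_comp measurable_fst measurable_fst).
Qed.

Let mS g : measurable [set u : Z * measurableTypeR R |
  II u.2 /\ family_index u.2 (proj u.1) g].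
Proof.
have [_ mF _] := F_borel.
have mp : measurable_fun setT (fun u : Z * measurableTypeR R => proj u.1).
  exact: (measurableT_comp measurable_proj measurable_fst).
have mq : measurable_fun setT (fun u : Z * measurableTypeR R =>
    (proj u.1, tauY g (proj u.1), u.2)).
  apply: measurable_fun_pair; last exact: measurable_snd.
  apply: measurable_fun_pair => //.
  exact: (measurableT_comp (pact_meas actY g) mp).
rewrite (_ : [set u | _] =
  (setT `&` (fun u : Z * measurableTypeR R => proj u.1) @^-1` domY g) `&`
  (setT `&` (fun u : Z * measurableTypeR R => (proj u.1, tauY g (proj u.1), u.2))
    @^-1` [set u : Y * Y * measurableTypeR R | II u.2 /\ F u.2 u.1.1 u.1.2])).
  apply: measurableI; last exact: mq.
  by apply: mp => //; exact: (pact_dom actY).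
by apply/seteqP; split => u /=; rewrite /family_index /=; tauto.
Qed.

Variables (Y0 : set Y) (mY0 : measurable Y0).
Hypothesis Y0_free : forall y, Y0 y -> free_pt y.
Hypothesis Y0_nonempty : forall y r, Y0 y -> II r -> F r y !=set0.

Let mZ0 : measurable [set z : Z | Y0 (proj z)].
Proof. by rewrite -[X in measurable X]setTI; exact: measurable_proj. Qed.

Let S_fin r (z : Z) : Y0 (proj z) -> II r ->
  ecard (family_index r (proj z)) < +oo :> \bar R.
Proof.
move=> Yz IIr; rewrite ecard_family_index//; last exact: Y0_free.
by rewrite /counting asboolT ?ltry//; exact: F_finite.
Qed.

Let S_nonempty r (z : Z) : Y0 (proj z) -> II r -> family_index r (proj z) !=set0.
Proof.
move=> Yz IIr; have [w] := Y0_nonempty Yz IIr.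
by rewrite F_image// => -[g Sg _]; exists g.
Qed.

Let mfinZ : (nu \x mu \x theta lambda n) setT < +oo.
Proof. by rewrite -/((_ : probability _ _) setT) probability_setT ltry. Qed.

Lemma lifted_regular (C : R) : (0 < C)%R ->
  (forall y r, Y0 y -> II r ->
    counting (\bigcup_(s in [set s | II s /\ (s <= r)%R])
      sf_comp (sf_inv (F s)) (F r) y) <= C%:E * counting (F r y)) ->
  forall (f : Z -> R) (eps : R), measurable_fun setT f ->
    (forall z, 0 <= f z)%R -> (0 < eps)%R ->
  exists D : set Z, [/\ measurable D,
    forall z r, Y0 (proj z) -> II r -> eps%:E * ecard (family_index r (proj z)) <
      \esum_(g in family_index r (proj z)) (f (tauZ g z))%:E -> D z &
    (nu \x mu \x theta lambda n) D <= (2 * (2 * C + 1) / eps)%:E *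
      \int[nu \x mu \x theta lambda n]_z (f z)%:E].
Proof.
move=> C0 reg.
apply: (@weak_type_regular R _ Z _ mfinZ Gamma countG domZ tauZ partial_actionZ
  II [set z | Y0 (proj z)] (fun r z => family_index r (proj z))) => //.
- by move=> r z g _ [].
- split=> // z r Yz IIr; rewrite ecard_family_index//; last exact: Y0_free.
  apply: le_trans (reg _ _ Yz IIr).
  exact: (@ecard_conflicts [set s | (s <= r)%R] r (proj z) (Y0_free Yz)).
Qed.

Lemma lifted_tempered (C Cu : R) (a b : R -> R) : II = nat_index ->
  (0 <= C)%R -> (0 < Cu)%R ->
  (forall r, II r -> [/\ 0 < a r, 0 < b r & b r <= Cu * a r]%R) ->
  (forall y g, Y0 y -> domY g y -> Y0 (tauY g y)) ->
  (forall y (k : nat), Y0 y ->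
    [/\ (a k%:R)%:E <= counting (F k%:R y),
        counting (sf_inv (F k%:R) y) <= (b k%:R)%:E &
        counting (\bigcup_(j < k) sf_comp (sf_inv (F j%:R)) (F k%:R) y) <=
        C%:E * counting (F k%:R y)]) ->
  forall (f : Z -> R) (eps : R), measurable_fun setT f ->
    (forall z, 0 <= f z)%R -> (0 < eps)%R ->
  exists D : set Z, [/\ measurable D,
    forall z r, Y0 (proj z) -> II r -> eps%:E * ecard (family_index r (proj z)) <
      \esum_(g in family_index r (proj z)) (f (tauZ g z))%:E -> D z &
    (nu \x mu \x theta lambda n) D <= (2 * (2 * C + Cu) / eps)%:E *
      \int[nu \x mu \x theta lambda n]_z (f z)%:E].
Proof.
move=> IIn C0 Cu0 ab inv temp.
have IIk (k : nat) : II k%:R by rewrite IIn; exists k.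
apply: (@weak_type_tempered R _ Z _ mfinZ Gamma countG domZ tauZ partial_actionZ
  II [set z | Y0 (proj z)] (fun r z => family_index r (proj z)) _ _ _ C Cu
  (fun k => a k%:R) (fun k => b k%:R)) => //.
- by move=> r z g _ [].
- split=> //.
  + by move=> k; exact: ab.
  + move=> k z Yz; have fz := Y0_free Yz.
    have [ak _ ck] := temp _ k Yz; rewrite ecard_family_index//; split => //.
    apply: le_trans ck.
    apply: le_trans (@ecard_conflicts [set s | (s < k%:R)%R] k%:R (proj z) fz) _.
    rewrite -!ecard_counting; apply: esum_sub => // w [s [sII /= sk] sw].
    move: sII sk sw; rewrite IIn => -[j _ <-]; rewrite ltr_nat => jk sw.
    by exists j.
  + move=> k v; have [->|/set0P[h [hv [Yh _]]]] := eqVneq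
        [set h | domZ h v /\ (Y0 (proj (tauZ h v)) /\
           family_index k%:R (proj (tauZ h v)) h^-1%g)] set0.
      by rewrite /ecard esum_set0 lee_fin ltW//; have [] := ab _ (IIk k).
    (* The bound on [sf_inv] is available on [Y0] only; invariance brings [v] there from the point
       [tauZ h v] hitting it. *)
    have Yv : Y0 (proj v).
      have := inv _ h^-1%g Yh (pactV actY (g := h) (z := proj v) hv).
      by rewrite (pactK actY (g := h) (z := proj v) hv).
    have [_ bk _] := temp _ k Yv.
    apply: le_trans bk; exact: (@ecard_hits Y0 k%:R (proj v) (Y0_free Yv)).
Qed.

End lifted.

Hypothesis F_nonempty : nonempty_family mY II F.

Theorem family_weak_type :
  regular_family mY II F \/
    (uniform_family mY II F /\ tempered_family mY II F) ->
  exists Y0 c0, [/\ measurable Y0, mY (~` Y0) = 0, (0 < c0)%R,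
    forall y, Y0 y -> free_pt y & has_weak_type Y0 c0].
Proof.
move=> [[C C0 reg]|[[Cu [a [b [Cu0 unif]]]] [IIn [Ct temp]]]].
- have ae3 : {ae mY, forall y, free_pt y /\ (forall r, II r -> F r y !=set0) /\
      forall r, II r -> counting (\bigcup_(s in [set s | II s /\ (s <= r)%R])
        sf_comp (sf_inv (F s)) (F r) y) <= C%:E * counting (F r y)}.
    apply: filterS3 free_ae F_nonempty reg => y; by [].
  have [Y0 [mY0 Y00 Y0P Y0inv]] := invariant_conull countG actY ae3.
  exists Y0, (2 * (2 * C + 1))%R; split => //.
  + by rewrite mulr_gt0// addr_gt0// mulr_gt0.
  + by move=> y /Y0P[].
  + move=> dX X mu actX aX mX; apply: lifted_regular => //.
    * by move=> y /Y0P[].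
    * by move=> y r /Y0P[_ [+ _]]; exact.
    * by move=> y r /Y0P[_ [_ +]]; exact.
- have IIk (k : nat) : II k%:R by rewrite IIn; exists k.
  have ae_unif : {ae mY, forall y, forall k : nat,
      (a k%:R)%:E <= counting (F k%:R y) <= (b k%:R)%:E /\
      (a k%:R)%:E <= counting (sf_inv (F k%:R) y) <= (b k%:R)%:E}.
    by apply: ae_foralln => k; have [] := unif _ (IIk k).
  have ae3 : {ae mY, forall y, (free_pt y /\ forall r, II r -> F r y !=set0) /\
    (forall k : nat, (a k%:R)%:E <= counting (F k%:R y) <= (b k%:R)%:E /\
      (a k%:R)%:E <= counting (sf_inv (F k%:R) y) <= (b k%:R)%:E) /\
    forall k : nat, counting (\bigcup_(j < k) sf_comp (sf_inv (F j%:R)) (F k%:R) y) <=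
        Ct%:E * counting (F k%:R y)}.
    have ae2 : {ae mY, forall y, free_pt y /\ forall r, II r -> F r y !=set0}.
      by apply: filterS2 free_ae F_nonempty => y.
    by apply: filterS3 ae2 ae_unif temp => y.
  have [Y0 [mY0 Y00 Y0P Y0inv]] := invariant_conull countG actY ae3.
  (* Temperedness gives [Ct] without a sign. *)
  have C0 : (0 <= Num.max 0 Ct)%R by rewrite le_max lexx.
  exists Y0, (2 * (2 * Num.max 0 Ct + Cu))%R; split => //.
  + by rewrite mulr_gt0// ltr_wpDl// mulr_ge0.
  + by move=> y /Y0P[[]].
  + move=> dX X mu actX aX mX.
    apply: (@lifted_tempered dX X mu actX aX mX Y0 mY0 _ (Num.max 0 Ct)%R Cu a b) => //.
    * by move=> y /Y0P[[]].
    * by move=> r IIr; have [] := unif r IIr.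
    * move=> y k /Y0P[_ [/(_ k)[/andP[ak _] /andP[_ bk]] /(_ k) ck]]; split => //.
      apply: le_trans ck _; apply: lee_wpmul2r.
        by rewrite -ecard_counting ecard_ge0.
      by rewrite lee_fin le_max lexx orbT.
Qed.

End family_weak_type.

(** * From weak type to integrable majorants *)

Section average_bounds.
Context {R : realType} {T : choiceType}.

Let natr_counting (A : set T) : finite_set A ->
  counting A = (\sum_(i \in A) (1 : R))%:E.
Proof.
move=> fA; rewrite -ecard_counting /ecard esum_fset// fsbig_finite//= sumEFin.
by rewrite [in RHS]fsbig_finite.
Qed.

Lemma average_ge0 (U : T -> set T) (h : T -> R) z :
  (forall u, 0 <= h u) -> 0 <= average U h z.
Proof.
move=> h0; apply: mulr_ge0; last exact: fsumr_ge0.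
by rewrite invr_ge0 fine_ge0// -ecard_counting ecard_ge0.
Qed.

Lemma average_leD (U : T -> set T) (h h1 : T -> R) (c : R) z : 0 <= c ->
  (forall u, h u <= h1 u + c) -> average U h z <= average U h1 z + c.
Proof.
move=> c0 hh; have [fU|iU] := pselect (finite_set (U z)); last first.
  by rewrite /average /counting asboolF//= invr0 !mul0r add0r.
have [U0|/set0P[w Uw]] := eqVneq (U z) set0.
  by rewrite /average U0 !fsbig_set0 !mulr0 add0r.
rewrite /average natr_counting//=; set N := (\sum_(i \in U z) 1).
have N0 : 0 < N.
  rewrite lt_neqAle eq_sym; apply/andP; split; last exact: fsumr_ge0.
  apply/negP => /eqP /(@pfsumr_eq0 _ _ _ _ fU) H.
  have /eqP := H (fun _ _ => ler01) w Uw; by rewrite oner_eq0.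
rewrite -(ler_pM2l N0) mulrDr !mulrA mulfV ?gt_eqF// !mul1r.
rewrite /N !(fsbig_finite _ _ fU)/= mulr_suml -big_split/=; apply: ler_sum => u _.
by rewrite mul1r.
Qed.

End average_bounds.

Section average_family.
Local Open Scope ereal_scope.
Context {R : realType} {Gamma : groupType} dB {B : measurableType dB}.
Variables (actB : Gamma -> {mfun B >-> B}) (rho : Gamma -> B -> int).
Hypothesis actB_action : is_action actB.
Variables (n : nat) (II : set R) (F : R -> B * 'I_n.+1 -> set (B * 'I_n.+1)).
Hypothesis F_borel : borel_family (@restricted_rel Gamma B n.+1 actB rho) II F.
Context dX {X : measurableType dX} (actX : Gamma -> {mfun X >-> X}).

Local Notation Z := (B * X * 'I_n.+1)%type.
Local Notation proj := (fun z : Z => (z.1.1, z.2) : B * 'I_n.+1).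
Local Notation rhoZ := (fun g (bx : B * X) => rho g bx.1).
Local Notation tauZ := (fun g (z : Z) => stau (diag_action actB actX) rhoZ g z).
Local Notation relX :=
  (@restricted_rel Gamma (B * X)%type n.+1 (diag_action actB actX) rhoZ).
Local Notation index := (family_index actB rho F).

Let lift_image r z : lift_family relX F r z = [set tauZ g z | g in index r (proj z)].
Proof.
apply/seteqP; split => u.
  by move=> [Fu /restricted_relP[g gz ue]]; exists g => //; split => //=; move: Fu; rewrite ue.
by move=> [g [gz Fg] <-]; split => //; apply/restricted_relP; exists g.
Qed.

(** Freeness on [B] passes to [B * X]: distinct elements of the index set give distinct points of
    the lifted set. *)
Lemma average_lift r z (h : Z -> R) : II r -> free_pt actB (proj z) ->
  (forall u, 0 <= h u)%R ->
  (average (lift_family relX F r) h z)%:E * ecard (index r (proj z)) =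
  \esum_(g in index r (proj z)) (h (tauZ g z))%:E.
Proof.
move=> IIr fz h0; set S := index r (proj z).
have fS : finite_set S by exact: (finite_family_index actB_action F_borel fz IIr).
have injS : set_inj S (fun g => tauZ g z).
  move=> g k _ _ [e _ _].
  have act1 := actB_action.1; have actM := actB_action.2.
  have /fz e2 : actB (k^-1 * g)%g (proj z).1 = (proj z).1.
    by rewrite actM e -actM mulVg act1.
  by rewrite -[g]mul1g -(mulgV k) -mulgA e2 mulg1.
have fU : finite_set [set tauZ g z | g in S] by exact: finite_image.
have EC : ecard S = counting (lift_family relX F r z) :> \bar R.
  by rewrite -ecard_counting lift_image /ecard esum_image.
rewrite EC /average lift_image -/S.
have [S0|/set0P[g Sg]] := eqVneq S set0.
  by rewrite S0 image_set0 fsbig_set0 mulr0 mul0e esum_set0.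
have -> : \esum_(g in S) (h (tauZ g z))%:E = (\sum_(u \in [set tauZ g z | g in S]) h u)%:E.
  transitivity (\esum_(u in [set tauZ g z | g in S]) (h u)%:E).
    by rewrite esum_image// => i; rewrite lee_fin.
  by rewrite esum_fset//= ?fsumEFin// => i; rewrite lee_fin.
have cfin : (counting [set tauZ g z | g in S] : \bar R) \is a fin_num.
  by rewrite /counting asboolT.
have cgt : 0 < counting [set tauZ g z | g in S] :> \bar R.
  rewrite -ecard_counting; apply: lt_le_trans (ecard_ge1 (i := tauZ g z) _) => //.
  by exists g.
rewrite -[in X in _ * X](fineK cfin) -EFinM mulrAC mulVf ?mul1r//.
by rewrite gt_eqF// fine_gt0// cgt ltey_eq cfin.
Qed.

Variables (nu : probability B R) (lambda : R) (Y0 : set (B * 'I_n.+1)) (c0 : R).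
Hypotheses (mY0 : measurable Y0) (Y00 : (nu \x theta lambda n) (~` Y0) = 0).
Hypotheses (c00 : (0 < c0)%R) (Y0_free : forall y, Y0 y -> free_pt actB y).
Hypothesis weak : has_weak_type nu actB lambda rho II F Y0 c0.
Variable mu : probability X R.
Hypothesis actX_action : is_action actX.
Hypothesis actX_mp : measure_preserving mu actX.

(** The part of [Z] over the complement of [Y0] is null and is added to the exceptional set, so the
    conclusion holds at every point. *)
Lemma weak_type_average (h : Z -> R) (eps : R) : measurable_fun setT h ->
  (forall z, 0 <= h z)%R -> (0 < eps)%R ->
  exists D : set Z, [/\ measurable D,
    forall z r, II r -> (eps < average (lift_family relX F r) h z)%R -> D z &
    (nu \x mu \x theta lambda n) D <=
      (c0 / eps)%:E * \int[nu \x mu \x theta lambda n]_z (h z)%:E].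
Proof.
move=> mh h0 eps0.
have [D [mD DP Dle]] := weak actX_action actX_mp mh h0 eps0.
have mbad : measurable [set z : Z | ~ Y0 (proj z)].
  rewrite -[X in measurable X]setTI.
  have mp : measurable_fun setT proj.
    apply: measurable_fun_pair; last exact: measurable_snd.
    exact: (measurableT_comp measurable_fst measurable_fst).
  exact: (mp measurableT _ (measurableC mY0)).
have bad0 : (nu \x mu \x theta lambda n) [set z : Z | ~ Y0 (proj z)] = 0.
  have mind : measurable_fun setT (fun y : B * 'I_n.+1 => (\1_(~` Y0) y)%:E : \bar R).
    by apply/measurable_EFinP; exact/measurable_indicP/measurableC.
  have e1 : \int[nu \x theta lambda n]_y (\1_(~` Y0) y)%:E = 0.
    by rewrite integral_indic ?setIT//; exact: measurableC.
  rewrite -(setIT [set z : Z | _]) -integral_indic//.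
  have mindZ : measurable_fun setT (fun z : Z => (\1_[set z : Z | ~ Y0 (proj z)] z)%:E : \bar R).
    by apply/measurable_EFinP; exact/measurable_indicP.
  rewrite integral_prod_theta// -[RHS]e1 integral_prod_theta//.
  apply: eq_bigr => t _; congr (_ * _).
  rewrite fubini_tonelli1//.
  - apply: eq_integral => b _; rewrite /fubini_F.
    under eq_integral => x _ do
      rewrite (_ : \1_[set z : Z | ~ Y0 (proj z)] (b, x, t) = \1_(~` Y0) (b, t))//.
    by rewrite (integral_cst mu measurableT) [X in _ * X]probability_setT mule1.
  - exact: (measurableT_comp mindZ (pair2_measurable t)).
exists (D `|` [set z : Z | ~ Y0 (proj z)]); split.
- exact: measurableU.
- move=> z r IIr lt; have [Yz|nYz] := pselect (Y0 (proj z)); last by right.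
  left; apply: (DP z r Yz IIr).
  have fz := Y0_free Yz.
  have [S0|/set0P[g Sg]] := eqVneq (index r (proj z)) set0.
    move: lt; rewrite /average lift_image S0 image_set0 fsbig_set0 mulr0 => lt.
    by have := lt_trans eps0 lt; rewrite ltxx.
  rewrite -average_lift// lte_pmul2r ?lte_fin//.
    by rewrite ecard_counting /counting asboolT//; exact: (finite_family_index actB_action F_borel).
  exact: lt_le_trans lte01 (ecard_ge1 Sg).
- apply: le_trans Dle; apply: le_trans (measureU2 _ mD mbad) _.
  by rewrite [X in _ + X](_ : _ = 0) ?adde0//; exact: bad0.
Qed.

End average_family.

(** Half of the dyadic height a 2^k: an average above [2 * level a k] stays above [level a k] after
    the values of the function at most [level a k] are removed. *)
Definition level {R : realType} (a : R) (k : nat) : R := a * 2 ^+ k / 2.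

Section levels.
Context {R : realType}.
Implicit Types a s p : R.

Lemma level_gt0 a k : 0 < a -> 0 < level a k.
Proof. by move=> a0; rewrite divr_gt0// mulr_gt0// exprn_gt0. Qed.

Lemma levelS a k : level a k.+1 = 2 * level a k.
Proof. by rewrite /level exprS; lra. Qed.

Lemma between_levels a v : 0 < a -> a < v ->
  exists k, 2 * level a k < v <= 4 * level a k.
Proof.
move=> a0 av.
have lE k : 4 * level a k = a * 2 ^+ k.+1 by rewrite /level exprS; lra.
have lE2 k : 2 * level a k = a * 2 ^+ k by rewrite /level; lra.
have ex : exists k, v <= a * 2 ^+ k.
  exists (Num.truncn (v / a)).+1; rewrite mulrC -ler_pdivrMr//.
  apply: le_trans (ltW (truncnS_gt _)) _.
  by rewrite -natrX ler_nat ltnW// ltn_expl.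
case: (ex_minnP ex) => -[|k] vk kmin.
  by move: vk; rewrite expr0 mulr1 leNgt av.
exists k; rewrite lE lE2 vk andbT ltNge; apply/negP => /kmin.
by rewrite ltnn.
Qed.

Lemma powR2_gt1 p : 1 < p -> 1 < 2 `^ (p - 1).
Proof.
move=> p1; have := @gt0_ltr_powR R (p - 1) _ 1 2.
by rewrite powR1 subr_gt0 !nnegrE ltr1n; apply.
Qed.

(** A geometric sum of ratio 2^(p - 1) > 1, dominated by its last term. *)
Lemma sum_level_powR a p s K : 0 < a -> 1 < p -> 0 <= s ->
  \sum_(k < K) (if level a k < s then level a k `^ (p - 1) else 0) <=
  2 `^ (p - 1) / (2 `^ (p - 1) - 1) * s `^ (p - 1).
Proof.
move=> a0 p1 s0; set q := 2 `^ (p - 1).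
have q1 : 1 < q by exact: powR2_gt1.
have LS k : level a k.+1 `^ (p - 1) = q * level a k `^ (p - 1).
  by rewrite levelS powRM// ltW// level_gt0.
have full k : \sum_(i < k) level a i `^ (p - 1) <= (q - 1)^-1 * level a k `^ (p - 1).
  elim: k => [|k IH].
    by rewrite big_ord0 mulr_ge0 ?powR_ge0// invr_ge0 subr_ge0 ltW.
  rewrite big_ord_recr/= LS; apply: le_trans (lerD IH (lexx _)) _.
  rewrite le_eqVlt; apply/orP; left; apply/eqP; field.
  by rewrite subr_eq0 gt_eqF.
elim: K => [|K IH].
  by rewrite big_ord0 mulr_ge0 ?powR_ge0// divr_ge0 ?powR_ge0// subr_ge0 ltW.
rewrite big_ord_recr/=; case: ifPn => [Ks|_]; last by rewrite addr0.
apply: le_trans (_ : \sum_(i < K.+1) level a i `^ (p - 1) <= _).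
  rewrite big_ord_recr/= lerD2r; apply: ler_sum => i _.
  by case: ifP => // _; exact: powR_ge0.
apply: le_trans (full _) _; rewrite LS mulrA [(_ * q)%R]mulrC.
apply: ler_wpM2l; first by rewrite divr_ge0 ?powR_ge0// subr_ge0 ltW.
apply: ge0_ler_powR; rewrite ?nnegrE ?subr_ge0 ?(ltW p1) ?(ltW Ks)//.
by rewrite ltW// level_gt0.
Qed.

(** If level [K] is below [s], then 2^(K + 1) < 4 s / a <= (1 + s / a)^2; the square produces the
    factor 2. *)
Lemma sum_level1 a s K : 0 < a -> 0 <= s ->
  \sum_(k < K) (if level a k < s then 1 else 0) <= 2 / ln 2 * ln (1 + s / a).
Proof.
move=> a0 s0.
have l2 : 0 < ln 2 :> R by rewrite ln_gt0// ltr1n.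
have sa0 : 0 <= s / a by rewrite divr_ge0// ltW.
elim: K => [|K IH].
  rewrite big_ord0 mulr_ge0//; first by rewrite divr_ge0// ltW.
  by rewrite ln_ge0// lerDl.
rewrite big_ord_recr/=; case: ifPn => [Ks|_]; last by rewrite addr0.
apply: le_trans (_ : K.+1%:R <= _).
  rewrite -natr1 lerD2r; apply: le_trans (_ : \sum_(i < K) 1 <= _).
    by apply: ler_sum => i _; case: ifP.
  by rewrite sumr_const card_ord.
rewrite mulrAC ler_pdivlMr// mulr_natl -lnXn// mulr_natl -lnXn; last first.
  by rewrite ltr_wpDr.
rewrite ler_ln ?posrE ?exprn_gt0//; last by rewrite ltr_wpDr.
have : 2 ^+ K < 2 * (s / a).
  move: Ks; rewrite /level => Ks.
  rewrite mulrA ltr_pdivlMr// mulrC; lra.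
rewrite exprS => H; apply: le_trans (_ : 4 * (s / a) <= _); first by lra.
have : 0 <= (s / a - 1) ^+ 2 by exact: sqr_ge0.
by rewrite !expr2; nra.
Qed.

End levels.

Section strong_type.
Local Open Scope ereal_scope.
Context {R : realType} d {T : measurableType d} (m : {measure set T -> \bar R}).
Variables (J : set R) (U : R -> T -> set T) (c0 : R).
Hypothesis c0_ge0 : (0 <= c0)%R.
Hypothesis weak : forall (h : T -> R) (eps : R), measurable_fun setT h ->
  (forall z, 0 <= h z)%R -> (0 < eps)%R ->
  exists D : set T, [/\ measurable D,
    forall z r, J r -> (eps < average (U r) h z)%R -> D z &
    m D <= (c0 / eps)%:E * \int[m]_z (h z)%:E].

(** The majorant is a^p plus the p-th powers of [4 * level a k] on the exceptional sets [D k] of the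
    truncations [fk k]. The weak type bound on [m (D k)] absorbs one power of the level and leaves p
    - 1; [w] bounds the sum over [k] and stays abstract to serve both p > 1 and p = 1. *)
Lemma strong_type (p a : R) (f : T -> R) (w : R -> R) :
  (1 <= p)%R -> (0 < a)%R -> measurable_fun setT f ->
  (forall s K, 0 <= s -> s * \sum_(k < K)
    (if level a k < s then level a k `^ (p - 1) else 0) <= w s)%R ->
  exists G : T -> \bar R, [/\ measurable_fun setT G, forall z, 0 <= G z,
    forall z r, J r -> (average (U r) (fun z => `|f z|) z `^ p)%:E <= G z &
    \int[m]_z G z <= (a `^ p)%:E * m setT +
      (4 `^ p * c0)%:E * \int[m]_z (w `|f z|)%:E].
Proof.
move=> p1 a0 mf ww; have p0 : (0 <= p)%R by apply: le_trans p1.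
pose fk k z := (`|f z| * \1_[set z | (level a k < `|f z|)%R] z)%R.
have mnf : measurable_fun setT (fun z => `|f z|%R) by exact: measurableT_comp.
have mfk k : measurable_fun setT (fk k).
  apply: measurable_funM => //; apply/measurable_indicP.
  exact: (@measurable_set_lt R d T (cst (level a k)) (fun z => `|f z|%R)).
have fk0 k z : (0 <= fk k z)%R by rewrite mulr_ge0.
have /choice[D HD] k := weak (mfk k) (fk0 k) (level_gt0 k a0).
have mD k : measurable (D k) by have [] := HD k.
pose gk k z : \bar R := ((4 * level a k) `^ p)%:E * (\1_(D k) z)%:E.
have gk0 k z : 0 <= gk k z by rewrite mule_ge0// lee_fin ?powR_ge0.
have mind k : measurable_fun setT (fun z => (\1_(D k) z)%:E : \bar R).
  by apply/measurable_EFinP; exact/measurable_indicP.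
have mgk k : measurable_fun setT (gk k) by exact: emeasurable_funM.
have mS : measurable_fun setT (fun z => \sum_(k <oo) gk k z).
  by apply: ge0_emeasurable_sum.
have S0 z : 0 <= \sum_(k <oo) gk k z by exact: nneseries_ge0.
exists (fun z => (a `^ p)%:E + \sum_(k <oo) gk k z); split.
- exact: emeasurable_funD.
- by move=> z; rewrite adde_ge0// lee_fin powR_ge0.
- move=> z r Jr; set v := average _ _ z.
  have v0 : (0 <= v)%R by exact: average_ge0.
  have [va|av] := leP v a.
    apply: (@le_trans _ _ (a `^ p)%:E); last by rewrite leeDl.
    by rewrite lee_fin ge0_ler_powR// nnegrE// ltW.
  have [k /andP[kv vk]] := between_levels a0 av.
  apply: (@le_trans _ _ (gk k z)); last first.
    apply: (@le_trans _ _ (\sum_(k <oo) gk k z)); last first.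
      by rewrite leeDr// lee_fin powR_ge0.
    apply: (@le_trans _ _ (\sum_(0 <= i < k.+1) gk i z)); last exact: nneseries_lim_ge.
    by rewrite big_nat_recr//= leeDr// sume_ge0.
  rewrite /gk indicE mem_set ?mule1.
    by rewrite lee_fin ge0_ler_powR// nnegrE// (le_trans v0).
  have [_ /(_ z r Jr) DP _] := HD k; apply: DP.
  have lk := level_gt0 k a0.
  have : (v <= average (U r) (fk k) z + level a k)%R.
    apply: average_leD; first exact: ltW.
    move=> u; rewrite /fk indicE; have [lt|le] := ltP (level a k) `|f u|%R.
      by rewrite mem_set// mulr1 lerDl ltW.
    by rewrite memNset ?mulr0 ?add0r//=; apply/negP; rewrite -leNgt.
  lra.
rewrite ge0_integralD//; last by move=> z _; rewrite lee_fin powR_ge0.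
rewrite integral_cst// leeD2l// integral_nneseries//.
have mLf k : measurable_fun setT
    (fun z => (level a k `^ (p - 1))%:E * (fk k z)%:E : \bar R).
  by apply: emeasurable_funM => //; exact/measurable_EFinP.
have Lf0 k z : 0 <= (level a k `^ (p - 1))%:E * (fk k z)%:E.
  by rewrite mule_ge0// lee_fin; first exact: powR_ge0.
apply: (@le_trans _ _ (\sum_(k <oo) (4 `^ p * c0)%:E *
    \int[m]_z ((level a k `^ (p - 1))%:E * (fk k z)%:E))).
  apply: lee_nneseries => [k _ _|k _]; first exact: integral_ge0.
  have lk := level_gt0 k a0.
  rewrite /gk ge0_integralZl_EFin ?powR_ge0//.
  rewrite integral_indic// setIT ge0_integralZl_EFin ?powR_ge0//; last 2 first.
  - by move=> z _; rewrite lee_fin.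
  - exact/measurable_EFinP.
  have [_ _ Dk] := HD k.
  apply: (le_trans (lee_wpmul2l _ Dk)); first by rewrite lee_fin powR_ge0.
  rewrite !muleA -!EFinM powRM ?(ltW lk)// -{1}(mulr_powRB1 (ltW lk)); last lra.
  rewrite le_eqVlt; apply/orP; left; apply/eqP; congr (_%:E * _).
  by field; rewrite gt_eqF.
rewrite nneseriesZl; last by move=> k _; exact: integral_ge0.
apply: lee_wpmul2l; first by rewrite lee_fin mulr_ge0// powR_ge0.
rewrite -integral_nneseries//; apply: le_integral_nneg => z _.
  exact: nneseries_ge0.
apply: lime_le; first exact: is_cvg_nneseries.
apply: nearW => K; rewrite big_mkord.
under eq_bigr do rewrite -EFinM.
rewrite sumEFin lee_fin; apply: le_trans (ww _ K (normr_ge0 (f z))).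
rewrite mulr_sumr; apply: ler_sum => k _.
rewrite /fk indicE; have [lt|le] := ltP (level a k) `|f z|%R.
  by rewrite mem_set// mulr1 mulrC.
by rewrite memNset ?mulr0//=; apply/negP; rewrite -leNgt.
Qed.

End strong_type.

Lemma le_poweR {R : realType} (x y : \bar R) (r : R) : (0 <= r)%R ->
  (0 <= x -> x <= y -> x `^ r <= y `^ r)%E.
Proof.
move=> r0 x0 xy; apply: gt0_ler_poweR => //; rewrite in_itv/= leey andbT//.
exact: le_trans xy.
Qed.

Section fibre_average.
Local Open Scope ereal_scope.
Context {R : realType} d {T : measurableType d} (Q : probability T R).
Variables (lambda : R) (n : nat).
Hypothesis lambda01 : (0 < lambda < 1)%R.

Lemma theta_weight_gt0 : (0 < theta_weight lambda n 0)%R.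
Proof.
rewrite /theta_weight oppr0 powRr0 divr_gt0// big_ord_recl oppr0 powRr0.
by rewrite ltr_wpDr// sumr_ge0// => i _; exact: powR_ge0.
Qed.

Lemma theta_weight_min t : (theta_weight lambda n 0 <= theta_weight lambda n t)%R.
Proof.
rewrite /theta_weight; apply: ler_wpM2r.
  by rewrite invr_ge0 sumr_ge0// => i _; exact: powR_ge0.
by have /andP[l0 /ltW l1] := lambda01; rewrite ger_powR ?l0// lerN2.
Qed.

(** The mean over [t] is at most its largest term, hence controlled by the sum of [G] over the
    fibre. Replacing counting by [theta] costs the inverse of the smallest weight, at [t = 0]
    because [lambda < 1]. *)
Lemma fibre_average_bound (J : set R) (A : R -> T * 'I_n.+1 -> R) (p : R)
    (G : T * 'I_n.+1 -> \bar R) :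
  (0 <= p)%R -> measurable_fun setT G -> (forall z, 0 <= G z) ->
  (forall r z, 0 <= A r z)%R -> (forall z r, J r -> (A r z `^ p)%:E <= G z) ->
  exists P : T -> \bar R, [/\ measurable_fun setT P, forall x, 0 <= P x,
    forall x r, J r ->
      ((n.+1%:R^-1 * \sum_(t < n.+1) A r (x, t)) `^ p)%:E <= P x &
    \int[Q]_x P x <= (theta_weight lambda n 0)^-1%:E *
      \int[Q \x theta lambda n]_z G z].
Proof.
move=> p0 mG G0 A0 AG; have w0 := theta_weight_gt0.
have mGt t : measurable_fun setT (fun x => G (x, t)).
  exact: (measurableT_comp mG (pair2_measurable t)).
exists (fun x => \sum_(t < n.+1) G (x, t)); split.
- exact: emeasurable_sum.
- by move=> x; exact: sume_ge0.
- move=> x r Jr.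
  have [t tmax] : exists t, forall s, (A r (x, s) <= A r (x, t))%R.
    case: (@arg_maxP _ _ _ ord0 xpredT (fun t => A r (x, t))) => // t _ H.
    by exists t => s; exact: H.
  apply: (@le_trans _ _ (A r (x, t) `^ p)%:E); last first.
    apply: le_trans (AG _ _ Jr) _; rewrite (bigD1 t)//= leeDl//.
    exact: sume_ge0.
  have S0 : (0 <= \sum_(t < n.+1) A r (x, t))%R by exact: sumr_ge0.
  rewrite lee_fin ge0_ler_powR ?nnegrE//; first by rewrite mulr_ge0.
  rewrite ler_pdivrMl// mulr_natl.
  apply: le_trans (ler_sum _ (fun s _ => tmax s)) _.
  by rewrite sumr_const card_ord.
- rewrite ge0_integral_sum// integral_prod_theta//.
  rewrite ge0_sume_distrr; last first.
    by move=> t _; rewrite mule_ge0 ?lee_fin ?theta_weight_ge0// integral_ge0.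
  apply: lee_sum => t _; rewrite muleA -EFinM -[leLHS]mul1e.
  apply: lee_wpmul2r; first exact: integral_ge0.
  by rewrite lee_fin ler_pdivlMl// mulr1 theta_weight_min.
Qed.

End fibre_average.

(** * From majorants to the maximal function *)

Section maximal_bounds.
Local Open Scope ereal_scope.
Context {R : realType} dB {B : measurableType dB} dX {X : measurableType dX}.
Variables (nu : probability B R) (mu : probability X R) (n : nat).
Variables (J : set R) (U : R -> B * X * 'I_n.+1 -> set (B * X * 'I_n.+1)).
Variables (psi : B -> R) (f : B * X * 'I_n.+1 -> R).
Hypotheses (J0 : J !=set0) (psi_density : prob_density nu psi).

Let mean r b x : R :=
  (n.+1%:R^-1 * \sum_(t < n.+1) average (U r) (fun z => `|f z|) (b, x, t))%R.

Let mean0 r b x : (0 <= mean r b x)%R.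
Proof. by rewrite mulr_ge0// sumr_ge0// => t _; exact: average_ge0. Qed.

Let psi0 b : (0 <= psi b)%R. Proof. by have [_ +] := psi_density. Qed.
Let mpsi : measurable_fun setT psi. Proof. by have [+] := psi_density. Qed.

Lemma maximal_ge0 x : 0 <= maximal nu J U psi f x.
Proof.
have [r Jr] := J0; apply: (@le_trans _ _ (\int[nu]_b (mean r b x * psi b)%:E)).
  by apply: integral_ge0 => b _; rewrite lee_fin mulr_ge0.
by apply: ereal_sup_ubound; exists r.
Qed.

Variables (p : R) (P : B * X -> \bar R).
Hypotheses (mP : measurable_fun setT P) (P0 : forall z, 0 <= P z).
Hypothesis meanP : forall z r, J r -> (mean r z.1 z.2 `^ p)%:E <= P z.

Let mPx x : measurable_fun setT (fun b => P (b, x)).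
Proof. exact: (measurableT_comp mP (pair2_measurable x)). Qed.

Let integral_fibres : \int[mu]_x \int[nu]_b P (b, x) = \int[nu \x mu]_z P z.
Proof. by rewrite fubini_tonelli2. Qed.

Let mfibres : measurable_fun setT (fun x => \int[nu]_b P (b, x)).
Proof. exact: (@measurable_fun_fubini_tonelli_G _ _ _ _ _ nu P mP P0). Qed.

Lemma psi_Lnorm_gt0 (q : \bar R) : 0 < q -> 0 < 'N[nu]_q[EFin \o psi].
Proof.
move=> q0; rewrite lt_neqAle Lnorm_ge0 andbT eq_sym; apply/eqP.
move=> /(Lnorm_eq0_eq0 _ _) H.
have : EFin \o psi = \0 %[ae nu] by apply: H => //; exact/measurable_EFinP.
move=> /ae_eq_integral e; have [_ _] := psi_density.
rewrite [X in X = _ -> _](_ : _ = \int[nu]_b 0); last first.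
  by apply: e => //; exact/measurable_EFinP.
by rewrite integral0 => /eqP; rewrite eq_sym onee_eq0.
Qed.

Lemma maximal_hoelder q x : (1 < p)%R -> (p^-1 + q^-1 = 1)%R ->
  maximal nu J U psi f x <=
  'N[nu]_q%:E[EFin \o psi] * (\int[nu]_b P (b, x)) `^ p^-1.
Proof.
move=> p1 pq; have p0 : (0 < p)%R by apply: lt_trans p1.
have pn0 : (p != 0)%R by rewrite gt_eqF.
have q0 : (0 < q)%R.
  rewrite -invr_gt0; have := invf_lt1 p0; rewrite p1 => ip; lra.
(* With an infinite fibre integral the right side is infinite, because the norm of [psi] is positive
   and no product of 0 with +oo occurs. *)
have [Poo|Pfin] := eqVneq (\int[nu]_b P (b, x)) +oo.
  by rewrite Poo poweRyr ?invr_eq0 ?gt_eqF// gt0_muley ?leey// psi_Lnorm_gt0.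
have iP : nu.-integrable setT (fun b => P (b, x)).
  apply/integrableP; split => //; under eq_integral do rewrite gee0_abs//.
  by rewrite ltey.
apply: ge_ereal_sup => _ [r Jr <-].
pose u b := (fine (P (b, x)) `^ p^-1)%R.
have mu_ : measurable_fun setT u.
  apply: (measurableT_comp (measurable_powR p^-1)).
  exact: measurableT_comp.
apply: (@le_trans _ _ (\int[nu]_b (P (b, x) `^ p^-1 * (psi b)%:E))).
  apply: le_integral_nneg => b _.
    by rewrite lee_fin; exact: mulr_ge0 (mean0 r b x) (psi0 b).
  rewrite EFinM; apply: lee_wpmul2r; first by rewrite lee_fin.
  rewrite -/(mean r b x).
  have -> : (mean r b x)%:E = (mean r b x `^ p)%:E `^ p^-1.
    by rewrite -poweR_EFin -poweRrM mulfV// poweRe1// lee_fin.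
  apply: le_poweR; rewrite ?invr_ge0 ?lee_fin ?powR_ge0 ?(ltW p0)//.
  exact: (meanP (b, x) Jr).
apply: (@le_trans _ _ 'N[nu]_1[EFin \o (u \* psi)%R]).
  rewrite Lnorm1 le_eqVlt; apply/orP; left; apply/eqP.
  apply: ae_eq_integral => //.
  - apply: emeasurable_funM; last exact/measurable_EFinP.
    exact: measurableT_comp (measurable_poweR _) (mPx x).
  - apply: measurableT_comp => //; apply/measurable_EFinP.
    exact: measurable_funM.
  - have := integrable_ae measurableT iP; apply: filterS => b /(_ I) Pb _.
    rewrite gee0_abs; last by rewrite lee_fin mulr_ge0// powR_ge0.
    rewrite /=.
    by rewrite EFinM /u -[in LHS](fineK Pb) poweR_EFin.
apply: le_trans (hoelder nu mu_ mpsi p0 q0 pq) _.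
rewrite muleC; apply: lee_wpmul2l; first exact: Lnorm_ge0.
rewrite unlock; apply: le_poweR; rewrite ?invr_ge0 ?(ltW p0)//.
  by apply: integral_ge0 => b _; exact: poweR_ge0.
apply: le_integral_nneg => b _; first exact: poweR_ge0.
rewrite /= /u ger0_norm ?powR_ge0// -powRrM mulVf ?gt_eqF// powRr1 ?fine_ge0//.
by case: (P (b, x)) (P0 (b, x)) => [s||] // _; rewrite leey.
Qed.

Lemma Lnorm_maximal q : (1 < p)%R -> (p^-1 + q^-1 = 1)%R ->
  'N[mu]_p%:E[maximal nu J U psi f] <=
  'N[nu]_q%:E[EFin \o psi] * (\int[nu \x mu]_z P z) `^ p^-1.
Proof.
move=> p1 pq; have p0 : (0 < p)%R by apply: lt_trans p1.
have pn0 : (p != 0)%R by rewrite gt_eqF.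
have K0 : 0 <= 'N[nu]_q%:E[EFin \o psi] by exact: Lnorm_ge0.
set K := 'N[nu]__[_] in K0 *.
have I0 : 0 <= \int[nu \x mu]_z P z by exact: integral_ge0.
rewrite -integral_fibres.
have -> : K * (\int[mu]_x \int[nu]_b P (b, x)) `^ p^-1 =
    (\int[mu]_x ((K `^ p) * \int[nu]_b P (b, x))) `^ p^-1.
  rewrite ge0_integralZl//; last 2 first.
  - by move=> x _; exact: integral_ge0.
  - exact: poweR_ge0.
  rewrite poweRM ?poweR_ge0//; last by apply: integral_ge0 => x _; exact: integral_ge0.
  by rewrite -poweRrM mulfV ?gt_eqF// poweRe1.
rewrite unlock; apply: le_poweR; rewrite ?invr_ge0 ?(ltW p0)//.
  by apply: integral_ge0 => x _; exact: poweR_ge0.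
apply: le_integral_nneg => x _; first exact: poweR_ge0.
rewrite gee0_abs; last exact: maximal_ge0.
rewrite -[X in _ * X]poweRe1 ?integral_ge0// -(mulVf pn0) poweRrM -poweRM ?poweR_ge0//.
apply: le_poweR; rewrite ?maximal_ge0 ?(ltW p0)//.
exact: maximal_hoelder.
Qed.

Lemma Lnorm1_maximal : p = 1%R ->
  'N[mu]_1[maximal nu J U psi f] <=
  'N[nu]_+oo[EFin \o psi] * \int[nu \x mu]_z P z.
Proof.
move=> p1; have K0 : 0 <= 'N[nu]_+oo[EFin \o psi] by exact: Lnorm_ge0.
have ae_psi : {ae nu, forall b, (psi b)%:E <= 'N[nu]_+oo[EFin \o psi]}.
  rewrite unlock ifT; last by rewrite [ltRHS]probability_setT lte01.
  apply: filterS (ess_sup_inf.ess_sup_ge nu _) => b; apply: le_trans.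
  by rewrite /= lee_fin ler_norm.
set K := 'N[nu]__[_] in K0 ae_psi *.
rewrite Lnorm1 -integral_fibres -ge0_integralZl//; last by move=> x _; exact: integral_ge0.
apply: le_integral_nneg => x _ //.
rewrite gee0_abs; last exact: maximal_ge0.
apply: ge_ereal_sup => _ [r Jr <-].
rewrite -ge0_integralZl//.
apply: (@le_trans _ _ (\int[nu]_b ((psi b)%:E * P (b, x)))).
  apply: le_integral_nneg => b _.
    by rewrite lee_fin; exact: mulr_ge0 (mean0 r b x) (psi0 b).
  rewrite EFinM muleC; apply: lee_wpmul2l; first by rewrite lee_fin.
  by have := meanP (b, x) Jr; rewrite p1 powRr1.
apply: ae_ge0_le_integral => //.
- by move=> b _; rewrite mule_ge0// lee_fin.
- by apply: emeasurable_funM => //; exact/measurable_EFinP.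
- by move=> b _; rewrite mule_ge0.
- exact: emeasurable_funM.
- by apply: filterS ae_psi => b psib _; exact: lee_wpmul2r.
Qed.

End maximal_bounds.

Section mean_bounds.
Local Open Scope ereal_scope.
Context {R : realType} d {T : measurableType d} (Q : probability T R).
Variables (lambda : R) (n : nat).
Hypothesis lambda01 : (0 < lambda < 1)%R.
Variables (J : set R) (U : R -> T * 'I_n.+1 -> set (T * 'I_n.+1)) (c0 : R).
Hypothesis c0_ge0 : (0 <= c0)%R.
Hypothesis weak : forall (h : T * 'I_n.+1 -> R) (eps : R), measurable_fun setT h ->
  (forall z, 0 <= h z)%R -> (0 < eps)%R ->
  exists D : set (T * 'I_n.+1), [/\ measurable D,
    forall z r, J r -> (eps < average (U r) h z)%R -> D z &
    (Q \x theta lambda n) D <=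
      (c0 / eps)%:E * \int[Q \x theta lambda n]_z (h z)%:E].

Local Notation mean f r x :=
  (n.+1%:R^-1 * \sum_(t < n.+1) average (U r) (fun z => `|f z|) (x, t))%R.

Lemma mean_bound (p a : R) (f : T * 'I_n.+1 -> R) (w : R -> R) :
  (1 <= p)%R -> (0 < a)%R -> measurable_fun setT f ->
  (forall s K, 0 <= s -> s * \sum_(k < K)
    (if level a k < s then level a k `^ (p - 1) else 0) <= w s)%R ->
  exists P : T -> \bar R, [/\ measurable_fun setT P, forall x, 0 <= P x,
    forall x r, J r -> ((mean f r x) `^ p)%:E <= P x &
    \int[Q]_x P x <= (theta_weight lambda n 0)^-1%:E * ((a `^ p)%:E +
      (4 `^ p * c0)%:E * \int[Q \x theta lambda n]_z (w `|f z|)%:E)].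
Proof.
move=> p1 a0 mf ww.
have [G [mG G0 AG Gle]] := strong_type c0_ge0 weak p1 a0 mf ww.
have A0 r z : (0 <= average (U r) (fun z => `|f z|) z)%R by exact: average_ge0.
have p0 : (0 <= p)%R by exact: le_trans p1.
have [P [mP P0 meanP Ple]] := fibre_average_bound Q lambda01 p0 mG G0 A0 AG.
exists P; split => //; apply: le_trans Ple _.
apply: lee_wpmul2l; first by rewrite lee_fin invr_ge0 theta_weight_ge0.
by apply: le_trans Gle _; rewrite [X in _ * X + _]probability_setT mule1.
Qed.

(** [mean_bound] asks for [a > 0], which excludes taking [a] to be a vanishing norm. In that case
    the weak type inequality makes the averages vanish off a null set, and the majorant is infinite
    on that set. *)
Lemma mean_bound_null (p : R) (f : T * 'I_n.+1 -> R) :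
  (0 < p)%R -> measurable_fun setT f ->
  \int[Q \x theta lambda n]_z `|f z|%:E = 0 ->
  exists P : T -> \bar R, [/\ measurable_fun setT P, forall x, 0 <= P x,
    forall x r, J r -> ((mean f r x) `^ p)%:E <= P x & \int[Q]_x P x = 0].
Proof.
move=> p0 mf f0.
have mnf : measurable_fun setT (fun z => `|f z|%R) by exact: measurableT_comp.
have k0 (k : nat) : (0 < k.+1%:R^-1 :> R)%R by rewrite invr_gt0.
have /choice[D HD] k := weak mnf (fun z => normr_ge0 (f z)) (k0 k).
have mD k : measurable (D k) by have [] := HD k.
set E := \bigcup_k D k.
have mE : measurable E by exact: bigcupT_measurable.
have E0 : (Q \x theta lambda n) E = 0.
  apply/eqP; rewrite eq_le measure_ge0 andbT.
  apply: le_trans (generalized_Boole_inequality _ mD mE) _.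
  rewrite eseries0// => k _ _; apply/eqP; rewrite eq_le measure_ge0 andbT.
  by have [_ _] := HD k; rewrite f0 mule0.
pose G z : \bar R := if z \in E then +oo else 0.
have mG : measurable_fun setT G by exact: (measurable_indic_fun mE (measurable_cst _)).
have G0 z : 0 <= G z by rewrite /G; case: ifP.
have A0 r z : (0 <= average (U r) (fun z => `|f z|) z)%R by exact: average_ge0.
have AG z r : J r -> (average (U r) (fun z => `|f z|) z `^ p)%:E <= G z.
  move=> Jr; rewrite /G; case: ifPn => [_|/negP nE]; first exact: leey.
  suff -> : average (U r) (fun z => `|f z|)%R z = 0%R by rewrite powR0// gt_eqF.
  apply/eqP; rewrite eq_le A0 andbT; apply/ler_addgt0Pr => e e0; rewrite add0r.
  have [k ke] : exists k : nat, (k.+1%:R^-1 <= e)%R.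
    exists (Num.truncn e^-1); rewrite -[leRHS]invrK lef_pV2 ?posrE ?invr_gt0//.
    exact: ltW (truncnS_gt _).
  apply: le_trans ke; rewrite leNgt; apply/negP => lt.
  apply: nE; apply/mem_set; exists k => //.
  by have [_ DP _] := HD k; exact: DP Jr lt.
have [P [mP P0 meanP Ple]] := fibre_average_bound Q lambda01 (ltW p0) mG G0 A0 AG.
exists P; split => //; apply/eqP; rewrite eq_le integral_ge0 ?andbT//.
apply: le_trans Ple _.
rewrite (ae_eq_integral (cst 0)) ?integral0 ?mule0//.
exists E; split => // z /= nG; apply: contrapT => nE; apply: nG => _.
by rewrite /G memNset.
Qed.

End mean_bounds.

Section maximal_inequalities.
Local Open Scope ereal_scope.
Context {R : realType} dB {B : measurableType dB} dX {X : measurableType dX}.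
Variables (nu : probability B R) (mu : probability X R).
Variables (lambda : R) (n : nat).
Hypothesis lambda01 : (0 < lambda < 1)%R.
Local Notation mZ := (nu \x mu \x theta lambda n).
Variables (J : set R) (U : R -> B * X * 'I_n.+1 -> set (B * X * 'I_n.+1)) (c0 : R).
Hypotheses (J0 : J !=set0) (c0_gt0 : (0 < c0)%R).
Hypothesis weak : forall (h : B * X * 'I_n.+1 -> R) (eps : R), measurable_fun setT h ->
  (forall z, 0 <= h z)%R -> (0 < eps)%R ->
  exists D : set (B * X * 'I_n.+1), [/\ measurable D,
    forall z r, J r -> (eps < average (U r) h z)%R -> D z &
    mZ D <= (c0 / eps)%:E * \int[mZ]_z (h z)%:E].
Variables (psi : B -> R) (f : B * X * 'I_n.+1 -> R).
Hypotheses (psi_density : prob_density nu psi) (mf : measurable_fun setT f).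

Let w0 := theta_weight lambda n 0.
Let w0_gt0 : (0 < w0)%R. Proof. exact: theta_weight_gt0. Qed.

Let mnf : measurable_fun setT (fun z => `|f z|%R).
Proof. exact: measurableT_comp. Qed.

Definition maximal_const (p : R) : R :=
  (w0^-1 * (1 + 4 `^ p * c0 * (2 `^ (p - 1) / (2 `^ (p - 1) - 1))))%R.

Let levels_const_gt0 (p : R) : (1 < p)%R -> (0 < 2 `^ (p - 1) / (2 `^ (p - 1) - 1))%R.
Proof.
move=> p1; rewrite divr_gt0 ?powR_gt0// subr_gt0 powR2_gt1//.
Qed.

Lemma maximal_const_gt0 (p : R) : (1 < p)%R -> (0 < maximal_const p)%R.
Proof.
move=> p1; rewrite mulr_gt0 ?invr_gt0// ltr_pwDl// mulr_ge0 ?(ltW (levels_const_gt0 p1))//.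
by rewrite mulr_ge0 ?powR_ge0// ltW.
Qed.

Lemma maximal_Lp (p q : R) : (1 < p)%R -> (p^-1 + q^-1 = 1)%R ->
  'N[mZ]_p%:E[EFin \o f] < +oo ->
  'N[mu]_p%:E[maximal nu J U psi f] <=
  (maximal_const p `^ p^-1)%:E * 'N[nu]_q%:E[EFin \o psi] *
  'N[mZ]_p%:E[EFin \o f].
Proof.
move=> p1 pq Nfin; have p0 : (0 < p)%R by apply: lt_trans p1.
have pn0 : (p != 0)%R by rewrite gt_eqF.
have K0 : 0 <= 'N[nu]_q%:E[EFin \o psi] by exact: Lnorm_ge0.
have N0 : 0 <= 'N[mZ]_p%:E[EFin \o f] by exact: Lnorm_ge0.
have mEf : measurable_fun setT (EFin \o f) by exact/measurable_EFinP.
have [Nz|Nnz] := eqVneq 'N[mZ]_p%:E[EFin \o f] 0.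
  have f0 : \int[mZ]_z `|f z|%:E = 0.
    rewrite (ae_eq_integral (cst 0)) ?integral0//; first exact/measurable_EFinP.
    have := Lnorm_eq0_eq0 mEf (_ : 0 < p%:E) Nz; rewrite lte_fin => /(_ p0).
    by apply: filterS => z /= /(_ I) [->] _; rewrite normr0.
  have [P [mP P0 meanP PE]] := mean_bound_null lambda01 weak p0 mf f0.
  apply: le_trans (Lnorm_maximal mu J0 psi_density mP P0 _ p1 pq) _.
    by move=> [b x] r Jr; exact: meanP.
  rewrite PE poweR0r ?invr_eq0// mule0; apply: mule_ge0 => //.
  by apply: mule_ge0 => //; rewrite lee_fin powR_ge0.
set N := 'N[mZ]__[_] in Nfin N0 Nnz *.
have Nf : N \is a fin_num by rewrite ge0_fin_numE.
(* With the norm of [f] as base height, a^p is the integral of |f|^p, so both terms of [mean_bound]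
   are multiples of it. *)
pose a := fine N; have a0 : (0 < a)%R by rewrite fine_gt0// Nfin andbT lt_neqAle eq_sym Nnz.
pose k := (2 `^ (p - 1) / (2 `^ (p - 1) - 1))%R.
have k0 : (0 <= k)%R by exact: ltW (levels_const_gt0 p1).
have [|P [mP P0 meanP Ple]] := mean_bound lambda01 (ltW c0_gt0) weak (ltW p1) a0 mf
    (w := fun s => (k * s `^ p)%R).
  move=> s K s0; apply: le_trans (ler_wpM2l s0 (sum_level_powR K a0 p1 s0)) _.
  by rewrite mulrCA mulr_powRB1.
have PE : \int[nu \x mu]_z P z <= (maximal_const p)%:E * (a `^ p)%:E.
  apply: le_trans Ple _.
  have -> : \int[mZ]_z (k * `|f z| `^ p)%:E = k%:E * (a `^ p)%:E.
    under eq_integral do rewrite EFinM.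
    rewrite ge0_integralZl_EFin//; last first.
      apply/measurable_EFinP.
      exact: (measurableT_comp (measurable_powR p) mnf).
    by congr (_ * _); rewrite -poweR_EFin /a fineK// /N poweR_Lnorm.
  rewrite (_ : _ + _ = (a `^ p + 4 `^ p * c0 * (k * a `^ p))%:E)// -!EFinM.
  rewrite lee_fin le_eqVlt; apply/orP; left; apply/eqP.
  by rewrite /maximal_const -/k; ring.
apply: le_trans (Lnorm_maximal mu J0 psi_density mP P0 _ p1 pq) _.
  by move=> [b x] r Jr; exact: meanP.
have C0 : (0 <= maximal_const p)%R by exact: ltW (maximal_const_gt0 p1).
rewrite -muleA muleCA; apply: lee_wpmul2l => //.
apply: le_trans (le_poweR _ _ PE) _; rewrite ?invr_ge0 ?(ltW p0) ?integral_ge0//.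
rewrite -EFinM poweR_EFin powRM ?powR_ge0// -powRrM mulfV// powRr1 ?(ltW a0)//.
by rewrite EFinM /a fineK.
Qed.

Definition maximal_const1 : R := (w0^-1 * (1 + 4 * c0 * (2 / ln 2)))%R.

Lemma maximal_const1_gt0 : (0 < maximal_const1)%R.
Proof.
rewrite mulr_gt0 ?invr_gt0// ltr_pwDl// mulr_ge0 ?mulr_ge0 ?(ltW c0_gt0)//.
by rewrite invr_ge0 ln_ge0// ler1n.
Qed.

(** For each [a] admissible in the Luxemburg norm, taken as base height, the logarithmic count of
    levels reproduces the Young function at |f| / a, and both terms of the majorant become multiples
    of [a]; the infimum over [a] concludes. *)
Lemma maximal_LlogL : LlogL_norm mZ f < +oo -> 'N[nu]_+oo[EFin \o psi] < +oo ->
  'N[mu]_1[maximal nu J U psi f] <=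
  maximal_const1%:E * 'N[nu]_+oo[EFin \o psi] * LlogL_norm mZ f.
Proof.
move=> Lfin Kfin.
have K0 : 0 < 'N[nu]_+oo[EFin \o psi] by exact: psi_Lnorm_gt0.
set K := 'N[nu]__[_] in Kfin K0 *.
have Kf : K \is a fin_num by rewrite ge0_fin_numE// ltW.
have l2 : (0 < ln 2 :> R)%R by rewrite ln_gt0// ltr1n.
have C0 := maximal_const1_gt0.
have bound a : (0 < a)%R ->
    \int[mZ]_z (`|f z| / a * ln (1 + `|f z| / a))%:E <= 1 ->
    'N[mu]_1[maximal nu J U psi f] <= (maximal_const1 * fine K)%:E * a%:E.
  move=> a0 ale.
  pose w s := (2 / ln 2 * a * (s / a * ln (1 + s / a)))%R.
  have [|P [mP P0 meanP Ple]] := mean_bound lambda01 (ltW c0_gt0) weak (lexx 1%R) a0 mf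
      (w := w).
    move=> s k s0; rewrite subrr.
    under eq_bigr => i _ do rewrite powRr0.
    apply: le_trans (ler_wpM2l s0 (sum_level1 k a0 s0)) _.
    rewrite le_eqVlt; apply/orP; left; apply/eqP; rewrite /w; field.
    by rewrite !gt_eqF.
  apply: le_trans (Lnorm1_maximal mu J0 psi_density mP P0 _ erefl) _.
    by move=> [b x] r Jr; exact: meanP.
  rewrite -/K mulrC EFinM fineK// -muleA; apply: lee_wpmul2l; first exact: ltW.
  apply: le_trans Ple _.
  have we : \int[mZ]_z (w `|f z|)%:E <= (2 / ln 2 * a)%:E.
    under eq_integral do rewrite EFinM.
    rewrite ge0_integralZl_EFin//.
    - rewrite -[leRHS]mule1; apply: lee_wpmul2l => //.
      by rewrite lee_fin mulr_ge0 ?(ltW a0)// divr_ge0// ltW.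
    - move=> z _; rewrite lee_fin mulr_ge0 ?divr_ge0 ?(ltW a0)//.
      by rewrite ln_ge0// lerDl divr_ge0// ltW.
    - apply/measurable_EFinP; apply: measurable_funM; first exact: measurable_funM.
      apply: (measurableT_comp (@measurable_ln R)); apply: measurable_funD => //.
      exact: measurable_funM.
    - by rewrite mulr_ge0 ?(ltW a0)// divr_ge0// ltW.
  apply: (@le_trans _ _ (w0^-1%:E * (a%:E + (4 * c0)%:E * (2 / ln 2 * a)%:E))).
    apply: lee_wpmul2l; first by rewrite lee_fin invr_ge0 ltW.
    rewrite !powRr1 ?(ltW a0)//; apply: leeD2l.
    by apply: lee_wpmul2l => //; rewrite lee_fin mulr_ge0// ltW.
  rewrite (_ : _ + _ = (a + 4 * c0 * (2 / ln 2 * a))%:E)// -!EFinM.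
  rewrite lee_fin le_eqVlt; apply/orP; left; apply/eqP.
  by rewrite /maximal_const1; ring.
have cK : (0 < maximal_const1 * fine K)%R by rewrite mulr_gt0// fine_gt0// K0 Kfin.
rewrite -(fineK Kf) -EFinM -lee_pdivrMl//.
apply: le_ereal_inf_tmp => _ [a [a0 ale] <-].
by rewrite lee_pdivrMl//; exact: bound.
Qed.

End maximal_inequalities.

Theorem theorem5p1 (R : realType)
  (Gamma : groupType) (countable_Gamma : countable [set: Gamma])
  (dB : measure_display) (B : measurableType dB) (nu : probability B R)
  (std_B : standard_borel R B)
  (actB : Gamma -> {mfun B >-> B}) (actB_action : is_action actB)
  (actB_mcp : class_preserving nu actB) (actB_free : essentially_free nu actB)
  (lambda : R) (lambda01 : 0 < lambda < 1)
  (rho : Gamma -> B -> int) (rho_R : log_RN_cocycle lambda nu actB rho)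
  (n : nat) (II : set R) (II_index : II = nat_index \/ II = pos_index)
  (F : R -> B * 'I_n.+1 -> set (B * 'I_n.+1)) :
  let m := (nu \x theta lambda n)%E in
  let rel := @restricted_rel Gamma B n.+1 actB rho in
  borel_family rel II F ->
  nonempty_family m II F ->
  regular_family m II F \/
    [/\ asymptotically_invariant m rel II F, uniform_family m II F
      & tempered_family m II F] ->
  (forall p : R, 1 < p ->
    exists2 Cp : R, 0 < Cp &
    forall (dX : measure_display) (X : measurableType dX)
      (mu : probability X R) (actX : Gamma -> {mfun X >-> X})
      (psi : B -> R) (f : B * X * 'I_n.+1 -> R) (q : R),
      standard_borel R X -> is_action actX -> measure_preserving mu actX ->
      let relX := @restricted_rel Gamma (B * X)%type n.+1 (diag_action actB actX)
                    (fun g bx => rho g bx.1) in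
      prob_density nu psi ->
      f \in Lfun (nu \x mu \x theta lambda n)%E p%:E ->
      p^-1 + q^-1 = 1 ->
      ('N[mu]_p%:E[maximal nu II (lift_family relX F) psi f] <=
       Cp%:E * 'N[nu]_q%:E[EFin \o psi] *
       'N[(nu \x mu \x theta lambda n)%E]_p%:E[EFin \o f])%E) /\
  (exists2 C1 : R, 0 < C1 &
    forall (dX : measure_display) (X : measurableType dX)
      (mu : probability X R) (actX : Gamma -> {mfun X >-> X})
      (psi : B -> R) (f : B * X * 'I_n.+1 -> R),
      standard_borel R X -> is_action actX -> measure_preserving mu actX ->
      let relX := @restricted_rel Gamma (B * X)%type n.+1 (diag_action actB actX)
                    (fun g bx => rho g bx.1) in
      prob_density nu psi ->
      LlogL (nu \x mu \x theta lambda n)%E f ->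
      psi \in Lfun nu +oo%E ->
      ('N[mu]_1%E[maximal nu II (lift_family relX F) psi f] <=
       C1%:E * 'N[nu]_+oo%E[EFin \o psi] *
       LlogL_norm (nu \x mu \x theta lambda n)%E f)%E).
Proof.
move=> m rel F_borel F_ne F_cases.
have [Y0 [c0 [mY0 Y00 c0_gt0 Y0_free weak]]] := family_weak_type countable_Gamma
  actB_action actB_mcp actB_free lambda01 rho_R II_index F_borel F_ne
  (match F_cases with
   | or_introl reg => or_introl reg
   | or_intror (And3 _ unif temp) => or_intror (conj unif temp)
   end).
have II0 : II !=set0.
  by case: II_index => ->; [exists 0, 0%N|exists 1; exact: ltr01].
split.
- move=> p p1.
  exists (maximal_const lambda n c0 p `^ p^-1); first exact/powR_gt0/maximal_const_gt0.
  move=> dX X mu actX psi f q _ actX_action actX_mp relX psi_density /andP[].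
  rewrite inE/= => mf; rewrite inE/= => Nf pq.
  apply: maximal_Lp => //.
  exact: (weak_type_average actB_action F_borel mY0 Y00 Y0_free weak
    actX_action actX_mp).
- exists (maximal_const1 lambda n c0); first exact: maximal_const1_gt0.
  move=> dX X mu actX psi f _ actX_action actX_mp relX psi_density [mf Lf].
  move=> /andP[_]; rewrite inE/= => Npsi.
  apply: maximal_LlogL => //.
  exact: (weak_type_average actB_action F_borel mY0 Y00 Y0_free weak
    actX_action actX_mp).
Qed.
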